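(* Let $d\ge1$. Consider random walk in random environment (RWRE) on $\mathbb{Z}^d$ in an ergodic environment with a finite set $\mathcal{R}\subset\mathbb{Z}^d$ of admissible steps. Assume that $g(\omega,z)=\log p_z(\omega)$ is a member of $\mathcal{L}$. Then there exists a continuous, convex rate function $I:\mathcal{U}\to[0,\infty)$ such that, for $\mathbb{P}$-a.e. $\omega$, the distributions $Q_0^\omega\{X_n/n\in\cdot\,\}$ on $\mathcal{U}$ satisfy a large deviation principle with rate $I$. For $\zeta\in\mathrm{ri}\,\mathcal{U}$, $I(\zeta)$ is the limit of point probabilities: $$I(\zeta)=-\lim_{n\to\infty}n^{-1}\log Q_0^\omega\{X_n=\hat x_n(\zeta)\}\quad\mathbb{P}\text{-a.s.}$$
   Context: Let $\mathcal{R}\subset\mathbb{Z}^d$ be finite and nonempty, $\mathcal{G}=\{\sum_{z\in\mathcal{R}}a_z z: a_z\in\mathbb{Z}\}$, and $\mathcal{U}$ the convex hull of $\mathcal{R}$ in $\mathbb{R}^d$, with relative interior $\mathrm{ri}\,\mathcal{U}$. $(\Omega,\mathfrak{S},\mathbb{P},\{T_z:z\in\mathcal{G}\})$ is a measurable ergodic dynamical system: $(\Omega,\mathfrak S,\mathbb P)$ is a probability space, the $T_z$ are measurable commuting transformations of $\Omega$ with $T_{x+y}=T_xT_y$ and $T_0$ the identity, $\mathbb{P}$ is invariant under all $T_z$, and every event $A$ with $T_z^{-1}A=A$ for all $z\in\mathcal{R}$ has $\mathbb{P}(A)\in\{0,1\}$. RWRE: $\omega\mapsto(p_z(\omega))_{z\in\mathcal{R}}$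 is a measurable map from $\Omega$ into the space of probability distributions on $\mathcal{R}$. For fixed $\omega$, the quenched path measure $Q_0^\omega$ is the law of the Markov chain $(X_n)_{n\ge0}$ on $\mathbb{Z}^d$ with $Q_0^\omega(X_0=0)=1$ and $Q_0^\omega(X_{n+1}=y\mid X_n=x)=p_{y-x}(T_x\omega)$ (for $y-x\in\mathcal{R}$, and zero otherwise). Class $\mathcal{L}$ (here for functions on $\Omega\times\mathcal{R}$): measurable $g:\Omega\times\mathcal{R}\to\mathbb{R}$ such that for each $\tilde z\in\mathcal{R}$, $g(\cdot,\tilde z)\in L^1(\mathbb{P})$ and for every nonzero $z\in\mathcal{R}$, $$\varlimsup_{\varepsilon\searrow0}\varlimsup_{n\to\infty}\max_{x\in\mathcal{G}:|x|\le n}\frac1n\sum_{0\le k\le\varepsilon n}|g(T_{x+kz}\omega,\tilde z)|=0\quad\text{for }\mathbb{P}\text{-a.e. }\omega.$$ Lattice points $\hat x_n(\zeta)$: for each $\zeta\in\mathcal{U}$ fix weights $\beta_z(\zeta)\in[0,1]$ with $\sum_{z\in\mathcal{R}}\beta_z(\zeta)=1$ and $\zeta=\sum_z\beta_z(\zeta)z$ (rational weights if $\zeta\in\mathbb{Q}^d$), and set $\hat x_n(\zeta)=\sum_{z\in\mathcal{R}}(\lfloor n\beta_z(\zeta)\rfloor+b_z^{(n)}(\zeta))z$, where $b_z^{(n)}(\zeta)\in\{0,1\}$ are arbitrary subject to $b_z^{(n)}(\zeta)=0$ if $\beta_z(\zeta)=0$ and $\sum_zb_z^{(n)}(\zeta)=n-\sum_z\lfloor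 n\beta_z(\zeta)\rfloor$. The LDP with rate $I$ means: $\varlimsup_n n^{-1}\log Q_0^\omega\{X_n/n\in A\}\le-\inf_{A}I$ for closed $A\subset\mathcal{U}$ and $\varliminf_n n^{-1}\log Q_0^\omega\{X_n/n\in O\}\ge-\inf_{O}I$ for relatively open $O\subset\mathcal{U}$. *)

(* Defs.v *)
From HB Require Import structures.
From mathcomp Require Export all_boot all_order all_algebra.
From mathcomp Require Export finmap.
From mathcomp Require Export all_classical all_reals all_analysis.
Export Order.TTheory GRing.Theory Num.Theory numFieldNormedType.Exports.

#[export] Set Implicit Arguments.
#[export] Unset Strict Implicit.
#[export] Unset Printing Implicit Defensive.

Local Open Scope classical_set_scope.
Local Open Scope ring_scope.

Section ConvexGeometry.
Variables (R : realType) (d : nat).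
Implicit Types A : set 'rV[R]_d.

Definition convex_hull A : set 'rV[R]_d :=
  [set x | exists (m : nat) (v : 'I_m -> 'rV[R]_d) (a : 'I_m -> R),
    [/\ forall i, A (v i), forall i, 0 <= a i,
        \sum_i a i = 1 & x = \sum_i a i *: v i]].

Definition affine_hull A : set 'rV[R]_d :=
  [set x | exists (m : nat) (v : 'I_m -> 'rV[R]_d) (a : 'I_m -> R),
    [/\ forall i, A (v i), \sum_i a i = 1 & x = \sum_i a i *: v i]].

Definition relative_interior A : set 'rV[R]_d :=
  [set x | A x /\ \forall y \near x, affine_hull A y -> A y].

End ConvexGeometry.

Section Lattice.
Variable d : nat.
Implicit Types steps : {fset 'rV[int]_d}.

Definition to_real (R : realType) (z : 'rV[int]_d) : 'rV[R]_d :=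
  map_mx intr z.

Definition step_group steps : set 'rV[int]_d :=
  [set x | exists a : 'rV[int]_d -> int, x = \sum_(z <- steps) z *~ a z].

Definition step_hull (R : realType) steps : set 'rV[R]_d :=
  convex_hull [set to_real R z | z in [set` steps]].

Definition euclidean_norm (R : realType) (x : 'rV[int]_d) : R :=
  Num.sqrt (\sum_i (x 0 i)%:~R ^+ 2).

End Lattice.

Arguments step_hull {d} R steps _.

Section Environment.
Variables (R : realType) (d : nat) (steps : {fset 'rV[int]_d}).
Variables (disp : measure_display) (Omega : measurableType disp).
Variable P : probability Omega R.

(* [T] is a total function of the lattice vector; only its values on the group
   generated by the steps are constrained. *)
Definition measurable_system (T : 'rV[int]_d -> Omega -> Omega) : Prop :=
  [/\ forall x, step_group steps x -> measurable_fun setT (T x),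
      forall x y, step_group steps x -> step_group steps y ->
        forall w, T (x + y) w = T x (T y w),
      forall w, T 0 w = w &
      forall x, step_group steps x ->
        forall A, measurable A -> P (T x @^-1` A) = P A].

Definition ergodic (T : 'rV[int]_d -> Omega -> Omega) : Prop :=
  forall A, measurable A ->
    (forall z, z \in steps -> T z @^-1` A = A) -> P A = 0%E \/ P A = 1%E.

(* The entries [p w z] with [z] outside [steps] are irrelevant. *)
Definition random_transition (p : Omega -> 'rV[int]_d -> R) : Prop :=
  [/\ forall z, z \in steps -> measurable_fun setT (p ^~ z),
      forall w z, z \in steps -> 0 <= p w z &
      forall w, \sum_(z <- steps) p w z = 1].

(* The maximum over the finite set of lattice points is rendered as a supremum
   in the extended reals. *)
Definition orbit_max (T : 'rV[int]_d -> Omega -> Omega)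
    (g : Omega -> 'rV[int]_d -> R) (z zt : 'rV[int]_d) (w : Omega)
    (eps : R) (n : nat) : \bar R :=
  ereal_sup
    [set (n%:R^-1 * \sum_(0 <= k < (Num.truncn (eps * n%:R)).+1)
            `|g (T (x + z *+ k) w) zt|)%:E
    | x in [set x | step_group steps x /\ euclidean_norm R x <= n%:R]].

Definition classL (T : 'rV[int]_d -> Omega -> Omega)
    (g : Omega -> 'rV[int]_d -> R) : Prop :=
  forall zt, zt \in steps ->
    P.-integrable setT (EFin \o (g ^~ zt)) /\
    forall z, z \in steps -> z != 0 ->
      {ae P, forall w,
        limf_esup (fun eps : R => limn_esup (orbit_max T g z zt w eps)) 0^'+
        = 0%E}.

(* The library's [ln] is real-valued with [ln 0 = 0], so that [log p_z] be
   almost surely finite has to be said separately. *)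
Definition log_transition_in_classL (T : 'rV[int]_d -> Omega -> Omega)
    (p : Omega -> 'rV[int]_d -> R) : Prop :=
  (forall z, z \in steps -> {ae P, forall w, 0 < p w z}) /\
  classL T (fun w z => ln (p w z)).

End Environment.

(* Lattice paths form a [measurableType] only if [int] is pointed. *)
HB.instance Definition _ := isPointed.Build int 0.

Section PathMeasure.
Variables (R : realType) (d : nat).

(* Since the lattice is countable, the events [X_n = x] generate the product
   sigma-algebra on the path space. *)
Definition coordinate_events : set (set (nat -> 'rV[int]_d)) :=
  [set C | exists n x, C = [set X | X n = x]].

Definition path_space := g_sigma_algebraType coordinate_events.

Definition markov_law (x0 : 'rV[int]_d) (pi : 'rV[int]_d -> 'rV[int]_d -> R)
    (Q : probability path_space R) : Prop :=
  Q [set X : nat -> 'rV[int]_d | X 0%N = x0] = 1%E /\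
  forall (n : nat) (c : nat -> 'rV[int]_d) (y : 'rV[int]_d),
    (Q [set X : nat -> 'rV[int]_d |
          (forall i, (i <= n)%N -> X i = c i) /\ X n.+1 = y]
     = Q [set X : nat -> 'rV[int]_d | forall i, (i <= n)%N -> X i = c i]
       * (pi (c n) y)%:E)%E.

Definition rwre_kernel (steps : {fset 'rV[int]_d}) (Omega : Type)
    (T : 'rV[int]_d -> Omega -> Omega) (p : Omega -> 'rV[int]_d -> R)
    (w : Omega) (x y : 'rV[int]_d) : R :=
  if y - x \in steps then p (T x w) (y - x) else 0.

Definition quenched_law (steps : {fset 'rV[int]_d}) (Omega : Type)
    (T : 'rV[int]_d -> Omega -> Omega) (p : Omega -> 'rV[int]_d -> R)
    (Q : Omega -> probability path_space R) : Prop :=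
  forall w, markov_law 0 (rwre_kernel steps T p w) (Q w).

Definition velocity_law (Q : probability path_space R) (n : nat)
    (A : set 'rV[R]_d) : \bar R :=
  Q [set X : nat -> 'rV[int]_d | A (n%:R^-1 *: to_real R (X n))].

End PathMeasure.

Section LatticePoints.
Variables (R : realType) (d : nat) (steps : {fset 'rV[int]_d}).

Definition admissible_weights (beta : 'rV[R]_d -> 'rV[int]_d -> R) : Prop :=
  forall zeta, step_hull R steps zeta ->
    [/\ forall z, z \in steps -> 0 <= beta zeta z <= 1,
        \sum_(z <- steps) beta zeta z = 1,
        zeta = \sum_(z <- steps) beta zeta z *: to_real R z &
        (forall i, rational (zeta 0 i)) ->
        forall z, z \in steps -> rational (beta zeta z)].

Definition admissible_corrections (beta : 'rV[R]_d -> 'rV[int]_d -> R)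
    (b : nat -> 'rV[R]_d -> 'rV[int]_d -> bool) : Prop :=
  forall n zeta, step_hull R steps zeta ->
    (forall z, z \in steps -> beta zeta z = 0 -> b n zeta z = false) /\
    \sum_(z <- steps) (b n zeta z : nat)%:Z
    = n%:Z - \sum_(z <- steps) Num.floor (n%:R * beta zeta z).

Definition xhat (beta : 'rV[R]_d -> 'rV[int]_d -> R)
    (b : nat -> 'rV[R]_d -> 'rV[int]_d -> bool) (n : nat) (zeta : 'rV[R]_d)
  : 'rV[int]_d :=
  \sum_(z <- steps)
    z *~ (Num.floor (n%:R * beta zeta z) + (b n zeta z : nat)%:Z).

End LatticePoints.

Section LargeDeviations.
Variables (R : realType) (d : nat).

(* Relatively open subsets of [U] are the traces on [U] of open sets. *)
Definition large_deviation_principle (U : set 'rV[R]_d)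
    (mu : nat -> set 'rV[R]_d -> \bar R) (I : 'rV[R]_d -> R) : Prop :=
  (forall A : set 'rV[R]_d, closed A -> A `<=` U ->
     (limn_esup (fun n => (n%:R^-1)%:E * lne (mu n A))
      <= - ereal_inf [set (I x)%:E | x in A])%E) /\
  (forall V : set 'rV[R]_d, open V ->
     (- ereal_inf [set (I x)%:E | x in U `&` V]
      <= limn_einf (fun n => (n%:R^-1)%:E * lne (mu n (U `&` V))))%E).

End LargeDeviations.

(* Main.v *)
From HB Require Import structures.
Require Import Defs.
From mathcomp Require Import zify ring lra measurable_realfun.

Local Open Scope classical_set_scope.
Local Open Scope ring_scope.

(** Write [q_n(w, x)] for the quenched probability that the walk is at [x] at
    time [n].  For positive step counts [a], with total [k] and displacement [y],
    the sequence [- ln q_(nk)(w, n y)] is subadditive along the shift [T y], whose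
    iterates need not be ergodic.  Its normalised limit [F a] is nevertheless
    constant: class L makes the events "below a level infinitely often"
    invariant under every step, and a block decomposition with the maximal ergodic
    inequality bounds the upper limit by the lower one.  With [C] the mean of
    [\sum_z - ln p_z], the excess [F a - C k] is nonincreasing in every count,
    hence extends to a convex, homogeneous function [H] of nonnegative real
    weights, continuous up to the boundary of the orthant.  It depends on the
    weights only through their sum and barycenter, because real relations between
    the steps are limits of rational ones.  The rate is [I zeta = C + H g] for any
    weights [g] representing [zeta].  Class L bounds the cost of correcting the
    step counts of a path by a small proportion of [n] by a small multiple of [n],
    which compares [- ln q_n] with [n I] at nearby counts; compactness of the simplex
    makes the upper bound on probabilities uniform, and the number of reachable
    points is polynomial in [n]. *)

(** Step probabilities have no uniform lower bound, so costs of nearby paths are compared only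
    through class L, which controls sums along lines in a nonzero step direction and says nothing
    about waiting at one site. When [0] is a step, the null steps of a correction are therefore
    spread along a line of nonzero steps, which requires the counts of the correction to be
    comparable with each other. This is one reason to start from strictly positive counts. The other
    is that a block with positive counts can give up one copy of any step [z], which makes its
    asymptotic cost insensitive to the shift [T z]. Boundary weights are reached by monotonicity:
    heuristically [F b <= F a + F (b - a)], and the last term is at most [C] per step. Lower bounds
    on costs hold at all weights, upper bounds only at positive ones. The lower large deviation
    bound gets around this by moving slightly towards the uniform weights. For point probabilities
    the endpoint is fixed: a point of the relative interior has a representation with all weights
    positive, and counts rounded from other weights are carried close to a positive one along an
    integral relation that leaves the endpoint alone. *)

Lemma rational_relation_approx (R : realType) (m d : nat)
    (z : 'I_m -> 'rV[int]_d) (v : 'I_m -> R) (e : R) :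
  0 < e -> \sum_i v i = 0 -> \sum_i v i *: to_real R (z i) = 0 ->
  exists l u, [/\ (0 < l)%N, \sum_i u i = 0 :> int, \sum_i z i *~ u i = 0 &
    forall i, `|(u i)%:~R / l%:R - v i| < e].
Proof.
move=> e0 v0 vz.
pose M : 'M[rat]_(m, d + 1) :=
  row_mx (\matrix_(i, j) (z i 0 j)%:~R) (const_mx 1).
pose f : {rmorphism rat -> R} := ratr.
pose V : 'rV[R]_m := \row_i v i.
have VM : V *m map_mx f M = 0.
  rewrite map_row_mx mul_mx_row; apply/rowP => j.
  rewrite [RHS]mxE mxE; case: splitP => k jk; rewrite mxE.
    have := congr1 (fun w : 'rV_d => w 0 k) vz.
    rewrite summxE [RHS]mxE => vzk; rewrite -[RHS]vzk; apply: eq_bigr => i _.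
    by rewrite !mxE /f/= ratr_int.
  rewrite -[RHS]v0; apply: eq_bigr => i _.
  by rewrite !mxE /f/= rmorph1 mulr1.
(* Kernels commute with extension of scalars, so [V] is a real combination of rational relations.
   Rounding only the coefficients [w] of this combination gives a vector that is still an exact
   relation; clearing denominators then makes it integral. *)
have : (V <= map_mx f (kermx M))%MS by rewrite map_kermx; apply/sub_kermxP.
case/submxP => w Vw.
set K := kermx M in Vw.
pose S : R := \sum_i \sum_j `|f (K j i)| + 1.
have S0 : 0 < S.
  by rewrite ltr_wpDl// sumr_ge0// => i _; apply: sumr_ge0.
have /fin_all_exists [r r_w] : forall j, exists q : rat, `|ratr q - w 0 j| < e / S.
  move=> j; have eS : 0 < e / S by rewrite divr_gt0.
  have /rat_in_itvoo[q] : w 0 j < w 0 j + e / S by rewrite ltrDl.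
  rewrite in_itv/= => /andP[q1 q2]; exists q.
  by rewrite gtr0_norm ?subr_gt0// ltrBlDl.
pose q : 'rV[rat]_m := (\row_j r j) *m K.
have qM : q *m M = 0 by rewrite /q -mulmxA mulmx_ker mulmx0.
have q_v i : `|f (q 0 i) - v i| < e.
  have -> : v i = V 0 i by rewrite mxE.
  rewrite Vw /q !mxE rmorph_sum/= -sumrB.
  apply: le_lt_trans (ler_norm_sum _ _ _) _.
  apply: (@le_lt_trans _ _ (\sum_j e / S * `|f (K j i)|)).
    apply: ler_sum => j _; rewrite !mxE rmorphM/= -mulrBl normrM.
    by apply: ler_wpM2r => //; exact/ltW/r_w.
  rewrite -mulr_sumr mulrAC ltr_pdivrMr// ltr_pM2l//.
  rewrite /S [X in _ < X + _](bigD1 i)//= -addrA ltrDl ltr_wpDl//.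
  by apply: sumr_ge0 => k _; exact: sumr_ge0.
pose L : int := \prod_i denq (q 0 i).
have L0 : 0 < L by apply: prodr_gt0 => i _; exact: denq_gt0.
pose u (i : 'I_m) : int := numq (q 0 i) * \prod_(j | j != i) denq (q 0 j).
have uE i : (u i)%:~R = L%:~R * q 0 i :> rat.
  rewrite /u /L [X in _ = X%:~R * _](bigD1 i)// !rmorphM/= mulrAC; congr (_ * _).
  by rewrite -[X in _ = _ * X]divq_num_den mulrC divfK// intr_eq0 denq_eq0.
have LE : L%:~R = (absz L)%:R :> R by rewrite -[in LHS](gtz0_abs L0).
exists (absz L), u; split.
- by rewrite absz_gt0 gt_eqF.
- apply/eqP; rewrite -(eqr_int rat) rmorph_sum/=; apply/eqP.
  have := congr1 (fun w : 'rV_(d + 1) => w 0 (rshift d 0)) qM.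
  rewrite !mxE => qM1; rewrite -[RHS](mulr0 L%:~R) -[X in _ * X]qM1 mulr_sumr.
  by apply: eq_bigr => i _; rewrite uE row_mxEr [const_mx _ _ _]mxE mulr1.
- apply/rowP => k; apply/eqP; rewrite -(eqr_int rat); apply/eqP.
  have := congr1 (fun w : 'rV_(d + 1) => w 0 (lshift 1 k)) qM.
  rewrite !mxE => qM1; rewrite summxE rmorph_sum/=.
  rewrite -[RHS](mulr0 L%:~R) -[X in _ * X]qM1 mulr_sumr.
  apply: eq_bigr => i _; rewrite row_mxEl [X in _ * (_ * X)]mxE mulrA -uE.
  by rewrite -scaler_int mxE rmorphM/= intz.
- move=> i; have -> : (u i)%:~R / (absz L)%:R = f (q 0 i); last exact: q_v.
  rewrite -LE.
  have -> : (u i)%:~R = f ((u i)%:~R) :> R by rewrite /f/= ratr_int.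
  rewrite uE rmorphM/= ratr_int mulrC mulKf//.
  by rewrite intr_eq0 gt_eqF.
Qed.

(** * Step counts and the convex extension of a subadditive function of them *)

Definition positive_counts m (a : 'I_m -> nat) := forall i, (0 < a i)%N.

Definition total_count m (a : 'I_m -> nat) : nat := \sum_i a i.

Definition displacement d m (z : 'I_m -> 'rV[int]_d) (a : 'I_m -> nat) :=
  \sum_i z i *+ a i.

(** Serves to remove bounded errors: an inequality known up to a constant is applied to all
    multiples, and homogeneity makes the constant negligible. *)
Lemma le0_of_archi (R : realType) (x K : R) :
  (forall n, x * n.+1%:R <= K) -> x <= 0.
Proof.
move=> xK; rewrite leNgt; apply/negP => x0.
have [n] : exists n : nat, K / x < n.+1%:R.
  exists (Num.truncn (`|K / x|)); apply: (le_lt_trans (ler_norm _)).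
  exact: Num.Theory.truncnS_gt.
by rewrite ltr_pdivrMr// mulrC ltNge xK.
Qed.

(** The witness is the inverse of one plus the sum of the inverses, which also serves an empty index
    type. *)
Lemma pos_lower_bound (R : realType) (I : finType) (g : I -> R) :
  (forall i, 0 < g i) -> exists2 e, 0 < e & forall i, e <= g i.
Proof.
move=> g0; pose S := 1 + \sum_i (g i)^-1.
have S0 : 0 < S by rewrite ltr_pwDl// sumr_ge0// => i _; rewrite invr_ge0 ltW.
exists S^-1 => [|i]; first by rewrite invr_gt0.
rewrite -[leRHS]invrK lef_pV2 ?posrE ?invr_gt0//.
rewrite /S (bigD1 i)//= addrCA lerDl addr_ge0// sumr_ge0// => j _.
by rewrite invr_ge0 ltW.
Qed.

Section HomogeneousExtension.
Variables (R : realType) (m : nat) (F : ('I_m -> nat) -> R) (C : R).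
Hypothesis C_ge0 : 0 <= C.
Hypothesis F_bound : forall a, positive_counts a ->
  0 <= F a <= C * (total_count a)%:R.
Hypothesis F_hom : forall a k, positive_counts a -> (0 < k)%N ->
  F (fun i => k * a i)%N = k%:R * F a.
Hypothesis F_sub : forall a b, positive_counts a -> positive_counts b ->
  F (fun i => a i + b i)%N <= F a + F b.

(* Subtracting [C] times the number of steps makes [F] nonincreasing in every
   coordinate, so that it extends to nonnegative real weights, boundary
   included, as a supremum over the rational weights strictly above. *)
Definition excess (a : 'I_m -> nat) : R := F a - C * (total_count a)%:R.
Local Notation D := excess.

Let ext_set (g : 'I_m -> R) : set R :=
  [set r | exists a k, [/\ positive_counts a, (0 < k)%N,
     forall i, k%:R * g i < (a i)%:R & r = D a / k%:R]].

Definition extension (g : 'I_m -> R) : R := sup (ext_set g).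

Let total_countM k (a : 'I_m -> nat) :
  total_count (fun i => k * a i)%N = (k * total_count a)%N.
Proof. by rewrite /total_count big_distrr. Qed.

Let total_countD (a b : 'I_m -> nat) :
  total_count (fun i => a i + b i)%N = (total_count a + total_count b)%N.
Proof. by rewrite /total_count big_split. Qed.

Let D_le0 a : positive_counts a -> D a <= 0.
Proof. by move=> /F_bound/andP[_ ?]; rewrite /excess subr_le0. Qed.

Let D_ge a : positive_counts a -> - (C * (total_count a)%:R) <= D a.
Proof. by move=> /F_bound/andP[? _]; rewrite /excess lerDr. Qed.

Let D_hom a k : positive_counts a -> (0 < k)%N ->
  D (fun i => k * a i)%N = k%:R * D a.
Proof.
move=> a0 k0; rewrite /excess F_hom// total_countM natrM mulrBr; congr (_ - _).
by rewrite mulrCA.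
Qed.

Let D_sub a b : positive_counts a -> positive_counts b ->
  D (fun i => a i + b i)%N <= D a + D b.
Proof.
move=> a0 b0; rewrite /excess total_countD natrD mulrDr.
by have := F_sub a0 b0; lra.
Qed.

(** The difference [b - a] may vanish in some coordinates, where subadditivity does not apply. In
    [(n+1) b = n a + (b + n (b - a))] the second summand is positive and has excess at most 0, so
    [(n+1) D b <= n D a] for all [n]. *)
Let D_decr a b : positive_counts a -> (forall i, a i <= b i)%N -> D b <= D a.
Proof.
move=> a0 ab; rewrite -subr_le0; apply: (@le0_of_archi _ _ (- D a)) => n.
have b0 : positive_counts b by move=> i; exact: leq_trans (a0 i) (ab i).
have [->|n0] := posnP n; first by have := D_le0 b0; lra.
pose r i := (b i + n * (b i - a i))%N.
have r0 : positive_counts r by move=> i; rewrite addn_gt0 b0.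
have na0 : positive_counts (fun i => n * a i)%N by move=> i; rewrite muln_gt0 n0 a0.
have : D (fun i => n.+1 * b i)%N <= n%:R * D a.
  have -> : (fun i => n.+1 * b i)%N = (fun i => n * a i + r i)%N.
    apply/funext => i; rewrite /r addnCA -mulnDr subnKC//.
  by apply: (le_trans (D_sub na0 r0)); rewrite D_hom// gerDl D_le0.
by rewrite D_hom// -[n.+1]addn1 natrD; lra.
Qed.

Lemma excess_ratio a b k l : positive_counts a -> positive_counts b ->
  (0 < k)%N -> (0 < l)%N -> (forall i, k * a i <= l * b i)%N ->
  D b / k%:R <= D a / l%:R.
Proof.
move=> a0 b0 k0 l0 ab.
rewrite ler_pdivrMr ?ltr0n// mulrAC ler_pdivlMr ?ltr0n//.
rewrite mulrC (mulrC _ k%:R) -!D_hom//; apply: D_decr => // i.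
by rewrite muln_gt0 k0 a0.
Qed.

Let ext_set_ub g : ubound (ext_set g) 0.
Proof.
move=> _ [a [k [a0 k0 _ ->]]].
by rewrite pmulr_lle0 ?invr_gt0 ?ltr0n// D_le0.
Qed.

Lemma extension_ge g a k : positive_counts a -> (0 < k)%N ->
  (forall i, k%:R * g i < (a i)%:R) -> D a / k%:R <= extension g.
Proof.
move=> a0 k0 ga; apply: ub_le_sup; last by exists a, k.
by exists 0; exact: ext_set_ub.
Qed.

Let ext_nonempty g : (ext_set g) !=set0.
Proof.
pose a i := (Num.truncn `|g i|).+1.
exists (D a / 1%:R), a, 1%N; split=> // i; rewrite mul1r.
by apply: (le_lt_trans (ler_norm _)); exact: Num.Theory.truncnS_gt.
Qed.

Lemma extension_le g x :
  (forall a k, positive_counts a -> (0 < k)%N ->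
    (forall i, k%:R * g i < (a i)%:R) -> D a / k%:R <= x) -> extension g <= x.
Proof.
move=> gx; apply: ge_sup; first exact: ext_nonempty.
by move=> _ [a [k [a0 k0 ga ->]]]; exact: gx.
Qed.

Lemma extension_adherent g e : 0 < e -> exists a k, [/\ positive_counts a,
  (0 < k)%N, forall i, k%:R * g i < (a i)%:R & extension g - e < D a / k%:R].
Proof.
move=> e0; have hs : has_sup (ext_set g).
  by split; [exact: ext_nonempty|exists 0; exact: ext_set_ub].
by have [_ [a [k [a0 k0 ga ->]]]] := sup_adherent e0 hs; exists a, k.
Qed.

Lemma extension_le0 g : extension g <= 0.
Proof.
apply: extension_le => a k a0 k0 _.
by rewrite pmulr_lle0 ?invr_gt0 ?ltr0n// D_le0.
Qed.

Lemma extension_decr g g' : (forall i, g i <= g' i) ->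
  extension g' <= extension g.
Proof.
move=> gg; apply: extension_le => a k a0 k0 ga; apply: extension_ge => // i.
by apply: le_lt_trans (ga i); rewrite ler_wpM2l.
Qed.

(** For rational [t] this is homogeneity of the excess. A real [t] is replaced by [k / (n+1)] with
    [k] the integer part of [t (n+1)]; since the extension is at most 0, this costs at most
    [- extension g], a constant that disappears as [n] grows. *)
Lemma extension_scale t g : 0 < t -> (forall i, 0 <= g i) ->
  extension (fun i => t * g i) <= t * extension g.
Proof.
move=> t0 g0; rewrite -subr_le0.
apply: (@le0_of_archi _ _ (- extension g)) => n.
rewrite mulrBl lerBlDr.
pose k := Num.truncn (t * n.+1%:R).
have kt : k%:R <= t * n.+1%:R by rewrite Num.Theory.truncn_le; rewrite mulr_ge0// ltW.
have tk : t * n.+1%:R - 1 < k%:R by rewrite ltrBlDr natr1 Num.Theory.truncnS_gt.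
have h0 := extension_le0 g.
apply: (@le_trans _ _ (k%:R * extension g)); last by nra.
case: (posnP k) => [->|k0]; first by rewrite mul0r pmulr_lle0 ?extension_le0// ltr0n.
rewrite -ler_pdivlMr ?ltr0n//; apply: extension_le => a l a0 l0 ga.
rewrite ler_pdivlMr ?ltr0n// -ler_pdivrMl ?ltr0n//.
have -> : k%:R^-1 * (D a / l%:R * n.+1%:R) =
    D (fun i => n.+1 * a i)%N / (k * l)%:R.
  by rewrite D_hom// natrM invfM; ring.
apply: extension_ge => [i||i]; first by rewrite muln_gt0/= a0.
  by rewrite muln_gt0 k0.
rewrite !natrM -ltr_pdivrMl ?ltr0n//; apply: le_lt_trans (ga i).
rewrite ler_pdivrMl ?ltr0n//.
have -> : n.+1%:R * (l%:R * (t * g i)) = (t * n.+1%:R) * (l%:R * g i) by ring.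
by rewrite -mulrA ler_wpM2r// mulr_ge0.
Qed.

Lemma extension_sub g g' : (forall i, 0 <= g i) -> (forall i, 0 <= g' i) ->
  extension (fun i => g i + g' i) <= extension g + extension g'.
Proof.
move=> g0 g'0; apply: extension_le => a k a0 k0 ga.
have [e e0 ega] : exists2 e, 0 < e &
    forall i, e <= (a i)%:R - k%:R * (g i + g' i).
  by apply: pos_lower_bound => i; rewrite subr_gt0.
(* The weights [g] and [g'] are rounded up separately with denominator [l]. Each rounding adds at
   most 1, so together they cost at most [2 k] against the slack [l * e] below [l * a]. *)
have [l l0 lek] : exists2 l, (0 < l)%N & 2%:R * k%:R <= l%:R * e.
  exists (Num.truncn (2%:R * k%:R / e)).+1 => //.
  by rewrite -ler_pdivrMr//; apply/ltW/Num.Theory.truncnS_gt.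
pose up (h : 'I_m -> R) i := (Num.truncn (l%:R * h i)).+1.
have up1 h i : 0 <= h i -> (up h i)%:R <= l%:R * h i + 1.
  by move=> hi; rewrite /up -natr1 lerD2r; rewrite Num.Theory.truncn_le; rewrite mulr_ge0.
have upl h i : l%:R * h i < (up h i)%:R by exact: Num.Theory.truncnS_gt.
apply: (@le_trans _ _ (D (fun i => up g i + up g' i)%N / l%:R)).
  apply: excess_ratio => // i.
  rewrite -(ler_nat R) !natrM natrD.
  have := up1 g i (g0 i); have := up1 g' i (g'0 i); have := ega i.
  have : 0 < k%:R :> R by rewrite ltr0n.
  have : 0 < l%:R :> R by rewrite ltr0n.
  move: lek e0; set L := l%:R; set K := k%:R; set x := g i; set y := g' i.
  set U := (up g i)%:R; set V := (up g' i)%:R; set A := (a i)%:R.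
  move=> lek e0 L0 K0 h1 h2 h3.
  have : L * e <= L * (A - K * (x + y)) by rewrite ler_wpM2l// ltW.
  have : K * U <= K * (L * x + 1) by rewrite ler_wpM2l// ltW.
  have : K * V <= K * (L * y + 1) by rewrite ler_wpM2l// ltW.
  by lra.
apply: (@le_trans _ _ (D (up g) / l%:R + D (up g') / l%:R)).
  by rewrite -mulrDl ler_wpM2r ?invr_ge0// D_sub.
by apply: lerD; apply: extension_ge.
Qed.

Lemma extension_convex t g g' : 0 <= t <= 1 ->
  (forall i, 0 <= g i) -> (forall i, 0 <= g' i) ->
  extension (fun i => t * g i + (1 - t) * g' i) <=
  t * extension g + (1 - t) * extension g'.
Proof.
move=> /andP[]; rewrite le_eqVlt => /predU1P[<- _ g0 g'0|t0].
  rewrite mul0r add0r subr0 mul1r le_eqVlt; apply/orP; left; apply/eqP.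
  by congr extension; apply/funext => i; rewrite mul0r add0r mul1r.
rewrite le_eqVlt => /predU1P[-> g0 g'0|t1 g0 g'0].
  rewrite subrr mul0r addr0 mul1r le_eqVlt; apply/orP; left; apply/eqP.
  by congr extension; apply/funext => i; rewrite mul0r addr0 mul1r.
have s0 : 0 < 1 - t by lra.
apply: (le_trans (extension_sub _ _)) => [i|i|].
- by rewrite mulr_ge0// ltW.
- by rewrite mulr_ge0// ltW.
by apply: lerD; exact: extension_scale.
Qed.

(** Rounding [(n+1) g] up adds at most one step per coordinate, hence an error [C * m] that does not
    depend on [n]. On the simplex this bound is what makes the rate nonnegative. *)
Lemma extension_lower (g : 'I_m -> R) : (forall i, 0 <= g i) ->
  - (C * \sum_i g i) <= extension g.
Proof.
move=> g0; rewrite -subr_le0; apply: (@le0_of_archi _ _ (C * m%:R)) => n.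
pose a i := (Num.truncn (n.+1%:R * g i)).+1.
have : D a / n.+1%:R <= extension g.
  by apply: extension_ge => // i; exact: Num.Theory.truncnS_gt.
rewrite ler_pdivrMr// => Da.
have aS : (total_count a)%:R <= n.+1%:R * (\sum_i g i) + m%:R.
  have -> : m%:R = \sum_(i < m) 1 :> R by rewrite sumr_const card_ord.
  rewrite /total_count natr_sum mulr_sumr -big_split/=; apply: ler_sum => i _.
  by rewrite /a -natr1 lerD2r; rewrite Num.Theory.truncn_le; rewrite mulr_ge0.
have := @D_ge a (fun _ => isT).
have := ler_wpM2l C_ge0 aS.
move: Da; set x := extension g; set S := \sum_i g i; set N := n.+1%:R.
by set A := (total_count a)%:R; lra.
Qed.

(** Lower bound: rational weights strictly above [g] that almost attain the supremum are still
    strictly above every nearby [g']. Upper bound: every nearby [g'] satisfies [(1 - s) g <= g'],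
    trivially where [g] vanishes, so monotonicity and scaling give [(1 - s) * extension g]; [s] is
    chosen to make [s * (- extension g) < e]. No coordinate has to be positive. *)
Lemma extension_continuous (g : 'I_m -> R) e : (forall i, 0 <= g i) -> 0 < e ->
  exists2 r, 0 < r & forall g' : 'I_m -> R, (forall i, 0 <= g' i) ->
    (forall i, `|g' i - g i| < r) -> `|extension g' - extension g| < e.
Proof.
move=> g0 e0.
have [a [k [a0 k0 ga Da]]] := extension_adherent g e0.
have kR : 0 < k%:R :> R by rewrite ltr0n.
have [r1 r10 gr1] : exists2 r, 0 < r & forall i, r <= (a i)%:R / k%:R - g i.
  by apply: pos_lower_bound => i; rewrite subr_gt0 ltr_pdivlMr// mulrC.
pose s := e / (2 * (1 + e - extension g)).
have h0 := extension_le0 g.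
have s0 : 0 < s by rewrite divr_gt0// mulr_gt0//; lra.
have s1 : s < 1 by rewrite ltr_pdivrMr; lra.
have sH : s * (- extension g) < e.
  rewrite mulrAC ltr_pdivrMr; last lra.
  by rewrite ltr_pM2l//; lra.
have [r2 r20 gr2] : exists2 r, 0 < r &
    forall i, r <= if 0 < g i then s * g i else 1.
  by apply: pos_lower_bound => i; case: ifPn => // ?; exact: mulr_gt0.
exists (Num.min r1 r2) => [|g' g'0 gg']; first by rewrite lt_min r10.
rewrite distrC ltr_distl; apply/andP; split.
  have : extension g' <= (1 - s) * extension g.
    apply: (@le_trans _ _ (extension (fun i => (1 - s) * g i))).
      apply: extension_decr => i; have := gr2 i; case: ifPn => [gi|].
        have := gg' i; rewrite lt_min => /andP[_].
        by rewrite ltr_distl => /andP[+ _]; lra.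
      rewrite -leNgt => gi0 _; have -> : g i = 0 by apply/eqP; rewrite eq_le gi0 g0.
      by rewrite mulr0.
    by apply: extension_scale; rewrite // subr_gt0.
  lra.
have : D a / k%:R <= extension g'.
  apply: extension_ge => // i; rewrite mulrC -ltr_pdivlMr//.
  have := gg' i; rewrite lt_min => /andP[+ _].
  by rewrite ltr_distl => /andP[_ +]; have := gr1 i; lra.
lra.
Qed.

Section Fibers.
Variables (d : nat) (z : 'I_m -> 'rV[int]_d).
Hypothesis F_fiber : forall a b, positive_counts a -> positive_counts b ->
  total_count a = total_count b -> displacement z a = displacement z b ->
  F a = F b.

(** Counts [a] with denominator [k] strictly above [g'] are transported above [g] by an integral
    relation [u] with [u / l] close to [k (g - g')]. The counts [b = l a + u] have the total and
    displacement of [l a], hence the same [F], and the slack of [a] over [k g'] pays for the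
    approximation. *)
Let extension_fiber_le (g g' : 'I_m -> R) : (forall i, 0 <= g i) ->
  \sum_i g i = \sum_i g' i ->
  \sum_i g i *: to_real R (z i) = \sum_i g' i *: to_real R (z i) ->
  extension g' <= extension g.
Proof.
move=> g0 gg zgg; apply: extension_le => a k a0 k0 ga.
have [e e0 ega] : exists2 e, 0 < e & forall i, e <= (a i)%:R - k%:R * g' i.
  by apply: pos_lower_bound => i; rewrite subr_gt0.
pose v i := k%:R * (g i - g' i).
have [||l [u [l0 u0 zu uv]]] := @rational_relation_approx R m d z v e e0.
- by rewrite -mulr_sumr sumrB gg subrr mulr0.
- under eq_bigr do rewrite /v -scalerA scalerBl.
  by rewrite -scaler_sumr sumrB zgg subrr scaler0.
have laE i : (l * k)%:R * g i < l%:R * (a i)%:R + (u i)%:~R.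
  have lR : 0 < l%:R :> R by rewrite ltr0n.
  have := uv i; rewrite ltr_distl => /andP[+ _].
  rewrite ltr_pdivlMr// natrM /v; have := ega i.
  by rewrite -(ler_pM2r lR); lra.
have la0 i : 0 < l%:Z * (a i)%:Z + u i.
  rewrite -(ltr0z R) intrD intrM -!pmulrn; apply: le_lt_trans (laE i).
  by rewrite mulr_ge0.
pose b i := absz (l%:Z * (a i)%:Z + u i).
have bE i : (b i)%:Z = l%:Z * (a i)%:Z + u i by rewrite gtz0_abs.
have b0 : positive_counts b by move=> i; rewrite absz_gt0 gt_eqF.
have la_pos : positive_counts (fun i => l * a i)%N.
  by move=> i; rewrite muln_gt0 l0 a0.
have tb : total_count b = total_count (fun i => l * a i)%N.
  have totZ c : (total_count c)%:Z = \sum_i (c i)%:Z.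
    by rewrite /total_count -natz natr_sum; apply: eq_bigr => i _; rewrite natz.
  apply/eqP; rewrite -eqz_nat !totZ; under eq_bigr do rewrite bE.
  rewrite big_split/= u0 addr0; apply/eqP; apply: eq_bigr => i _.
  by rewrite PoszM.
have db : displacement z b = displacement z (fun i => l * a i)%N.
  rewrite /displacement; under eq_bigr do rewrite pmulrn bE mulrzDr.
  rewrite big_split/= zu addr0; apply: eq_bigr => i _.
  by rewrite -PoszM -pmulrn.
have Db : D b = l%:R * D a by rewrite -D_hom// /excess tb (F_fiber b0 la_pos).
have -> : D a / k%:R = D b / (l * k)%:R.
  rewrite Db natrM invfM mulrACA divff ?mul1r//.
  by rewrite pnatr_eq0 -lt0n.
apply: extension_ge => // [|i]; first by rewrite muln_gt0 l0.
apply: (lt_le_trans (laE i)).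
by rewrite [(b i)%:R]pmulrn bE intrD intrM -!pmulrn.
Qed.

Lemma extension_fiber (g g' : 'I_m -> R) : (forall i, 0 <= g i) -> (forall i, 0 <= g' i) ->
  \sum_i g i = \sum_i g' i ->
  \sum_i g i *: to_real R (z i) = \sum_i g' i *: to_real R (z i) ->
  extension g = extension g'.
Proof.
by move=> g0 g'0 gg zgg; apply/eqP; rewrite eq_le !extension_fiber_le.
Qed.

End Fibers.
End HomogeneousExtension.

(** * Ergodic theory of the step group *)

Lemma ae_forall_count d (X : measurableType d) (R : realType)
    (mu : {measure set X -> \bar R}) (I : countType) (Q : I -> X -> Prop) :
  (forall i, {ae mu, forall x, Q i x}) -> {ae mu, forall x, forall i, Q i x}.
Proof.
move=> aeQ; have : {ae mu, forall x, forall (n : nat) (i : I), choice.unpickle n = Some i -> Q i x}.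
  apply: ae_foralln => n; case: (choice.unpickle n) => [i|].
    by apply: filterS (aeQ i) => x Qx _ [<-].
  exact: aeW.
by apply: filterS => x Qx i; apply: (Qx (choice.pickle i)); rewrite choice.pickleK.
Qed.

Lemma measurable_lt_set d (X : measurableType d) (R : realType) (f g : X -> R) :
  measurable_fun setT f -> measurable_fun setT g ->
  measurable [set x | f x < g x].
Proof.
move=> mf mg; rewrite -[X in measurable X]setTI.
by have /(_ measurableT [set true]) := measurable_fun_ltr mf mg; apply.
Qed.

Section Probability.
Context d (X : measurableType d) (R : realType) (P : probability X R).

Lemma prob_EFin (A : set X) : measurable A -> exists r, P A = r%:E.
Proof. by move=> mA; exists (fine (P A)); rewrite fineK// fin_num_measure. Qed.

Lemma prob_full_ae (A : set X) : measurable A -> P A = 1%E <-> {ae P, forall x, A x}.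
Proof.
move=> mA; split => [PA|[N [mN PN subN]]].
  exists (~` A); split; [exact: measurableC| |by []].
  by rewrite probability_setC// PA subee.
apply/eqP; rewrite eq_le probability_le1//=.
have : P (~` A) = 0%E.
  by apply: (subset_measure0 _ mN) => //; exact: measurableC.
rewrite probability_setC//.
have [r Pr] := prob_EFin mA.
rewrite Pr.
by rewrite -EFinB => -[] /eqP; rewrite subr_eq0 => /eqP <-.
Qed.

Lemma ae_exists (Q : X -> Prop) : {ae P, forall x, Q x} -> exists x, Q x.
Proof.
move=> [N [mN PN subN]]; apply: contrapT => /forallNP nQ.
have : P setT = 0%E.
  by apply: (subset_measure0 _ mN) => // x _; apply: subN => /nQ.
by rewrite probability_setT => /eqP; rewrite onee_eq0.
Qed.

Lemma prob_gt0_exists (A : set X) (Q : X -> Prop) : measurable A ->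
  (0 < P A)%E -> {ae P, forall x, Q x} -> exists2 x, A x & Q x.
Proof.
move=> mA PA [N [mN PN subN]]; apply: contrapT => nQ.
suff : P A = 0%E by move: PA => /[swap] ->; rewrite ltxx.
apply: (subset_measure0 _ mN) => // x Ax; apply: subN => Qx.
by apply: nQ; exists x.
Qed.

(** Continuity from below along the events that [E n] holds for all [n >= N]. *)
Lemma ae_eventually_prob (E : nat -> set X) (e : R) :
  (forall n, measurable (E n)) -> 0 < e ->
  {ae P, forall x, \forall n \near \oo, E n x} ->
  \forall n \near \oo, ((1 - e)%:E < P (E n))%E.
Proof.
move=> mE e0 aeE.
pose B N := \bigcap_(n in [set k | (N <= k)%N]) E n.
have mB N : measurable (B N) by apply: bigcap_measurableType => n _; exact: mE.
have mU : measurable (\bigcup_N B N) by apply: bigcup_measurable => n _.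
have PU : P (\bigcup_N B N) = 1%E.
  exact/prob_full_ae.
have : P (B n) @[n --> \oo] --> 1%E.
  rewrite -PU; apply: nondecreasing_cvg_mu => // m n mn.
  by apply/subsetPset => x Bx k /= nk; apply: Bx; exact: leq_trans nk.
move=> /fine_cvgP[_] /cvgr_gt /(_ (1 - e)).
rewrite ltrBlDr ltrDl => /(_ e0); apply: filterS => n /= Bn.
apply: (@lt_le_trans _ _ (P (B n))).
  by rewrite -[P (B n)]fineK ?lte_fin// fin_num_measure.
by apply: le_measure; rewrite ?inE// => x; apply; rewrite /=.
Qed.

Section Invariance.
Variable tau : X -> X.
Hypotheses (mtau : measurable_fun setT tau)
  (ptau : forall A, measurable A -> P (tau @^-1` A) = P A).

Lemma integral_comp_invariant (f : X -> \bar R) : measurable_fun setT f ->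
  (forall x, 0 <= f x)%E -> (\int[P]_x f (tau x) = \int[P]_x f x)%E.
Proof.
move=> mf f0.
pose t : {mfun X >-> X} := HB.pack tau (isMeasurableFun.Build _ _ _ _ _ mtau).
transitivity (\int[pushforward P t]_x f x)%E.
  by rewrite ge0_integral_pushforward// preimage_setT.
by apply: eq_measure_integral => A mA _; exact: ptau.
Qed.

Lemma ae_comp_invariant (Q : X -> Prop) : {ae P, forall x, Q x} ->
  {ae P, forall x, Q (tau x)}.
Proof.
move=> [N [mN PN subN]]; exists (tau @^-1` N); split.
- by rewrite -[X in measurable X]setTI; exact: mtau.
- by rewrite ptau.
- by move=> x nQ; exact: subN.
Qed.

Lemma iter_invariant n : measurable_fun setT (iter n tau) /\
  forall A, measurable A -> P (iter n tau @^-1` A) = P A.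
Proof.
elim: n => [|n [mn pn]]; first by split; [exact: measurable_id|].
split=> [|A mA]; first exact: (measurableT_comp mtau mn).
have mA' : measurable (tau @^-1` A).
  by rewrite -[X in measurable X]setTI; exact: mtau.
by rewrite -(ptau mA) -(pn _ mA').
Qed.

Section Maximal.
Variables (phi : X -> R) (delta : R).
Hypotheses (mphi : measurable_fun setT phi) (phi_ge0 : forall x, 0 <= phi x)
  (phi_int : (\int[P]_x (phi x)%:E < +oo)%E).

Let sum_upto n x := \sum_(j < n) phi (iter j tau x).

(* Garsia's running maximum of the partial sums of [phi - delta], which
   satisfies [M_(n+1) = max 0 (phi - delta + M_n o tau)]. *)
Let Fixpoint M (n : nat) (x : X) : R :=
  if n is n'.+1 then Num.max 0 (phi x - delta + M n' (tau x)) else 0.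

Let M_ge0 n x : 0 <= M n x.
Proof. by case: n => [|n] //=; rewrite le_max lexx. Qed.

Let M_mono n x : M n x <= M n.+1 x.
Proof.
elim: n x => [|n IH] x; first exact: M_ge0.
by rewrite [leLHS]/= [leRHS]/= le_max2// lerD2l.
Qed.

Let M_measurable n : measurable_fun setT (M n).
Proof.
elim: n => [|n IH]; first exact: measurable_cst.
apply: measurable_maxr; first exact: measurable_cst.
apply: measurable_funD; first by apply: measurable_funB => //; exact: measurable_cst.
exact: measurableT_comp IH mtau.
Qed.

Let M_sum n x : sum_upto n x - n%:R * delta <= M n x.
Proof.
elim: n x => [|n IH] x; first by rewrite /sum_upto big_ord0 mul0r subrr.
rewrite /= le_max; apply/orP; right.
rewrite /sum_upto big_ord_recl/= -natr1 mulrDl mul1r.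
have := IH (tau x); rewrite /sum_upto.
have -> : \sum_(j < n) phi (iter j tau (tau x)) =
    \sum_(j < n) phi (tau (iter (0 + j) tau x)).
  by apply: eq_bigr => j _; rewrite -iterSr.
lra.
Qed.

Lemma maximal_ergodic : 0 < delta ->
  (delta%:E * P [set x | exists n, (n.+1%:R * delta < sum_upto n.+1 x)%R] <=
   \int[P]_x (phi x)%:E)%E.
Proof.
move=> delta0.
have mM0 n : measurable [set x | 0 < M n x].
  exact: (measurable_lt_set (f := cst 0) (measurable_cst _) (M_measurable n)).
have mME n : measurable_fun setT (fun x => (M n x)%:E).
  by apply/measurable_EFinP; exact: M_measurable.
have mphiE : measurable_fun setT (fun x => (phi x)%:E) by exact/measurable_EFinP.
have M_fin n : (\int[P]_x (M n x)%:E < +oo)%E.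
  elim: n => [|n IH].
    by rewrite (eq_integral (cst 0%E)) ?integral0// => x _.
  apply: (@le_lt_trans _ _ (\int[P]_x ((phi x)%:E + (M n (tau x))%:E))%E).
    apply: ge0_le_integral => //.
    - by move=> x _; rewrite lee_fin.
    - apply: emeasurable_funD => //; exact: measurableT_comp (mME n) mtau.
    - move=> x _; rewrite -EFinD lee_fin /= ge_max addr_ge0//=.
      by rewrite lerD2r lerBlDr lerDl ltW.
  rewrite ge0_integralD//.
  - rewrite (integral_comp_invariant (f := fun x => (M n x)%:E))//.
      exact: lte_add_pinfty.
    by move=> x; rewrite lee_fin.
  - by move=> x _; rewrite lee_fin.
  - by move=> x _; rewrite lee_fin.
  - exact: measurableT_comp (mME n) mtau.
(* Where [M n] is positive, the recursion and monotonicity in [n] give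
   [M n + delta <= phi + M n o tau]; elsewhere [M n = 0]. With [delta] on the left as a multiple of
   an indicator all terms are nonnegative, so integrals add without integrability side conditions;
   invariance and [M_fin] then allow the integrals of [M n] to be cancelled. *)
have key n : (delta%:E * P [set x | 0 < M n x]%R <= \int[P]_x (phi x)%:E)%E.
  have : (\int[P]_x ((M n x)%:E + delta%:E * (\1_[set x | 0 < M n x]%R x)%:E) <=
          \int[P]_x ((phi x)%:E + (M n (tau x))%:E))%E.
    apply: ge0_le_integral => //.
    - by move=> x _; rewrite adde_ge0// ?mule_ge0// lee_fin// ltW.
    - apply: emeasurable_funD => //; apply: emeasurable_funM => //.
      by apply/measurable_EFinP; exact: measurable_indic.
    - apply: emeasurable_funD => //; exact: measurableT_comp (mME n) mtau.
    - move=> x _; rewrite -EFinM -!EFinD lee_fin indicE.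
      case: (boolP (x \in _)) => [|xn]; last first.
        have -> : M n x = 0.
          apply/eqP; rewrite eq_le M_ge0 andbT leNgt.
          by apply: contra xn => xn; rewrite inE.
        by rewrite mulr0 addr0 addr_ge0.
      rewrite inE/= mulr1; case: n {mM0} => [|n]; first by rewrite /= ltxx.
      rewrite [X in 0 < X -> X + _ <= _]/= lt_max ltxx/= => /ltW M0.
      rewrite max_r//.
      by have /= := M_mono n (tau x); lra.
  rewrite ge0_integralD//; last 3 first.
  - by move=> x _; rewrite lee_fin.
  - by move=> x _; rewrite mule_ge0// lee_fin// ltW.
  - apply: emeasurable_funM => //.
    by apply/measurable_EFinP; exact: measurable_indic.
  rewrite ge0_integralD//; last 3 first.
  - by move=> x _; rewrite lee_fin.
  - by move=> x _; rewrite lee_fin.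
  - exact: measurableT_comp (mME n) mtau.
  rewrite (integral_comp_invariant (f := fun x => (M n x)%:E))//; last first.
    by move=> x; rewrite lee_fin.
  rewrite ge0_integralZl//; last 2 first.
  - by apply/measurable_EFinP; exact: measurable_indic.
  - by rewrite lee_fin ltW.
  rewrite integral_indic// setIT addeC leeD2rE//.
  rewrite ge0_fin_numE// integral_ge0// => x _; by rewrite lee_fin.
pose A n := [set x | 0 < M n x].
have mUA : measurable (\bigcup_n A n) by apply: bigcup_measurable => n _; exact: mM0.
have cA : P (A n) @[n --> \oo] --> P (\bigcup_n A n).
  apply: nondecreasing_cvg_mu => //; apply/nondecreasing_seqP => n.
  by apply/subsetPset => x /lt_le_trans; apply; exact: M_mono.
have bound : (delta%:E * P (\bigcup_n A n) <= \int[P]_x (phi x)%:E)%E.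
  have : (delta%:E * P (A n) @[n --> \oo] --> delta%:E * P (\bigcup_n A n))%E.
    by apply: cvgeZl => //.
  move=> /cvg_lim <-//; apply: lime_le; last by near=> n; exact: key.
  apply/cvg_ex; eexists; exact: cvgeZl cA.
apply: le_trans bound; apply: lee_wpmul2l; first by rewrite lee_fin ltW.
have mS n : measurable_fun setT (sum_upto n).
  by apply: measurable_sum => j; apply: measurableT_comp => //; exact: (iter_invariant j).1.
have -> : [set x | exists n, n.+1%:R * delta < sum_upto n.+1 x] =
  \bigcup_n [set x | n.+1%:R * delta < sum_upto n.+1 x].
  by apply/seteqP; split=> x /= [n]; [exists n|move=> _; exists n].
apply: le_measure; rewrite ?inE//.
  apply: bigcup_measurable => n _.
  exact: (measurable_lt_set (f := cst _) (measurable_cst _) (mS n.+1)).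
move=> x [n _] /= xn; exists n.+1 => //; rewrite /A/=.
by apply: lt_le_trans (M_sum n.+1 x); rewrite subr_gt0.
Unshelve. all: by end_near. Qed.

End Maximal.
End Invariance.
End Probability.

Section ZeroOne.
Context (R : realType) (d : nat) (steps : {fset 'rV[int]_d}).
Context disp (Omega : measurableType disp) (P : probability Omega R).
Variable T : 'rV[int]_d -> Omega -> Omega.

Lemma step_group0 : step_group steps 0.
Proof. by exists (fun=> 0); rewrite big1// => i _; rewrite mulr0z. Qed.

Lemma step_groupD x y : step_group steps x -> step_group steps y ->
  step_group steps (x + y).
Proof.
move=> [a ->] [b ->]; exists (fun z => a z + b z).
by rewrite -big_split; apply: eq_bigr => z _; rewrite mulrzDr.
Qed.

Lemma step_groupN x : step_group steps x -> step_group steps (- x).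
Proof.
move=> [a ->]; exists (fun z => - a z).
by rewrite -sumrN; apply: eq_bigr => z _; rewrite mulrNz.
Qed.

Lemma step_group_step z : z \in steps -> step_group steps z.
Proof.
move=> zs; exists (fun y => (y == z)%:Z).
rewrite (big_fsetD1 z)//= eqxx mulr1z big_seq big1 ?addr0// => y.
by rewrite in_fsetD1 => /andP[/negPf -> _].
Qed.

Hypotheses (T_system : measurable_system steps P T)
  (T_ergodic : ergodic steps P T).

(** A set almost contained in its preimage under a measure-preserving map agrees with it up to a
    null set, because both have the same mass. Almost sure invariance then passes to sums and
    inverses, hence to the whole group. *)
Lemma step_group_ae_invariant (A : set Omega) x : measurable A ->
  (forall z, z \in steps -> {ae P, forall w, A w -> A (T z w)}) ->
  step_group steps x -> {ae P, forall w, A (T x w) <-> A w}.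
Proof.
case: T_system => mT TD T0 TP mA Aae.
have pull y (Q : Omega -> Prop) : step_group steps y -> {ae P, forall w, Q w} ->
    {ae P, forall w, Q (T y w)}.
  by move=> yG; apply: ae_comp_invariant; [exact: mT|exact: TP].
have inv_step z : z \in steps -> {ae P, forall w, A (T z w) <-> A w}.
  move=> zs; have zG := step_group_step zs.
  have mTA : measurable (T z @^-1` A).
    by rewrite -[X in measurable X]setTI; exact: mT.
  have Az0 : P (A `\` T z @^-1` A) = 0%E.
    apply: measure_negligible; first exact: measurableD.
    have [N [mN PN subN]] := Aae _ zs; exists N; split=> // w [Aw nTAw].
    by apply: subN => /(_ Aw).
  have zA0 : P (T z @^-1` A `\` A) = 0%E.
    have PA : P A = P (A `&` T z @^-1` A).
      rewrite -[RHS]add0e -[X in (X + _)%E]Az0; exact: measureDI.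
    transitivity (P (T z @^-1` A) - P (T z @^-1` A `&` A))%E.
      by apply: measureD => //; rewrite ltey_eq fin_num_measure.
    by rewrite TP// setIC -PA subee// fin_num_measure.
  exists (A `\` T z @^-1` A `|` T z @^-1` A `\` A); split.
  - by apply: measurableU; exact: measurableD.
  - by rewrite measureU0//; exact: measurableD.
  - move=> w /= nAw; have [Aw|Aw] := pselect (A w).
      by left; split => // TAw; apply: nAw.
    have [TAw|TAw] := pselect (A (T z w)); first by right.
    by exfalso; apply: nAw.
have invD y y' : step_group steps y -> step_group steps y' ->
    {ae P, forall w, A (T y w) <-> A w} -> {ae P, forall w, A (T y' w) <-> A w} ->
    {ae P, forall w, A (T (y + y') w) <-> A w}.
  move=> yG y'G /(pull _ _ y'G) h1 h2; apply: filterS2 h1 h2 => w h1 h2.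
  by rewrite TD// -h2.
have invN y : step_group steps y -> {ae P, forall w, A (T y w) <-> A w} ->
    {ae P, forall w, A (T (- y) w) <-> A w}.
  move=> yG /(pull (- y)); have yG' := step_groupN yG.
  move=> /(_ yG'); apply: filterS => w.
  by rewrite -TD// subrr T0 => ->.
have inv_mul z n : z \in steps -> step_group steps (z *+ n) /\
    {ae P, forall w, A (T (z *+ n) w) <-> A w}.
  move=> zs; elim: n => [|n [nG IH]].
    by split; [exact: step_group0|apply: aeW => w; rewrite T0].
  have zG := step_group_step zs.
  rewrite mulrS; split; first exact: step_groupD.
  by apply: invD => //; exact: inv_step.
move=> [a ->].
pose Q y := step_group steps y /\ {ae P, forall w, A (T y w) <-> A w}.
suff : Q (\sum_(z <- steps) z *~ a z) by case.
rewrite big_seq; apply: (big_ind Q).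
- by split; [exact: step_group0|apply: aeW => w; rewrite T0].
- move=> y y' [yG yA] [y'G y'A]; split; first exact: step_groupD.
  exact: invD.
- move=> z zs; case: (a z) => n.
    by rewrite -pmulrn; exact: inv_mul.
  rewrite NegzE mulrNz -pmulrn; have [nG nA] := inv_mul z n.+1 zs.
  by split; [exact: step_groupN|exact: invN].
Qed.

(** Ergodicity speaks of strictly invariant events. The event [A'] that the entire orbit stays in
    [A] is strictly invariant, measurable because the lattice is countable, and almost surely equal
    to [A]. *)
Lemma ergodic_zero_one (A : set Omega) : measurable A ->
  (forall z, z \in steps -> {ae P, forall w, A w -> A (T z w)}) ->
  {ae P, forall w, A w} \/ {ae P, forall w, ~ A w}.
Proof.
move=> mA Aae; case: (T_system) => mT TD T0 TP.
pose A' := [set w | forall x, step_group steps x -> A (T x w)].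
have A'E : A' = \bigcap_n (if (choice.unpickle n : option 'rV[int]_d) is Some x then
    if `[< step_group steps x >] then T x @^-1` A else setT else setT).
  apply/seteqP; split=> w /=.
    move=> A'w n _; case: choice.unpickle => // x.
    by case: asboolP => // xG; exact: A'w.
  move=> A'w x xG; have := A'w (choice.pickle x) I.
  by rewrite choice.pickleK; case: asboolP.
have mA' : measurable A'.
  rewrite A'E; apply: bigcapT_measurable => n; case: choice.unpickle => // x.
  case: asboolP => // xG.
  by rewrite -[X in measurable X]setTI; exact: mT.
have A'A : {ae P, forall w, A' w <-> A w}.
  have : {ae P, forall w, forall x : 'rV[int]_d,
      step_group steps x -> (A (T x w) <-> A w)}.
    apply: ae_forall_count => x; have [xG|xG] := pselect (step_group steps x).
      by apply: filterS (step_group_ae_invariant mA Aae xG).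
    exact: aeW.
  apply: filterS => w Aw; split=> [/(_ 0 step_group0)|]; first by rewrite T0.
  by move=> Aw' x xG; apply/Aw.
have A'inv z : z \in steps -> T z @^-1` A' = A'.
  move=> /step_group_step zG; apply/seteqP; split=> w A'w x xG.
    have xzG : step_group steps (x - z) by apply: step_groupD => //; exact: step_groupN.
    by have := A'w _ xzG; rewrite -TD// subrK.
  by rewrite -TD//; apply: A'w; exact: step_groupD.
have [PA'|PA'] := T_ergodic mA' A'inv; [right|left].
  have : {ae P, forall w, ~ A' w} by exists A'; split=> // w /= /contrapT.
  by apply: filterS2 A'A => w h1 h2 Aw; apply: h2; apply/h1.
by move/prob_full_ae : PA' => /(_ mA'); apply: filterS2 A'A => w ->.
Qed.

End ZeroOne.

(** * Point probabilities and their path expansion *)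

Section Walk.
Variables (R : realType) (d : nat) (steps : {fset 'rV[int]_d}).
Variables (Omega : Type) (T : 'rV[int]_d -> Omega -> Omega).
Variable p : Omega -> 'rV[int]_d -> R.

(** Conditioning on the first step shifts the environment and keeps the walk at the origin, so only
    the cocycle property of [T] enters; the link with the path measure is [law_point_prob]. *)
Fixpoint point_prob (n : nat) (w : Omega) (x : 'rV[int]_d) : R :=
  if n is n'.+1 then \sum_(z <- steps) p w z * point_prob n' (T z w) (x - z)
  else (x == 0)%:R.

Hypotheses
  (TD : forall x y, step_group steps x -> step_group steps y ->
        forall w, T (x + y) w = T x (T y w))
  (T0 : forall w, T 0 w = w)
  (p_ge0 : forall w z, z \in steps -> 0 <= p w z)
  (p_sum : forall w, \sum_(z <- steps) p w z = 1).

Lemma point_prob_ge0 n w x : 0 <= point_prob n w x.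
Proof.
elim: n w x => [|n IH] w x /=; first exact: ler0n.
by rewrite big_seq sumr_ge0// => z zs; rewrite mulr_ge0// p_ge0.
Qed.

Lemma point_prob_le1 n w x : point_prob n w x <= 1.
Proof.
elim: n w x => [|n IH] w x /=; first by case: eqP.
rewrite -(p_sum w) big_seq [leRHS]big_seq; apply: ler_sum => z zs.
by rewrite ler_piMr// p_ge0.
Qed.

Lemma point_prob1 w z : z \in steps -> point_prob 1 w z = p w z.
Proof.
move=> zs; rewrite /= (big_fsetD1 z)//= subrr eqxx mulr1 big_seq big1 ?addr0// => y.
by rewrite in_fsetD1 => /andP[yz _]; rewrite subr_eq0 eq_sym (negPf yz) mulr0.
Qed.

Lemma point_prob_add n k w x y : step_group steps x ->
  point_prob n w x * point_prob k (T x w) y <= point_prob (n + k) w (x + y).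
Proof.
elim: n w x => [|n IH] w x xG.
  rewrite /=; have [->|x0] := eqVneq x 0; first by rewrite mul1r T0 !add0r.
  by rewrite mul0r point_prob_ge0.
rewrite /= mulr_suml big_seq [leRHS]big_seq; apply: ler_sum => z zs.
rewrite -mulrA ler_wpM2l ?p_ge0//.
have zG := step_group_step zs.
have xzG : step_group steps (x - z) by apply: step_groupD => //; exact: step_groupN.
have := IH (T z w) (x - z) xzG.
by rewrite -TD// subrK addrAC.
Qed.

Fixpoint path_cost (w : Omega) (s : seq 'rV[int]_d) : R :=
  if s is z :: s' then - ln (p w z) + path_cost (T z w) s' else 0.

Definition path_end (s : seq 'rV[int]_d) : 'rV[int]_d := \sum_(z <- s) z.

Lemma path_end_group s : {subset s <= steps} -> step_group steps (path_end s).
Proof.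
elim: s => [|z s IH] ss; first by rewrite /path_end big_nil; exact: step_group0.
rewrite /path_end big_cons; apply: step_groupD.
  by apply: step_group_step; apply: ss; rewrite mem_head.
by apply: IH => y ys; apply: ss; rewrite inE ys orbT.
Qed.

Lemma path_cost_cat w s t : {subset s <= steps} ->
  path_cost w (s ++ t) = path_cost w s + path_cost (T (path_end s) w) t.
Proof.
elim: s w => [|z s IH] w ss /=; first by rewrite add0r /path_end big_nil T0.
have ss' : {subset s <= steps} by move=> y ys; apply: ss; rewrite inE ys orbT.
have zG : step_group steps z by apply: step_group_step; apply: ss; rewrite mem_head.
rewrite IH// addrA -TD//; last exact: path_end_group.
by rewrite /path_end big_cons [z + _]addrC.
Qed.

(** Since [ln 0 = 0], an unreachable point has cost 0 instead of infinite cost. Hence the positivity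
    hypotheses in [point_cost_add]. *)
Definition point_cost n w x := - ln (point_prob n w x).

Lemma point_cost_ge0 n w x : 0 <= point_cost n w x.
Proof. by rewrite oppr_ge0 ln_le0// point_prob_le1. Qed.

Lemma point_cost_add n k w x y : step_group steps x ->
  0 < point_prob n w x -> 0 < point_prob k (T x w) y ->
  point_cost (n + k) w (x + y) <= point_cost n w x + point_cost k (T x w) y.
Proof.
move=> xG h1 h2; rewrite /point_cost -opprD lerN2 -lnM ?posrE//.
rewrite ler_ln ?posrE//; first exact: point_prob_add.
  exact: mulr_gt0.
by apply: lt_le_trans (point_prob_add n k w y xG); exact: mulr_gt0.
Qed.

Hypothesis p_pos : forall w z, z \in steps -> 0 < p w z.

Lemma p_le1 w z : z \in steps -> p w z <= 1.
Proof. by move=> zs; rewrite -point_prob1// point_prob_le1. Qed.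

Lemma path_cost_ge0 w s : {subset s <= steps} -> 0 <= path_cost w s.
Proof.
elim: s w => [|z s IH] w ss //=; rewrite addr_ge0//.
  by rewrite oppr_ge0 ln_le0// p_le1// ss// mem_head.
by apply: IH => y ys; apply: ss; rewrite inE ys orbT.
Qed.

Lemma point_prob_path w s : {subset s <= steps} ->
  0 < point_prob (size s) w (path_end s).
Proof.
elim: s w => [|z s IH] w ss; first by rewrite /= /path_end big_nil eqxx.
have zs : z \in steps by apply: ss; rewrite mem_head.
have ss' : {subset s <= steps} by move=> y ys; apply: ss; rewrite inE ys orbT.
have zG := step_group_step zs.
rewrite /path_end big_cons -/(path_end s).
apply: lt_le_trans (point_prob_add 1 (size s) w (path_end s) zG).
by apply: mulr_gt0; [rewrite point_prob1// p_pos|exact: IH].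
Qed.

Lemma point_cost_path w s : {subset s <= steps} ->
  point_cost (size s) w (path_end s) <= path_cost w s.
Proof.
elim: s w => [|z s IH] w ss; first by rewrite /point_cost /= /path_end big_nil eqxx ln1 oppr0.
have zs : z \in steps by apply: ss; rewrite mem_head.
have ss' : {subset s <= steps} by move=> y ys; apply: ss; rewrite inE ys orbT.
have zG := step_group_step zs.
rewrite /path_end big_cons -/(path_end s) /=.
apply: (@le_trans _ _ (- ln (p w z) + point_cost (size s) (T z w) (path_end s))).
  2: by rewrite lerD2l IH.
have := @point_cost_add 1 (size s) w z (path_end s) zG.
rewrite /point_cost point_prob1// => /(_ (p_pos _ zs) (point_prob_path _ ss')).
by [].
Qed.

Section Counts.
Variables (m : nat) (step : 'I_m -> 'rV[int]_d).
Hypothesis step_mem : forall i, step i \in steps.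

Definition counts_path (a : 'I_m -> nat) : seq 'rV[int]_d :=
  flatten [seq nseq (a i) (step i) | i <- enum 'I_m].

Lemma counts_path_mem a : {subset counts_path a <= steps}.
Proof.
by move=> x /flatten_mapP[i _ /nseqP[-> _]].
Qed.

Lemma size_counts_path a : size (counts_path a) = total_count a.
Proof.
rewrite size_flatten /shape -map_comp sumnE big_map /total_count.
by rewrite big_enum/=; apply: eq_bigr => i _; rewrite size_nseq.
Qed.

Lemma counts_path_end a : path_end (counts_path a) = displacement step a.
Proof.
rewrite /path_end /counts_path big_flatten/= big_map big_enum/=.
by apply: eq_bigr => i _; rewrite big_nseq iter_addr_0.
Qed.

Lemma displacement_group a : step_group steps (displacement step a).
Proof. by rewrite -counts_path_end; exact/path_end_group/counts_path_mem. Qed.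

Lemma point_prob_counts w a :
  0 < point_prob (total_count a) w (displacement step a).
Proof.
rewrite -size_counts_path -counts_path_end.
exact/point_prob_path/counts_path_mem.
Qed.

Lemma point_cost_counts w a :
  point_cost (total_count a) w (displacement step a) <= path_cost w (counts_path a).
Proof.
rewrite -size_counts_path -counts_path_end.
exact/point_cost_path/counts_path_mem.
Qed.

End Counts.
End Walk.

Section PathLaw.
Variables (R : realType) (d : nat).
Implicit Types Q : probability (path_space d) R.

Lemma measurable_coordinate n x :
  measurable ([set X : nat -> 'rV[int]_d | X n = x] : set (path_space d)).
Proof. by apply: sub_sigma_algebra; exists n, x. Qed.

Lemma measurable_coordinate_set n (A : set 'rV[int]_d) :
  measurable ([set X : nat -> 'rV[int]_d | A (X n)] : set (path_space d)).
Proof.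
have -> : [set X : nat -> 'rV[int]_d | A (X n)] = \bigcup_k
    (if (choice.unpickle k : option 'rV[int]_d) is Some x then
       if `[< A x >] then [set X : nat -> 'rV[int]_d | X n = x] else set0 else set0).
  apply/seteqP; split=> X /=.
    move=> AX; exists (choice.pickle (X n)) => //.
    by rewrite choice.pickleK; case: asboolP.
  by case=> k _; case: choice.unpickle => // x; case: asboolP => // Ax /= ->.
apply: bigcup_measurable => k _; case: choice.unpickle => // x.
by case: asboolP => // _; exact: measurable_coordinate.
Qed.

Let hist (n : nat) (c : nat -> 'rV[int]_d) : set (path_space d) :=
  [set X : nat -> 'rV[int]_d | forall i, (i <= n)%N -> X i = c i].

Let measurable_hist n c : measurable (hist n c).
Proof.
have -> : hist n c = \bigcap_(i in [set i | (i <= n)%N])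
    [set X : nat -> 'rV[int]_d | X i = c i].
  by apply/seteqP; split=> X hX i iN; exact: hX.
by apply: bigcap_measurableType => i _; exact: measurable_coordinate.
Qed.

Lemma split_coordinate Q (A : set (path_space d)) n (s : seq 'rV[int]_d) :
  measurable A -> uniq s ->
  (Q A = \sum_(y <- s) Q (A `&` [set X : nat -> 'rV[int]_d | X n = y]) +
         Q (A `&` [set X : nat -> 'rV[int]_d | X n \notin s]))%E.
Proof.
move=> mA; elim: s => [_|y s IH /= /andP[ys us]].
  rewrite big_nil add0e; congr (Q _); apply/seteqP; split=> X; last by case.
  by move=> AX; split.
rewrite big_cons IH// -addeA addeC -addeA; congr (_ + _)%E.
have mB : measurable (A `&` [set X : nat -> 'rV[int]_d | X n \notin s]).
  by apply: measurableI => //; exact: (measurable_coordinate_set n [set x | x \notin s]).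
transitivity (Q ((A `&` [set X : nat -> 'rV[int]_d | X n \notin s]) `\`
     [set X : nat -> 'rV[int]_d | X n = y]) +
  Q ((A `&` [set X : nat -> 'rV[int]_d | X n \notin s]) `&`
     [set X : nat -> 'rV[int]_d | X n = y]))%E.
  exact: measureDI mB (measurable_coordinate n y).
congr (Q _ + Q _)%E; apply/seteqP; split=> X /=.
- move=> [[AX Xs] Xy]; split=> //; rewrite inE negb_or Xs andbT.
  exact/eqP.
- by move=> [AX]; rewrite inE negb_or => /andP[/eqP].
- by move=> [[AX _] ->].
- by move=> [AX Xy]; rewrite Xy.
Qed.

Variables (steps : {fset 'rV[int]_d}).
Variables (Omega : Type) (T : 'rV[int]_d -> Omega -> Omega).
Variable p : Omega -> 'rV[int]_d -> R.
Hypotheses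
  (TD : forall x y, step_group steps x -> step_group steps y ->
        forall w, T (x + y) w = T x (T y w))
  (T0 : forall w, T 0 w = w)
  (p_ge0 : forall w z, z \in steps -> 0 <= p w z)
  (p_sum : forall w, \sum_(z <- steps) p w z = 1).
Variables (w : Omega) (Q : probability (path_space d) R).
Hypothesis QM : markov_law 0 (rwre_kernel steps T p w) Q.

Let shift_steps y := [seq y + z | z <- steps].

Let shift_steps_uniq y : uniq (shift_steps y).
Proof. by rewrite map_inj_uniq ?fset_uniq//; exact: addrI. Qed.

Let hist_step n c z : z \in steps ->
  Q (hist n c `&` [set X : nat -> 'rV[int]_d | X n.+1 = c n + z]) =
  (Q (hist n c) * (p (T (c n) w) z)%:E)%E.
Proof.
move=> zs; have [_ QS] := QM.
have := QS n c (c n + z); rewrite /rwre_kernel.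
by have -> : c n + z - c n = z; [rewrite addrC addKr|rewrite zs].
Qed.

(** The transition probabilities out of [c n] sum to one, so the admissible successors already
    exhaust the mass of the history. *)
Let hist_rest n c :
  Q (hist n c `&` [set X : nat -> 'rV[int]_d | X n.+1 \notin shift_steps (c n)]) = 0%E.
Proof.
have := split_coordinate Q n.+1 (measurable_hist n c) (shift_steps_uniq (c n)).
rewrite big_map big_seq (eq_bigr (fun z => Q (hist n c) * (p (T (c n) w) z)%:E)%E); last first.
  by move=> z zs; exact: hist_step.
rewrite -big_seq.
have [r hr] := prob_EFin Q (measurable_hist n c).
have mrest : measurable (hist n c `&`
    [set X : nat -> 'rV[int]_d | X n.+1 \notin shift_steps (c n)]).
  apply: measurableI => //.
  exact: (measurable_coordinate_set n.+1 [set x | x \notin shift_steps (c n)]).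
have [t ht] := prob_EFin Q mrest.
rewrite ht hr; under eq_bigr do rewrite -EFinM.
rewrite sumEFin -mulr_sumr p_sum mulr1 -EFinD => -[] /eqP.
by rewrite addrC -subr_eq subrr => /eqP <-.
Qed.

Let hist_point_prob k n c x : step_group steps (c n) ->
  Q (hist n c `&` [set X : nat -> 'rV[int]_d | X (n + k)%N = x]) =
  (Q (hist n c) * (point_prob steps T p k (T (c n) w) (x - c n))%:E)%E.
Proof.
elim: k n c => [|k IH] n c cG /=.
  rewrite addn0; have [->|xc] := eqVneq x (c n).
    rewrite subrr eqxx mule1; congr (Q _); apply/seteqP; split=> X; first by case.
    by move=> hX; split=> //; exact: hX.
  rewrite subr_eq0 (negPf xc) mule0.
  rewrite (_ : _ `&` _ = set0) ?measure0//; apply/seteqP; split=> X //= [hX Xx].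
  by move: xc; rewrite -Xx (hX n)// eqxx.
have mA : measurable (hist n c `&` [set X : nat -> 'rV[int]_d | X (n + k.+1)%N = x]).
  by apply: measurableI => //; exact: measurable_coordinate.
have mR : measurable ([set X : nat -> 'rV[int]_d |
    X n.+1 \notin shift_steps (c n)] : set (path_space d)).
  exact: (measurable_coordinate_set n.+1 [set x | x \notin shift_steps (c n)]).
rewrite (split_coordinate Q n.+1 mA (shift_steps_uniq (c n))).
rewrite [X in (_ + X)%E](_ : _ = 0%E); last first.
  apply: (subset_measure0 _ _ _ (hist_rest n c)); [| |by move=> X [[]]].
  - exact: measurableI.
  - exact: measurableI.
have [r hr] := prob_EFin Q (measurable_hist n c).
rewrite adde0 big_map hr -EFinM mulr_sumr -sumEFin.
rewrite big_seq [RHS]big_seq; apply: eq_bigr => z zs.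
have zG := step_group_step zs.
(* [markov_law] conditions on full histories, so the induction on the remaining time carries the
   whole past; fixing the next position lengthens that past by one. *)
pose c' i := if i == n.+1 then c n + z else c i.
have hc' : hist n c `&` [set X : nat -> 'rV[int]_d | X n.+1 = c n + z] = hist n.+1 c'.
  apply/seteqP; split=> X /=.
    move=> [hX Xn] i; rewrite /c' leq_eqVlt; case: eqP => [->//|_] /= iN.
    exact: hX.
  move=> hX; split=> [i iN|].
    have := hX i (leqW iN); rewrite /c'; case: eqP => // iE.
    by move: iN; rewrite iE ltnn.
  by have := hX _ (leqnn _); rewrite /c' eqxx.
have cE : c' n.+1 = z + c n by rewrite /c' eqxx addrC.
have := IH n.+1 c'; rewrite cE addSnnS => IH'.
transitivity (Q (hist n.+1 c' `&` [set X : nat -> 'rV[int]_d | X (n + k.+1)%N = x])).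
  by congr (Q _); rewrite -hc' setIAC.
rewrite IH'; last exact: step_groupD.
rewrite -hc' hist_step// hr -!EFinM TD//; congr (_%:E).
by rewrite -mulrA opprD addrCA addrA [- z + _]addrC -[x - z - c n]addrA [- z - c n]addrC addrA.
Qed.

Lemma law_point_prob n x :
  Q [set X : nat -> 'rV[int]_d | X n = x] = (point_prob steps T p n w x)%:E.
Proof.
have [Q0 _] := QM.
have mn := measurable_coordinate n x.
have m0 := measurable_coordinate 0 (0 : 'rV[int]_d).
have h0 : hist 0 (fun=> 0) = [set X : nat -> 'rV[int]_d | X 0%N = 0].
  apply/seteqP; split=> X /=; first by apply.
  by move=> X0 i; rewrite leqn0 => /eqP ->.
have := @hist_point_prob n 0%N (fun=> 0) x (step_group0 steps).
rewrite h0 Q0 mul1e add0n T0 subr0 => <-.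
set A0 := [set X : nat -> 'rV[int]_d | X 0%N = 0] in Q0 m0 *.
set An := [set X : nat -> 'rV[int]_d | X n = x] in mn *.
transitivity (Q (An `\` A0) + Q (An `&` A0))%E.
  exact: (measureDI Q mn m0).
rewrite setIC [X in (X + _)%E](_ : _ = 0%E) ?add0e//.
have nA0 : Q (~` A0) = 0%E by rewrite probability_setC// Q0 subee.
apply: (subset_measure0 _ _ _ nA0).
- exact: measurableD.
- exact: measurableC.
- by move=> X [].
Qed.

End PathLaw.

(** * A subadditive limit theorem under commuting ergodic shifts *)

(* An orbit segment is cut into short blocks along which [f] is at most [b] per
   unit of time, single bad points, and a final piece of length at most [N]. *)
Lemma subadditive_blocks (R : realType) (X : Type) (tau : X -> X)
    (f : nat -> X -> R) (u : X -> R) (b : R) (N : nat) :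
  (forall x, f 0%N x = 0) ->
  (forall n l x, f (n + l)%N x <= f n x + f l (iter n tau x)) ->
  (forall x, 0 <= u x) -> (forall x, f 1%N x <= u x) -> 0 <= b ->
  let bad := [set x | forall l, (0 < l <= N)%N -> l%:R * b <= f l x] in
  forall n x, f n x <= n%:R * b +
    \sum_(0 <= j < n) \1_bad (iter j tau x) * u (iter j tau x) +
    \sum_(0 <= j < n | (n <= j + N)%N) u (iter j tau x).
Proof.
move=> f0 fD u0 fu b0 bad.
have fsum n x : f n x <= \sum_(0 <= j < n) u (iter j tau x).
  elim: n x => [|n IH] x; first by rewrite f0 big_nil.
  rewrite big_nat_recl//; apply: (le_trans (fD 1%N n x)); apply: lerD => //.
  apply: (le_trans (IH _)); rewrite le_eqVlt; apply/orP; left; apply/eqP.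
  by apply: eq_bigr => j _; rewrite -iterD addn1.
pose phi x := \1_bad x * u x.
have phi0 x : 0 <= phi x by rewrite mulr_ge0// indicE.
move=> n; have [k kn] := ubnP n; elim: k n kn => // k IH n nk x.
have [nN|Nn] := leqP n N.
  apply: (le_trans (fsum n x)); rewrite -[leLHS]add0r; apply: lerD.
    by rewrite addr_ge0 ?mulr_ge0// sumr_ge0// => j _; exact: phi0.
  rewrite big_nat_cond [leRHS]big_nat_cond le_eqVlt; apply/orP; left; apply/eqP.
  by apply: eq_bigl => j; rewrite andbT; case: (0 <= j < n)%N => //=; lia.
(* At a bad point the block is a single step, paid by [u] and recorded by [phi]; at any other point
   some block of length at most [N] costs less than [b] per unit of time. In both cases the block
   fits, since [N < n] here. *)
have [l lN fl] : exists2 l, (0 < l <= N)%N || (l == 1)%N &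
    f l x <= l%:R * b + phi x.
  have [xbad|] := pselect (bad x).
    exists 1%N; first by rewrite orbT.
    have -> : phi x = u x by rewrite /phi indicE mem_set// mul1r.
    by have := fu x; lra.
  move=> /existsNP[l /not_implyP[lN]] /negP; rewrite -ltNge => /ltW fl.
  by exists l; rewrite ?lN//; have := phi0 x; lra.
have l0 : (0 < l)%N by lia.
have ln : (l <= n)%N by lia.
have fn : f n x <= f l x + f (n - l)%N (iter l tau x) by rewrite -{1}(subnKC ln).
have nlk : (n - l < k)%N by lia.
have {IH} := IH _ nlk (iter l tau x).
have -> : \sum_(0 <= j < n - l) \1_bad (iter j tau (iter l tau x)) *
    u (iter j tau (iter l tau x)) = \sum_(l <= j < n) phi (iter j tau x).
  transitivity (\sum_(0 + l <= j < n) phi (iter j tau x)); last by rewrite add0n.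
  by rewrite big_addn; apply: eq_bigr => j _; rewrite /phi -iterD.
have -> : \sum_(0 <= j < n - l | (n - l <= j + N)%N) u (iter j tau (iter l tau x)) =
    \sum_(l <= j < n | (n <= j + N)%N) u (iter j tau x).
  transitivity (\sum_(0 + l <= j < n | (n <= j + N)%N) u (iter j tau x)).
    by rewrite big_addn; apply: eq_big => [j|j _]; [lia|rewrite -iterD].
  by rewrite add0n.
rewrite natrB// mulrBl.
have -> : \sum_(0 <= j < n) \1_bad (iter j tau x) * u (iter j tau x) =
    \sum_(0 <= j < l) phi (iter j tau x) + \sum_(l <= j < n) phi (iter j tau x).
  by rewrite -big_cat_nat.
have -> : \sum_(0 <= j < n | (n <= j + N)%N) u (iter j tau x) =
    \sum_(0 <= j < l | (n <= j + N)%N) u (iter j tau x) +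
    \sum_(l <= j < n | (n <= j + N)%N) u (iter j tau x).
  by rewrite -big_cat_nat.
have : phi x <= \sum_(0 <= j < l) phi (iter j tau x).
  rewrite -{1}(prednK l0) big_nat_recl//= lerDl sumr_ge0// => j _; exact: phi0.
have : 0 <= \sum_(0 <= j < l | (n <= j + N)%N) u (iter j tau x) by exact: sumr_ge0.
by move: fn fl; lra.
Qed.

Lemma natr_eventually (R : realType) (x : R) : exists N, forall n, (N <= n)%N -> x <= n%:R.
Proof.
exists (Num.truncn x).+1 => n Nn.
by apply/ltW/(lt_le_trans (Num.Theory.truncnS_gt x)); rewrite ler_nat.
Qed.

Lemma inv_nat_lt (R : realType) (e : R) : 0 < e -> exists j, j.+1%:R^-1 < e.
Proof.
move=> e0; exists (Num.truncn e^-1).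
by rewrite -[ltRHS]invrK ltf_pV2 ?posrE ?invr_gt0// Num.Theory.truncnS_gt.
Qed.

Section SubadditiveLimit.
Context (R : realType) (d : nat) (steps : {fset 'rV[int]_d}).
Context disp (Omega : measurableType disp) (P : probability Omega R).
Variable T : 'rV[int]_d -> Omega -> Omega.
Hypotheses (T_system : measurable_system steps P T)
  (T_ergodic : ergodic steps P T).
Variables (tau : Omega -> Omega) (f : nat -> Omega -> R) (u : Omega -> R) (B : R).
Hypotheses (mtau : measurable_fun setT tau)
  (ptau : forall A, measurable A -> P (tau @^-1` A) = P A)
  (mf : forall n, measurable_fun setT (f n)) (f_ge0 : forall n w, 0 <= f n w)
  (f0 : forall w, f 0%N w = 0)
  (fD : forall n l w, f (n + l)%N w <= f n w + f l (iter n tau w))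
  (mu : measurable_fun setT u) (u_ge0 : forall w, 0 <= u w)
  (fu : forall w, f 1%N w <= u w)
  (u_int : (\int[P]_w (u w)%:E <= B%:E)%E)
  (u_tail : {ae P, forall w, forall e : R, 0 < e -> exists N, forall n j,
     (N <= n)%N -> (j <= n)%N -> u (iter j tau w) <= e * n%:R})
  (f_inv : forall z, z \in steps -> {ae P, forall w, forall e : R, 0 < e ->
     exists N, forall n, (N <= n)%N -> f n.+1 w <= f n (T z w) + e * n%:R}).

(** The event that the lower limit of [f n / n] is at most [s]; [high] is its counterpart for the
    upper limit. The slack [1 / (j+1)] makes both events robust against the error [e * n] in
    [f_inv]. *)
Let low (s : R) : set Omega :=
  [set w | forall j N, exists2 n, (N <= n)%N & f n w < (s + j.+1%:R^-1) * n%:R].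

Let high (t : R) : set Omega :=
  [set w | forall j N, exists2 n, (N <= n)%N & (t - j.+1%:R^-1) * n%:R < f n w].

Let measurable_low s : measurable (low s).
Proof.
have -> : low s = \bigcap_j \bigcap_N \bigcup_(n in [set n | (N <= n)%N])
    [set w | f n w < (s + j.+1%:R^-1) * n%:R].
  apply/seteqP; split=> w /= h; first by move=> j _ N _; have [n] := h j N; exists n.
  by move=> j N; have [n] := h j I N I; exists n.
do 2 (apply: bigcapT_measurable => ?); apply: bigcup_measurable => n _.
exact: (measurable_lt_set (g := cst _) (mf n) (measurable_cst _)).
Qed.

Let measurable_high t : measurable (high t).
Proof.
have -> : high t = \bigcap_j \bigcap_N \bigcup_(n in [set n | (N <= n)%N])
    [set w | (t - j.+1%:R^-1) * n%:R < f n w].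
  apply/seteqP; split=> w /= h; first by move=> j _ N _; have [n] := h j N; exists n.
  by move=> j N; have [n] := h j I N I; exists n.
do 2 (apply: bigcapT_measurable => ?); apply: bigcup_measurable => n _.
exact: (measurable_lt_set (f := cst _) (measurable_cst _) (mf n)).
Qed.

(** The factor 4 counts the errors in [high_zero_one]: the finer slack, the error of [f_inv], and
    two from the change of [n+1] to [n] in the threshold. *)
Let quarter j : exists j' : nat, 4 * j'.+1%:R^-1 < j.+1%:R^-1 :> R.
Proof.
have r0 : 0 < j.+1%:R^-1 / 4 :> R by rewrite divr_gt0// invr_gt0.
have [j' hj] := inv_nat_lt r0; exists j'.
by rewrite mulrC -ltr_pdivlMr.
Qed.

Let low_zero_one s : {ae P, forall w, low s w} \/ {ae P, forall w, ~ low s w}.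
Proof.
(* The inequality in [f_inv] pulls [low] back from [T z w] to [w], so it is the complement that
   moves forward under the steps. For [high] the direction is already the right one. *)
have mC : measurable (~` low s) by exact: measurableC.
suff : {ae P, forall w, ~ low s w} \/ {ae P, forall w, ~ ~ low s w}.
  by case=> h; [right|left; apply: filterS h => w /contrapT].
apply: (ergodic_zero_one T_system T_ergodic mC) => z zs.
apply: filterS (f_inv zs) => w fw; apply: contra_not => lowz j N.
have [j' jj'] := quarter j.
have j'0 : 0 < j'.+1%:R^-1 :> R by rewrite invr_gt0.
have [N1 fw1] := fw _ j'0.
have [N2 hN2] := natr_eventually (`|s| / j'.+1%:R^-1).
have [n nN fn] := lowz j' (N + N1 + N2)%N.
exists n.+1; first by lia.
have := fw1 n ltac:(lia); have := hN2 n ltac:(lia).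
rewrite ler_pdivrMr// -[n.+1]addn1 natrD.
have := ler_norm (- s); rewrite normrN.
move: fn jj' j'0; set e := j'.+1%:R^-1; set r := j.+1%:R^-1; set x := n%:R.
move=> fn jj' e0 sn ex fw'.
have x0 : 0 <= x by [].
have : 0 <= (r - 4 * e) * x by apply: mulr_ge0 => //; lra.
have : 0 <= e * x by apply: mulr_ge0 => //; lra.
lra.
Qed.

Let high_zero_one t : {ae P, forall w, high t w} \/ {ae P, forall w, ~ high t w}.
Proof.
apply: (ergodic_zero_one T_system T_ergodic (measurable_high t)) => z zs.
apply: filterS (f_inv zs) => w fw hw j N.
have [j' jj'] := quarter j.
have j'0 : 0 < j'.+1%:R^-1 :> R by rewrite invr_gt0.
have [N1 fw1] := fw _ j'0.
have [N2 hN2] := natr_eventually (`|t| / j'.+1%:R^-1).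
have [[//|n] nN fn] := hw j' (N + N1 + N2).+2.
exists n; first by lia.
have := fw1 n ltac:(lia); have := hN2 n ltac:(lia).
have x1 : 1 <= n%:R :> R by rewrite ler1n; lia.
move: fn; rewrite ler_pdivrMr// -[n.+1]addn1 natrD.
have := ler_norm (- t); rewrite normrN.
move: x1 jj' j'0; set e := j'.+1%:R^-1; set r := j.+1%:R^-1; set x := n%:R.
move=> x1 jj' e0 sn fn ex fw'.
have : 0 <= (r - 4 * e) * x by apply: mulr_ge0; lra.
have : e <= e * x by rewrite ler_peMr// ltW.
lra.
Qed.

Let bad (b : R) N := [set w | forall l, (0 < l <= N)%N -> l%:R * b <= f l w].
Let phi (b : R) N w := \1_(bad b N) w * u w.

Let phi_ge0 b N w : 0 <= phi b N w.
Proof. by rewrite mulr_ge0// indicE. Qed.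

Let measurable_bad b N : measurable (bad b N).
Proof.
have -> : bad b N = \bigcap_(l in [set l | (0 < l <= N)%N])
    ~` [set w | f l w < l%:R * b].
  apply/seteqP; split=> w /=.
    by move=> h l /h; rewrite leNgt => /negP.
  by move=> h l /h /negP; rewrite -leNgt.
apply: bigcap_measurableType => l _; apply: measurableC.
exact: (measurable_lt_set (g := cst _) (mf l) (measurable_cst _)).
Qed.

Let measurable_phi b N : measurable_fun setT (phi b N).
Proof. by apply: measurable_funM => //; exact: measurable_indic. Qed.

(** As [N] grows the bad sets decrease to a null set, and [u] dominates. *)
Let phi_small (b e : R) : 0 < e ->
  {ae P, forall w, exists2 l, (0 < l)%N & f l w < l%:R * b} ->
  exists N, (\int[P]_w (phi b N w)%:E <= e%:E)%E.
Proof.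
move=> e0 fb.
have uE : measurable_fun setT (EFin \o u) by exact/measurable_EFinP.
have iu : P.-integrable setT (EFin \o u).
  apply/integrableP; split=> //.
  under eq_integral do rewrite /= ger0_norm//.
  by apply: le_lt_trans u_int _; rewrite ltry.
have [|||||_ _] := @dominated_convergence _ _ _ P setT measurableT
  (fun N w => (phi b N w)%:E) (cst 0%E) (EFin \o u).
- by move=> N; exact/measurable_EFinP.
- exact: measurable_cst.
- apply: filterS fb => w [l l0 fl] _.
  apply: cvg_near_cst; exists l => // N /= lN.
  rewrite /phi indicE memNset ?mul0r// => /(_ l); rewrite l0 lN => /(_ isT).
  by rewrite leNgt fl.
- exact: iu.
- apply: aeW => w N _ /=; rewrite ger0_norm// lee_fin /phi indicE.
  by case: (_ \in _); rewrite ?mul1r ?mul0r.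
rewrite integral0 => /fine_cvgP[[N1 _ hN1]] /cvgr_lt /(_ e e0) [N2 _ hN2].
exists (N1 + N2)%N.
have := hN1 (N1 + N2)%N (leq_addr _ _); have /= := hN2 (N1 + N2)%N (leq_addl _ _).
by move=> h /fineK <-; rewrite lee_fin ltW.
Qed.

(** With [e = (t - s) / 4], the block decomposition bounds [f n] by [(s + e) n], plus the cost [e n]
    of bad points, plus the cost [e n] of the last piece, in total [(t - e) n]. Ergodicity of [tau]
    would make bad points rare along almost every orbit; here the maximal inequality gives this only
    with positive probability, which is enough because [high t] would hold almost surely. *)
Let low_not_high (s t : R) : 0 <= s -> s < t -> {ae P, forall w, low s w} ->
  {ae P, forall w, ~ high t w}.
Proof.
move=> s0 st aelow; have [aehigh|//] := high_zero_one t; exfalso.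
pose e := (t - s) / 4.
have e0 : 0 < e by rewrite divr_gt0// subr_gt0.
have e20 : 0 < e / 2 by rewrite divr_gt0.
have [|N phiN] := @phi_small (s + e) (e / 2) e20.
  apply: filterS aelow => w lw.
  have [j je] := inv_nat_lt e0.
  have [[//|n] _ fn] := lw j 1%N; exists n.+1 => //.
  by apply: (lt_trans fn); rewrite mulrC ltr_pM2l// ltrD2l.
have phi_fin : (\int[P]_w (phi (s + e) N w)%:E < +oo)%E.
  by apply: le_lt_trans phiN _; rewrite ltry.
have := maximal_ergodic mtau ptau (measurable_phi (s + e) N)
  (phi_ge0 (s + e) N) phi_fin e0.
set S := [set w | exists n, _]; move=> maxS.
have mS : measurable S.
  have -> : S = \bigcup_n [set w | n.+1%:R * e <
      \sum_(j < n.+1) phi (s + e) N (iter j tau w)].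
    by apply/seteqP; split=> w /= [n]; [exists n|move=> _; exists n].
  apply: bigcup_measurable => n _.
  apply: (measurable_lt_set (f := cst _) (measurable_cst _)).
  apply: measurable_sum => j; apply: measurableT_comp => //.
  exact: (iter_invariant mtau ptau j).1.
(* The integral of [phi] was made at most [e / 2] so that [S] has probability at most one half. *)
have PS : (0 < P (~` S))%E.
  have [r Pr] := prob_EFin P mS.
  rewrite probability_setC// Pr -EFinB lte_fin subr_gt0.
  have : (e%:E * P S <= (e / 2)%:E)%E by exact: le_trans maxS phiN.
  by rewrite Pr -EFinM lee_fin => er; rewrite -(ltr_pM2l e0); lra.
have [w nSw [hw tailw]] : exists2 w, (~` S) w & high t w /\
    forall e : R, 0 < e -> exists N, forall n j, (N <= n)%N -> (j <= n)%N ->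
      u (iter j tau w) <= e * n%:R.
  apply: (prob_gt0_exists _ PS); first exact: measurableC.
  by apply: filterS2 aehigh u_tail.
have [j je] := inv_nat_lt e0.
(* The last piece has at most [N] sites, each of cost at most [e n / (N+1)]. *)
have [|N0 hN0] := tailw (e / N.+1%:R); first by rewrite divr_gt0.
have [[//|n] nN fn] := hw j N0.+1.
have se0 : 0 <= s + e by rewrite addr_ge0// ltW.
have := subadditive_blocks N f0 fD u_ge0 fu se0 n.+1 w.
have : \sum_(0 <= j < n.+1) phi (s + e) N (iter j tau w) <= n.+1%:R * e.
  rewrite big_mkord leNgt; apply/negP => h; apply: nSw; by exists n.
have : \sum_(0 <= j < n.+1 | (n.+1 <= j + N)%N) u (iter j tau w) <= e * n.+1%:R.
  have -> : \sum_(0 <= j < n.+1 | (n.+1 <= j + N)%N) u (iter j tau w) =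
      \sum_(n.+1 - N <= j < n.+1) u (iter j tau w).
    rewrite (@big_cat_nat _ _ _ (n.+1 - N))//=; last by rewrite leq_subr.
    rewrite big_nat_cond big_pred0 ?add0r; last first.
      by move=> i; apply/negP; clear; lia.
    rewrite big_nat_cond [RHS]big_nat_cond; apply: eq_bigl => i; clear; lia.
  apply: (@le_trans _ _ (\sum_(n.+1 - N <= j < n.+1) e / N.+1%:R * n.+1%:R)).
    rewrite big_nat_cond [leRHS]big_nat_cond; apply: ler_sum => i.
    by move=> /andP[/andP[_ iN] _]; apply: hN0; exact: ltnW.
  rewrite sumr_const_nat -[_ *+ (_ - _)]mulr_natl mulrA ler_wpM2r//.
  rewrite mulrCA ger_pMr// ler_pdivrMr// mul1r ler_nat; clear; lia.
move: fn; rewrite /phi; set A := \sum_(0 <= j < _) _.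
set A' := \sum_(0 <= j < _ | _) _.
set x := n.+1%:R => fn h1 h2 h3.
have x0 : 0 < x by rewrite /x.
have : (t - e) * x < (t - j.+1%:R^-1) * x by rewrite ltr_pM2r// ltrD2l ltrN2.
have -> : t - e = s + 3 * e by rewrite /e; lra.
by move=> /lt_trans/(_ fn) {fn}; lra.
Qed.

(** Otherwise [f n >= s n] eventually almost surely, so with probability exceeding [B / s] at some
    large [n]; by Markov's inequality this contradicts the bound [n * B] on the integral of
    [f n]. *)
Let low_large (s : R) : B < s -> {ae P, forall w, low s w}.
Proof.
move=> Bs; have [//|nlow] := low_zero_one s; exfalso.
have B0 : 0 <= B.
  by rewrite -lee_fin; apply: le_trans u_int; apply: integral_ge0 => w _; rewrite lee_fin.
have s0 : 0 < s by exact: le_lt_trans Bs.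
have fint n : (\int[P]_w (f n w)%:E <= (n%:R * B)%:E)%E.
  elim: n => [|n IH].
    by rewrite mul0r (eq_integral (cst 0%E)) ?integral0// => w _; rewrite f0.
  have mfE k : measurable_fun setT (fun w => (f k w)%:E) by exact/measurable_EFinP.
  apply: (@le_trans _ _ (\int[P]_w ((u w)%:E + (f n (tau w))%:E))%E).
    apply: ge0_le_integral => //.
    - by move=> w _; rewrite lee_fin.
    - apply: emeasurable_funD; first exact/measurable_EFinP.
      exact: measurableT_comp (mfE n) mtau.
    - move=> w _; rewrite -EFinD lee_fin.
      by apply: le_trans (fD 1 n w) _; rewrite lerD2r.
  rewrite ge0_integralD//; last 4 first.
  - by move=> w _; rewrite lee_fin.
  - exact/measurable_EFinP.
  - by move=> w _; rewrite lee_fin.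
  - exact: measurableT_comp (mfE n) mtau.
  rewrite (integral_comp_invariant mtau ptau (f := fun w => (f n w)%:E))//; last first.
    by move=> w; rewrite lee_fin.
  by rewrite -natr1 mulrDl mul1r addrC EFinD; exact: leeD.
pose E n := ~` [set w | f n w < s * n%:R].
have mE n : measurable (E n).
  apply: measurableC.
  exact: (measurable_lt_set (g := cst _) (mf n) (measurable_cst _)).
have aeE : {ae P, forall w, \forall n \near \oo, E n w}.
  apply: filterS nlow => w /existsNP[j] /existsNP[N] hN; exists N => // n /= Nn fn.
  apply: hN; exists n => //; apply: (lt_le_trans fn); rewrite ler_wpM2r//.
  by rewrite lerDl invr_ge0.
have e0 : 0 < 1 - B / s by rewrite subr_gt0 ltr_pdivrMr// mul1r.
have [N _ hN] := ae_eventually_prob mE e0 aeE.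
have := hN N.+1 (leqnSn _); rewrite /= opprB addrC subrK => PE.
have : ((s * N.+1%:R)%:E * P (E N.+1) <= (N.+1%:R * B)%:E)%E.
  apply: le_trans (fint N.+1).
  rewrite -[X in (_ * P X)%E]setIT -integral_indic// -ge0_integralZl//; last 2 first.
  - by apply/measurable_EFinP; exact: measurable_indic.
  - by rewrite lee_fin mulr_ge0// ltW.
  apply: ge0_le_integral => //.
  - by move=> w _; rewrite mule_ge0// lee_fin ?indicE// mulr_ge0// ltW.
  - apply: emeasurable_funM => //; apply/measurable_EFinP; exact: measurable_indic.
  - exact/measurable_EFinP.
  - move=> w _; rewrite -EFinM lee_fin indicE; case: (boolP (w \in E N.+1)).
      by rewrite inE /E/= mulr1 => /negP; rewrite -leNgt.
    by rewrite mulr0.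
have [r Pr] := prob_EFin P (mE N.+1).
move: PE; rewrite Pr lte_fin -EFinM lee_fin ltr_pdivrMr// => Br.
rewrite mulrAC mulrC ler_pM2l//; lra.
Qed.

Let low_neg (s : R) : s < 0 -> ~ {ae P, forall w, low s w}.
Proof.
move=> s0 /ae_exists[w lw].
have [j je] : exists j, j.+1%:R^-1 < - s by apply: inv_nat_lt; rewrite oppr_gt0.
have [n _ fn] := lw j 0%N.
have := f_ge0 n w; rewrite leNgt => /negP; apply.
apply: (lt_le_trans fn); rewrite pmulr_lle0.
  by rewrite -lerBrDl sub0r ltW.
rewrite lt_neqAle andbC ler0n/= eq_sym; apply/eqP => n0.
by move: fn; rewrite n0 mulr0 ltNge f_ge0.
Qed.

(** The limit is the infimum of the levels [s] at which [low s] is almost sure. Above it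
    [low_not_high] excludes larger upper limits, below it the zero-one law excludes smaller lower
    limits; countably many levels suffice. *)
Theorem subadditive_limit : exists c, 0 <= c <= B /\
  {ae P, forall w, f n w / n%:R @[n --> \oo] --> c}.
Proof.
pose S := [set s | {ae P, forall w, low s w}].
have S0 : lbound S 0 by move=> s Ss; rewrite leNgt; apply/negP => /low_neg.
have hS : has_inf S.
  split; last by exists 0.
  by exists (B + 1); apply: low_large; rewrite ltrDl.
have c0 : 0 <= inf S by apply: lb_le_inf => //; exact: hS.1.
exists (inf S); split.
  rewrite c0/=; apply/ler_addgt0Pr => e e0; apply: ge_inf; first exact: hS.2.
  by apply: low_large; rewrite ltrDl.
set c := inf S in c0 *.
have upper j : {ae P, forall w, ~ high (c + j.+1%:R^-1) w}.
  have j0 : 0 < j.+1%:R^-1 :> R by rewrite invr_gt0.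
  have [s Ss sc] := inf_adherent j0 hS.
  apply: (@low_not_high s) => //; exact: S0.
have lower j : {ae P, forall w, ~ low (c - j.+1%:R^-1) w}.
  have [h|//] := low_zero_one (c - j.+1%:R^-1); exfalso.
  have : c <= c - j.+1%:R^-1 by apply: ge_inf => //; exact: hS.2.
  by rewrite lerDl oppr_ge0 leNgt invr_gt0 ltr0n.
have := ae_foralln lower; apply: filterS2 (ae_foralln upper) => w uw lw.
apply/cvgrPdist_le => e e0.
have [j je] := inv_nat_lt (divr_gt0 e0 (ltr0Sn R 1)).
have /existsNP[j1 /existsNP[N1 h1]] := uw j.
have /existsNP[j2 /existsNP[N2 h2]] := lw j.
exists (N1 + N2).+1 => // -[//|n] /= nN.
have x0 : 0 < n.+1%:R :> R by [].
rewrite ler_distlC; apply/andP; split.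
  rewrite ler_pdivlMr// leNgt; apply/negP => fn; apply: h2.
  exists n.+1; first by lia.
  apply: (lt_le_trans fn); rewrite ler_wpM2r//.
  have : 0 <= j2.+1%:R^-1 :> R by [].
  by move: je; set a := j.+1%:R^-1; set b := j2.+1%:R^-1; lra.
rewrite ler_pdivrMr// leNgt; apply/negP => fn; apply: h1.
exists n.+1; first by lia.
apply: le_lt_trans fn; rewrite ler_wpM2r//.
have : 0 <= j1.+1%:R^-1 :> R by [].
by move: je; set a := j.+1%:R^-1; set b := j1.+1%:R^-1; lra.
Qed.

End SubadditiveLimit.

(** * Costs of corrections under class L *)

(** A norm with values in [nat], which keeps distance bounds along paths within integer arithmetic.
    It dominates the Euclidean norm, so its balls lie inside those of class L. *)
Definition l1norm d (x : 'rV[int]_d) : nat := (\sum_j absz (x ord0 j))%N.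

Lemma l1normD d (x y : 'rV[int]_d) : (l1norm (x + y) <= l1norm x + l1norm y)%N.
Proof.
rewrite -big_split/=; apply: leq_sum => j _; rewrite mxE.
by move: (x ord0 j) (y ord0 j) => a b; lia.
Qed.

Lemma l1norm0 d : l1norm (0 : 'rV[int]_d) = 0%N.
Proof. by rewrite /l1norm big1// => j _; rewrite mxE. Qed.

Lemma l1norm_mulrn d (x : 'rV[int]_d) n : (l1norm (x *+ n) <= n * l1norm x)%N.
Proof.
elim: n => [|n IH]; first by rewrite l1norm0.
by rewrite mulrS mulSn; apply: leq_trans (l1normD _ _) _; rewrite leq_add2l.
Qed.

Lemma euclidean_norm_le_l1 (R : realType) d (x : 'rV[int]_d) :
  euclidean_norm R x <= (l1norm x)%:R.
Proof.
have sq0 i : 0 <= ((x 0 i)%:~R : R) ^+ 2 by exact: sqr_ge0.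
rewrite -(@ler_pXn2r _ 2)// ?nnegrE ?sqrtr_ge0// sqr_sqrtr ?sumr_ge0//.
have xE i : ((x 0 i)%:~R : R) ^+ 2 = (absz (x ord0 i))%:R ^+ 2.
  by rewrite natr_absz intr_norm real_normK// num_real.
under eq_bigr do rewrite xE.
rewrite /l1norm natr_sum; suff [] : \sum_i ((absz (x ord0 i))%:R : R) ^+ 2 <=
    (\sum_i (absz (x ord0 i))%:R) ^+ 2 /\ 0 <= \sum_i ((absz (x ord0 i))%:R : R) by [].
elim/big_rec2: _ => [|i a b _ [ba a0]]; first by rewrite expr0n.
split; last exact: addr_ge0.
have : 0 <= (absz (x ord0 i))%:R * a by exact: mulr_ge0.
by rewrite sqrrD; move: ba; lra.
Qed.

Section Tame.
Variables (R : realType) (d : nat) (steps : {fset 'rV[int]_d}).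
Variables (Omega : Type) (T : 'rV[int]_d -> Omega -> Omega).
Variable p : Omega -> 'rV[int]_d -> R.
Hypotheses
  (TD : forall x y, step_group steps x -> step_group steps y ->
        forall w, T (x + y) w = T x (T y w))
  (T0 : forall w, T 0 w = w)
  (p_pos : forall w z, z \in steps -> 0 < p w z)
  (p_sum : forall w, \sum_(z <- steps) p w z = 1).

Let p_ge0 w z : z \in steps -> 0 <= p w z.
Proof. by move=> zs; rewrite ltW// p_pos. Qed.

Definition env_cost (w : Omega) : R := \sum_(z <- steps) - ln (p w z).

Let lnp_ge0 w z : z \in steps -> 0 <= - ln (p w z).
Proof. by move=> zs; rewrite oppr_ge0 ln_le0// (p_le1 T p_ge0 p_sum). Qed.

Lemma env_cost_ge0 w : 0 <= env_cost w.
Proof. by rewrite /env_cost big_seq; apply: sumr_ge0 => z; exact: lnp_ge0. Qed.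

Lemma env_cost_ge w z : z \in steps -> - ln (p w z) <= env_cost w.
Proof.
move=> zs; rewrite /env_cost (big_fsetD1 z)//= lerDl big_seq.
by apply: sumr_ge0 => y; rewrite in_fsetD1 => /andP[_]; exact: lnp_ge0.
Qed.

(* The pointwise form of membership in class L. *)
Definition tame (w : Omega) := forall z, z \in steps -> z != 0 ->
  forall e : R, 0 < e -> exists2 r : R, 0 < r & exists N, forall n k x,
    (N <= n)%N -> step_group steps x -> (l1norm x <= n)%N -> k%:R <= r * n%:R ->
    \sum_(0 <= j < k) env_cost (T (x + z *+ j) w) <= e * n%:R.

Section TameEnvironment.
Variable w : Omega.
Hypothesis w_tame : tame w.

Lemma tame_line K (e : R) : 0 < e -> exists2 r : R, 0 < r & exists N,
  forall z n k x, z \in steps -> z != 0 ->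
    (N <= n)%N -> step_group steps x -> (l1norm x <= K * n)%N -> k%:R <= r * n%:R ->
    \sum_(0 <= j < k) env_cost (T (x + z *+ j) w) <= e * n%:R.
Proof.
move=> e0; have eK : 0 < e / K.+1%:R by rewrite divr_gt0.
have : forall z : steps, exists rN : R * nat, 0 < rN.1 /\ (val z != 0 -> forall n k x,
    (rN.2 <= n)%N -> step_group steps x -> (l1norm x <= n)%N -> k%:R <= rN.1 * n%:R ->
    \sum_(0 <= j < k) env_cost (T (x + val z *+ j) w) <= e / K.+1%:R * n%:R).
  move=> z; have [z0|z0] := eqVneq (val z) 0.
    by exists (1, 0%N); split=> //=; rewrite z0 eqxx.
  have [r r0 [N hN]] := w_tame (valP z) z0 eK.
  by exists (r, N).
move=> /fin_all_exists[rN hrN].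
have [r r0 rmin] := pos_lower_bound (fun z => (hrN z).1).
exists r => //; exists (\sum_z (rN z).2)%N => z n k x zs z0 Nn xG xn kn.
have [_ /(_ z0)] := hrN [` zs]%fset.
(* Tameness is used at scale [(K+1) n], which contains the larger ball; hence the tolerance
   [e / (K+1)]. *)
move=> /(_ (K.+1 * n)%N k x _ xG).
have -> : e / K.+1%:R * (K.+1 * n)%:R = e * n%:R.
  by rewrite natrM mulrA divfK.
apply.
- apply: leq_trans (leq_trans _ Nn) (leq_pmull _ _) => //.
  by rewrite (bigD1 [` zs]%fset)//= leq_addr.
- by apply: leq_trans xn _; rewrite leq_mul2r leqnSn orbT.
- apply: le_trans kn _; apply: ler_pM => //; first exact: ltW.
  by rewrite ler_nat leq_pmull.
Qed.

(** Without a nonzero step tameness is an empty condition, but then the null step is the only one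
    and has probability 1. *)
Let degenerate_cost : (forall z, z \in steps -> z = 0) -> forall w, env_cost w = 0.
Proof.
move=> z0 w'; rewrite /env_cost big_seq big1// => z zs.
have := p_sum w'; rewrite (big_fsetD1 z)//= big_seq big1 ?addr0 => [->|y].
  by rewrite ln1 oppr0.
by rewrite in_fsetD1 => /andP[/eqP yz ys]; exfalso; apply: yz; rewrite (z0 y ys) (z0 z zs).
Qed.

Let nonzero_or_degenerate : (forall w, env_cost w = 0) \/
  exists2 z, z \in steps & z != 0.
Proof.
have [h|h] := pselect (exists2 z, z \in steps & z != 0); first by right.
left; apply: degenerate_cost => z zs; apply: contrapT => z0; apply: h.
by exists z => //; exact/eqP.
Qed.

(** A single site is a line with one term. *)
Lemma tame_point K (e : R) : 0 < e -> exists N, forall n x, (N <= n)%N ->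
  step_group steps x -> (l1norm x <= K * n)%N -> env_cost (T x w) <= e * n%:R.
Proof.
move=> e0; have [h|[z zs z0]] := nonzero_or_degenerate.
  by exists 0%N => n x _ _ _; rewrite h mulr_ge0// ltW.
have [r r0 [N hN]] := tame_line K e0.
have [N1 hN1] := natr_eventually r^-1.
exists (N + N1)%N => n x Nn xG xn.
have := hN z n 1%N x zs z0 (leq_trans (leq_addr _ _) Nn) xG xn.
rewrite big_nat1 mulr0n addr0; apply.
rewrite -ler_pdivrMl// mulr1; exact: hN1 (leq_trans (leq_addl _ _) Nn).
Qed.

Lemma tame_path (s : seq 'rV[int]_d) K (e : R) : {subset s <= steps} -> 0 < e ->
  exists N, forall n x, (N <= n)%N -> step_group steps x -> (l1norm x <= K * n)%N ->
    path_cost T p (T x w) s <= e * n%:R.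
Proof.
elim: s K e => [|z s IH] K e ss e0.
  by exists 0%N => n x _ _ _ /=; rewrite mulr_ge0// ltW.
have zs : z \in steps by apply: ss; rewrite mem_head.
have ss' : {subset s <= steps} by move=> y ys; apply: ss; rewrite inE ys orbT.
have e20 : 0 < e / 2 by rewrite divr_gt0.
have [N1 h1] := tame_point K e20.
have [N2 h2] := IH (K + l1norm z)%N (e / 2) ss' e20.
exists (N1 + N2).+1 => n x Nn xG xn /=.
have zG := step_group_step zs.
have -> : e * n%:R = e / 2 * n%:R + e / 2 * n%:R by rewrite -mulrDl -splitr.
apply: lerD.
  apply: le_trans (env_cost_ge _ zs) _; apply: h1 => //; by clear -Nn; lia.
rewrite -TD//; apply: h2; first by clear -Nn; lia.
  exact: step_groupD.
rewrite mulnDl addnC; apply: leq_trans (l1normD _ _) _; rewrite leq_add//.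
by rewrite leq_pmulr//; clear -Nn; lia.
Qed.

(* [l] steps [z] with [j <= L * l] null steps interleaved, at most [L] of them
   between consecutive steps [z]. *)
Let Fixpoint stair (L : nat) (z : 'rV[int]_d) (l j : nat) : seq 'rV[int]_d :=
  if l is l'.+1 then nseq (minn L j) 0 ++ z :: stair L z l' (j - minn L j) else [::].

Let size_stair L z l j : (j <= L * l)%N -> size (stair L z l j) = (l + j)%N.
Proof.
elim: l j => [|l IH] j jl /=; first by rewrite muln0 in jl; clear -jl; lia.
rewrite mulnS in jl; rewrite size_cat/= size_nseq IH; clear -jl; lia.
Qed.

Let stair_mem L z l j : z \in steps -> (j = 0%N \/ 0 \in steps) ->
  {subset stair L z l j <= steps}.
Proof.
move=> zs; elim: l j => [|l IH] j j0 //= y.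
rewrite mem_cat inE => /or3P[/nseqP[-> yj]|/eqP ->//|].
  by case: j0 => // j0; move: yj; rewrite j0; clear; lia.
apply: IH; case: j0 => [->|]; [left; clear; lia|by right].
Qed.

Let stair_end L z l j : path_end (stair L z l j) = z *+ l.
Proof.
elim: l j => [|l IH] j; first by rewrite /path_end big_nil.
have -> : path_end (stair L z l.+1 j) =
    path_end (nseq (minn L j) 0) + (z + path_end (stair L z l (j - minn L j))).
  by rewrite /path_end /= big_cat big_cons.
by rewrite IH mulrS /path_end big_nseq iter_addr_0 mul0rn add0r.
Qed.

Let path_cost_zeros w' k : (k = 0%N \/ 0 \in steps) ->
  path_cost T p w' (nseq k 0) <= k%:R * env_cost w'.
Proof.
case=> [->|s0]; first by rewrite mul0r.
elim: k => [|k IH] /=; first by rewrite mul0r.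
by rewrite -natr1 mulrDl mul1r addrC T0; apply: lerD => //; exact: env_cost_ge.
Qed.

(** Every site of the line is left after at most [L] null steps and one step [z], each costing at
    most [env_cost] there, which explains the factor [L+1]. *)
Let stair_cost L z l j x : z \in steps -> (j = 0%N \/ 0 \in steps) ->
  step_group steps x ->
  path_cost T p (T x w) (stair L z l j) <=
  L.+1%:R * \sum_(0 <= k < l) env_cost (T (x + z *+ k) w).
Proof.
move=> zs; have zG := step_group_step zs.
elim: l j x => [|l IH] j x j0 xG; first by rewrite big_nil mulr0.
have m0 : minn L j = 0%N \/ 0 \in steps.
  by case: j0 => [->|]; [left; clear; lia|right].
have zeros_end : path_end (nseq (minn L j) (0 : 'rV[int]_d)) = 0.
  by rewrite /path_end big_nseq iter_addr_0 mul0rn.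
rewrite /= (path_cost_cat p TD T0); last first.
  by move=> y /nseqP[-> mj]; case: m0 => // m0; rewrite m0 in mj.
rewrite zeros_end T0 /= big_nat_recl// mulr0n addr0 mulrDr addrA; apply: lerD.
  rewrite -natr1 mulrDl mul1r; apply: lerD; last exact: env_cost_ge.
  apply: le_trans (path_cost_zeros _ m0) _.
  by rewrite ler_wpM2r ?env_cost_ge0// ler_nat geq_minl.
rewrite -TD//; apply: le_trans (IH _ _ _ _) _.
- by case: j0 => [->|]; [left; clear; lia|right].
- exact: step_groupD.
- rewrite ler_wpM2l// le_eqVlt; apply/orP; left; apply/eqP.
  by apply: eq_bigr => k _; rewrite mulrS addrA [z + x]addrC.
Qed.

Let path_cost_flatten (I : eqType) (bl : I -> seq 'rV[int]_d) (s : seq I) (D : R) (M : nat) x :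
  (forall i, i \in s -> {subset bl i <= steps}) ->
  (forall i y, i \in s -> step_group steps y ->
    (l1norm y <= M)%N -> path_cost T p (T y w) (bl i) <= D) ->
  step_group steps x ->
  (l1norm x + \sum_(i <- s) l1norm (path_end (bl i)) <= M)%N ->
  path_cost T p (T x w) (flatten [seq bl i | i <- s]) <= (size s)%:R * D.
Proof.
elim: s x => [|i s IH] x bls blc xG; first by rewrite mul0r.
rewrite big_cons => xM.
have isub : {subset bl i <= steps} by apply: bls; rewrite mem_head.
have iG := path_end_group isub.
rewrite /= (path_cost_cat p TD T0)//.
rewrite -natr1 mulrDl mul1r addrC; apply: lerD; last first.
  by apply: blc => //; [rewrite mem_head|clear -xM; lia].
rewrite -TD//; apply: IH.
- by move=> k ks; apply: bls; rewrite inE ks orbT.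
- by move=> k y ks; apply: blc; rewrite inE ks orbT.
- exact: step_groupD.
- by have := l1normD (path_end (bl i)) x; clear -xM; lia.
Qed.

Section Counts.
Variables (m : nat) (step : 'I_m -> 'rV[int]_d).
Hypotheses (step_mem : forall i, step i \in steps)
  (step_surj : forall z, z \in steps -> exists i, z = step i).

(** The cost of a small correction is bounded along one explicit path: a straight line for each
    nonzero step, with all null steps interleaved into the line of a single nonzero step [i0].
    Comparability of the counts bounds the number of null steps by [m * L] times the length of that
    line. *)
Lemma tame_counts K L (e : R) : 0 < e -> exists2 r : R, 0 < r & exists N,
  forall n x (a : 'I_m -> nat), (N <= n)%N -> step_group steps x ->
    (l1norm x <= K * n)%N -> (forall i, (a i)%:R <= r * n%:R) ->
    (forall i j, a i <= L * a j)%N ->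
    point_cost steps T p (total_count a) (T x w) (displacement step a) <= e * n%:R.
Proof.
move=> e0; have [h|[z zs z0]] := nonzero_or_degenerate.
  exists 1 => //; exists 0%N => n x a _ _ _ _ _.
  apply: le_trans (point_cost_counts TD T0 p_ge0 p_pos step_mem _ _) _.
  have : forall s w', {subset s <= steps} -> path_cost T p w' s <= 0.
    elim=> [|y s IH] w' ss //=; rewrite -[leRHS]addr0; apply: lerD.
      by rewrite -(h w'); apply: env_cost_ge; apply: ss; rewrite mem_head.
    by apply: IH => v vs; apply: ss; rewrite inE vs orbT.
  move=> /(_ _ _ (@counts_path_mem _ _ _ _ step_mem a))/le_trans; apply.
  by rewrite mulr_ge0// ltW.
have [i0 zi0] := step_surj zs.
pose Z := (\sum_i l1norm (step i))%N.
pose L' := (m * L)%N.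
have eL : 0 < e / (m.+1%:R * L'.+1%:R) by rewrite divr_gt0// mulr_gt0.
have [r r0 [N hN]] := tame_line (K + Z) eL.
(* The bound by 1 gives [a i <= n], which keeps the path within the ball of radius [(K + Z) n] used
   for the lines. *)
exists (Num.min r 1); first by rewrite lt_min r0 ltr01.
exists N => n x a Nn xG xn an aL.
have anr i : (a i)%:R <= r * n%:R.
  by apply: le_trans (an i) _; rewrite ler_wpM2r// ge_min lexx.
have an1 i : (a i <= n)%N.
  rewrite -(ler_nat R); apply: le_trans (an i) _.
  by rewrite -[leRHS]mul1r ler_wpM2r// ge_min lexx orbT.
pose null i := step i == 0.
pose J := (\sum_(i | null i) a i)%N.
have JL : (J <= L' * a i0)%N.
  apply: (@leq_trans (\sum_(i < m) L * a i0)%N).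
    rewrite /J big_mkcond; apply: leq_sum => i _; case: ifP => // _.
  by rewrite sum_nat_const card_ord mulnA.
pose bl i := if null i then [::] else
  stair L' (step i) (a i) (if i == i0 then J else 0).
have Jz : J = 0%N \/ 0 \in steps.
  have [/existsP[i /eqP i00]|] := boolP [exists i, step i == 0].
    by right; rewrite -i00.
  rewrite negb_exists => /forallP no0; left.
  by rewrite /J big_pred0// => i; apply/negbTE/no0.
have J'z i : (if i == i0 then J else 0%N) = 0%N \/ 0 \in steps.
  by case: ifP => // _; left.
have bl_sub i : {subset bl i <= steps}.
  by rewrite /bl; case: ifP => // _; exact: stair_mem.
have bl_end i : path_end (bl i) = step i *+ a i.
  rewrite /bl /null; case: ifP => [/eqP ->|_]; last exact: stair_end.
  by rewrite mul0rn /path_end big_nil.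
pose s := flatten [seq bl i | i <- enum 'I_m].
have s_sub : {subset s <= steps} by move=> y /flatten_mapP[i _]; exact: bl_sub.
have s_end : path_end s = displacement step a.
  rewrite /path_end /s big_flatten/= big_map big_enum/=.
  by apply: eq_bigr => i _; rewrite -/(path_end _) bl_end.
have s_size : size s = total_count a.
  rewrite size_flatten /shape -map_comp sumnE big_map big_enum/= /total_count.
  rewrite [RHS](bigID null)/= -/J.
  rewrite (bigID null)/= big1 ?add0n => [|i i00]; last by rewrite /bl -/(null i) i00.
  have i0P : step i0 != 0 by rewrite -zi0.
  rewrite (bigD1 i0)//= [in RHS](bigD1 i0)//= addnA addnC [in RHS]addnC.
  congr (_ + _)%N.
    apply: eq_bigr => i /andP[/negPf i00 /negPf ii0].
    by rewrite /bl -/(null i) i00 ii0 size_stair// addn0.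
  by rewrite /bl /null (negPf i0P) eqxx size_stair// addnC.
rewrite -s_size -s_end.
apply: le_trans (point_cost_path TD T0 p_ge0 p_pos _ s_sub) _.
apply: le_trans (path_cost_flatten (D := L'.+1%:R * (e / (m.+1%:R * L'.+1%:R) * n%:R))
  (M := ((K + Z) * n)%N) _ _ xG _) _.
- by move=> i _; exact: bl_sub.
- move=> i y _ yG yM; rewrite /bl; case: ifP => [_|/negbT i00].
    by rewrite /= !mulr_ge0// ltW.
  apply: le_trans (stair_cost _ _ _ _ yG) _ => //.
  by rewrite ler_wpM2l//; apply: hN.
- rewrite mulnDl leq_add// /Z big_distrl/= big_enum/=; apply: leq_sum => i _.
  rewrite bl_end mulnC; apply: leq_trans (l1norm_mulrn _ _) _.
  by rewrite leq_mul2r an1 orbT.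
have -> : L'.+1%:R * (e / (m.+1%:R * L'.+1%:R) * n%:R) = e * n%:R / m.+1%:R.
  have L0 : L'.+1%:R != 0 :> R by [].
  have m0 : m.+1%:R != 0 :> R by [].
  move: L0 m0; move: (L'.+1%:R : R) (m.+1%:R : R) => A A' A0 A'0.
  by field; rewrite A0 A'0.
rewrite size_enum_ord mulrA ler_pdivrMr// mulrC.
by rewrite ler_wpM2l ?ler_nat// mulr_ge0// ltW.
Qed.

End Counts.
End TameEnvironment.
End Tame.

Lemma total_countD m (a b : 'I_m -> nat) :
  total_count (fun i => a i + b i)%N = (total_count a + total_count b)%N.
Proof. by rewrite /total_count big_split. Qed.

Lemma total_countM m k (a : 'I_m -> nat) :
  total_count (fun i => k * a i)%N = (k * total_count a)%N.
Proof. by rewrite /total_count big_distrr. Qed.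

Lemma displacementD d m (z : 'I_m -> 'rV[int]_d) (a b : 'I_m -> nat) :
  displacement z (fun i => a i + b i)%N = displacement z a + displacement z b.
Proof. by rewrite /displacement -big_split; apply: eq_bigr => i _; rewrite mulrnDr. Qed.

Lemma displacementM d m (z : 'I_m -> 'rV[int]_d) k (a : 'I_m -> nat) :
  displacement z (fun i => k * a i)%N = displacement z a *+ k.
Proof.
by rewrite /displacement -sumrMnl; apply: eq_bigr => i _; rewrite mulnC mulrnA.
Qed.

(** * The free energy of step counts *)

Section FreeEnergy.
Context (R : realType) (d : nat) (steps : {fset 'rV[int]_d}).
Context disp (Omega : measurableType disp) (P : probability Omega R).
Variable T : 'rV[int]_d -> Omega -> Omega.
Variable p : Omega -> 'rV[int]_d -> R.
Hypotheses (T_system : measurable_system steps P T)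
  (T_ergodic : ergodic steps P T)
  (p_meas : forall z, z \in steps -> measurable_fun setT (p ^~ z))
  (p_pos : forall w z, z \in steps -> 0 < p w z)
  (p_sum : forall w, \sum_(z <- steps) p w z = 1)
  (p_int : forall z, z \in steps -> P.-integrable setT (EFin \o (fun w => ln (p w z))))
  (tame_ae : {ae P, forall w, tame steps T p w}).
Variables (m : nat) (step : 'I_m -> 'rV[int]_d).
Hypotheses (step_mem : forall i, step i \in steps)
  (step_surj : forall z, z \in steps -> exists i, z = step i).

Let TD x y : step_group steps x -> step_group steps y ->
  forall w, T (x + y) w = T x (T y w).
Proof. by move=> xG yG w; case: T_system => _ + _ _; exact. Qed.

Let T0 w : T 0 w = w. Proof. by case: T_system. Qed.

Let mT x : step_group steps x -> measurable_fun setT (T x).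
Proof. by case: T_system => + _ _ _; apply. Qed.

Let PT x : step_group steps x -> forall A, measurable A -> P (T x @^-1` A) = P A.
Proof. by case: T_system => _ _ _; apply. Qed.

Let p_ge0 w z : z \in steps -> 0 <= p w z.
Proof. by move=> zs; rewrite ltW// p_pos. Qed.

Let measurable_sum_steps (h : 'rV[int]_d -> Omega -> R) :
  (forall z, z \in steps -> measurable_fun setT (h z)) ->
  measurable_fun setT (fun w => \sum_(z <- steps) h z w).
Proof.
move=> mh.
have -> : (fun w => \sum_(z <- steps) h z w) =
    (fun w => \sum_(z <- steps) (if z \in steps then h z w else 0)).
  by apply/funext => w; rewrite big_seq big_mkcond.
apply: measurable_sum => z; case zs: (z \in steps); last exact: measurable_cst.
exact: mh.
Qed.

Let measurable_point_prob n x : measurable_fun setT (fun w => point_prob steps T p n w x).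
Proof.
elim: n x => [|n IH] x; first exact: measurable_cst.
apply: measurable_sum_steps => z zs; apply: measurable_funM; first exact: p_meas.
exact: measurableT_comp (IH _) (mT (step_group_step zs)).
Qed.

Let measurable_lnN (h : Omega -> R) : measurable_fun setT h ->
  measurable_fun setT (fun w => - ln (h w)).
Proof.
move=> mh; apply: measurableT_comp => //.
exact: measurableT_comp (@measurable_ln R) mh.
Qed.

Let measurable_point_cost n x : measurable_fun setT (fun w => point_cost steps T p n w x).
Proof. exact: measurable_lnN (measurable_point_prob n x). Qed.

Let measurable_path_cost s : {subset s <= steps} ->
  measurable_fun setT (fun w => path_cost T p w s).
Proof.
elim: s => [|z s IH] ss; first exact: measurable_cst.
have zs : z \in steps by apply: ss; rewrite mem_head.
apply: measurable_funD; first exact/measurable_lnN/p_meas.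
apply: measurableT_comp (IH _) (mT (step_group_step zs)).
by move=> y ys; apply: ss; rewrite inE ys orbT.
Qed.

Definition mean_cost : R := fine (\int[P]_w (env_cost steps p w)%:E).

Let measurable_env_cost : measurable_fun setT (env_cost steps p).
Proof. by apply: measurable_sum_steps => z zs; exact/measurable_lnN/p_meas. Qed.

Let env_cost_integral : (\int[P]_w (env_cost steps p w)%:E = mean_cost%:E)%E.
Proof.
rewrite /mean_cost fineK//.
have : P.-integrable setT (EFin \o env_cost steps p).
  have -> : EFin \o env_cost steps p = (fun w => \sum_(z <- steps)
      (if z \in steps then (- ln (p w z))%:E else 0))%E.
    apply/funext => w; rewrite /= /env_cost -sumEFin big_seq [RHS]big_seq.
    by apply: eq_bigr => z ->.
  apply: integrable_sum => // z _; case zs: (z \in steps); last exact: integrable0.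
  exact: integrableN (p_int zs).
by move=> /integrable_fin_num; apply.
Qed.

Lemma mean_cost_ge0 : 0 <= mean_cost.
Proof.
rewrite -lee_fin -env_cost_integral; apply: integral_ge0 => w _.
by rewrite lee_fin (env_cost_ge0 T p_pos p_sum).
Qed.

Let path_cost_integral s : {subset s <= steps} ->
  (\int[P]_w (path_cost T p w s)%:E <= ((size s)%:R * mean_cost)%:E)%E.
Proof.
elim: s => [|z s IH] ss.
  by rewrite mul0r (eq_integral (cst 0%E)) ?integral0.
have zs : z \in steps by apply: ss; rewrite mem_head.
have ss' : {subset s <= steps} by move=> y ys; apply: ss; rewrite inE ys orbT.
have zG := step_group_step zs.
have mE h : measurable_fun setT h -> measurable_fun setT (fun w : Omega => (h w)%:E).
  by move=> mh; exact/measurable_EFinP.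
have lz0 w : 0 <= - ln (p w z) by rewrite oppr_ge0 ln_le0// (p_le1 T p_ge0 p_sum).
have s0 w : 0 <= path_cost T p w s by exact: (path_cost_ge0 T p_ge0 p_sum).
under eq_integral do rewrite /= EFinD.
rewrite ge0_integralD//; last 4 first.
- by move=> w _; rewrite lee_fin.
- exact/mE/measurable_lnN/p_meas.
- by move=> w _; rewrite lee_fin.
- apply: mE; exact: measurableT_comp (measurable_path_cost ss') (mT zG).
rewrite (integral_comp_invariant (mT zG) (PT zG)
  (f := fun w => (path_cost T p w s)%:E)); last 2 first.
- exact/mE/measurable_path_cost.
- by move=> w; rewrite lee_fin.
have -> : (size (z :: s))%:R * mean_cost = mean_cost + (size s)%:R * mean_cost.
  by rewrite /= -natr1 mulrDl mul1r addrC.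
rewrite EFinD; apply: leeD; last exact: (IH ss').
rewrite -env_cost_integral; apply: ge0_le_integral => //.
- by move=> w _; rewrite lee_fin.
- exact/mE/measurable_lnN/p_meas.
- exact/mE.
- by move=> w _; rewrite lee_fin (env_cost_ge T p_pos p_sum).
Qed.

Definition block_cost (k : nat) (y : 'rV[int]_d) (n : nat) (w : Omega) : R :=
  point_cost steps T p (n * k) w (y *+ n).

(** The almost sure constant limit. As it is chosen from [k] and [y] alone, counts with equal total
    and displacement have the same free energy by definition; the default 0 is never met at positive
    counts. *)
Definition block_limit (k : nat) (y : 'rV[int]_d) : R :=
  xget 0 [set c | {ae P, forall w, block_cost k y n w / n%:R @[n --> \oo] --> c}].

Definition free_energy (a : 'I_m -> nat) : R :=
  block_limit (total_count a) (displacement step a).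

Notation cost a := (block_cost (total_count a) (displacement step a)).

Let iter_shift y n w : step_group steps y -> step_group steps (y *+ n) /\
  iter n (T y) w = T (y *+ n) w.
Proof.
move=> yG; elim: n => [|n [nG IH]]; first by rewrite T0; split=> //; exact: step_group0.
rewrite mulrS /= IH TD//; split=> //; exact: step_groupD.
Qed.

Let disp_group a : step_group steps (displacement step a).
Proof. exact: displacement_group. Qed.

Let costE a n w : cost a n w =
  point_cost steps T p (total_count (fun i => n * a i)%N) w
    (displacement step (fun i => n * a i)%N).
Proof. by rewrite total_countM displacementM. Qed.

Lemma point_cost_countsD a b w :
  point_cost steps T p (total_count a + total_count b) w
    (displacement step a + displacement step b) <=
  point_cost steps T p (total_count a) w (displacement step a) +
  point_cost steps T p (total_count b) (T (displacement step a) w) (displacement step b).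
Proof.
by apply: (point_cost_add TD T0 p_ge0) => //;
  exact: (point_prob_counts TD T0 p_ge0 p_pos step_mem).
Qed.

(** The subadditive theorem for the shift [T y], with [u] the cost of one fixed path realising [a].
    By stationarity the mean of [u] is at most [mean_cost] per step, and tameness supplies both the
    tail bound on [u] and the near invariance. *)
Lemma block_cost_cvg a : positive_counts a ->
  exists c : R, 0 <= c <= (total_count a)%:R * mean_cost /\
  {ae P, forall w, cost a n w / n%:R @[n --> \oo] --> c}.
Proof.
move=> a0; set y := displacement step a; set k := total_count a.
have yG : step_group steps y by exact: disp_group.
have csub := @counts_path_mem _ _ _ _ step_mem a.
apply: (@subadditive_limit _ _ _ _ _ _ _ T_system T_ergodic (T y) _
   (fun w => path_cost T p w (counts_path step a))).
- exact: mT.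
- exact: PT.
- by move=> n; exact: measurable_point_cost.
- by move=> n w; exact: (point_cost_ge0 T p_ge0 p_sum).
- by move=> w; rewrite /block_cost /point_cost /= eqxx ln1 oppr0.
- move=> n l w; have [nG ->] := iter_shift n w yG.
  rewrite /block_cost mulnDl mulrnDr; apply: (point_cost_add TD T0 p_ge0) => //.
    have := point_prob_counts TD T0 p_ge0 p_pos step_mem w (fun i => n * a i)%N.
    by rewrite total_countM displacementM.
  have := point_prob_counts TD T0 p_ge0 p_pos step_mem (T (y *+ n) w) (fun i => l * a i)%N.
  by rewrite total_countM displacementM.
- exact: measurable_path_cost.
- by move=> w; exact: (path_cost_ge0 T p_ge0 p_sum).
- by move=> w; rewrite /block_cost mul1n mulr1n;
  exact: (point_cost_counts TD T0 p_ge0 p_pos step_mem).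
- by have := path_cost_integral csub; rewrite size_counts_path.
- apply: filterS tame_ae => w tw e e0.
  have [N hN] := tame_path TD p_pos p_sum tw (l1norm y) csub e0.
  exists N => n j Nn jn; have [jG ->] := iter_shift j w yG.
  apply: hN => //; apply: leq_trans (l1norm_mulrn _ _) _.
  by rewrite mulnC leq_mul2l jn orbT.
- move=> z zs; apply: filterS tame_ae => w tw e e0.
  have [i zi] := step_surj zs.
  (* Near invariance under [z]: from [w] take the step [z], then follow [n] blocks in the
     environment [T z w], then the steps of one block without one copy of [z]. This makes [n+1]
     blocks, and it exists because [a] contains every step. *)
  pose a' j := (a j - (j == i))%N.
  have ei j : a j = (a' j + (j == i))%N.
    by rewrite /a' subnK//; case: eqP => // ->; exact: a0.
  have tei : total_count (fun j => (j == i : nat)) = 1%N.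
    by rewrite /total_count (bigD1 i)//= eqxx big1 ?addn0// => j /negPf ->.
  have dei : displacement step (fun j => (j == i : nat)) = z.
    rewrite /displacement (bigD1 i)//= eqxx mulr1n big1 ?addr0 ?zi// => j /negPf ->.
    by rewrite mulr0n.
  have aE : a = (fun j => a' j + (j == i))%N by apply/funext.
  have ka : k = (total_count a' + 1)%N by rewrite /k aE total_countD tei.
  have ya : y = displacement step a' + z by rewrite /y aE displacementD dei.
  have e20 : 0 < e / 2 by rewrite divr_gt0.
  have [N1 hN1] := tame_path TD p_pos p_sum tw (l1norm y + l1norm z)
    (@counts_path_mem _ _ _ _ step_mem a') e20.
  have [N2 hN2] := natr_eventually (- ln (p w z) / (e / 2)).
  exists (N1 + N2).+1 => n Nn.
  have zG := step_group_step zs.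
  have [nG _] := iter_shift n w yG.
  have pn w' : 0 < point_prob steps T p (n * k) w' (y *+ n).
    have := point_prob_counts TD T0 p_ge0 p_pos step_mem w' (fun i => n * a i)%N.
    by rewrite total_countM displacementM.
  have h1 : point_cost steps T p (1 + n * k) w (z + y *+ n) <=
      - ln (p w z) + block_cost k y n (T z w).
    have := @point_cost_add _ _ _ _ _ _ TD T0 p_ge0 1 (n * k) w z (y *+ n) zG.
    rewrite {2}/point_cost point_prob1//; apply=> //; exact: p_pos.
  have pn1 : 0 < point_prob steps T p (1 + n * k) w (z + y *+ n).
    have := @point_prob_add _ _ _ _ _ _ TD T0 p_ge0 1 (n * k) w z (y *+ n) zG.
    apply: lt_le_trans; rewrite point_prob1//; apply: mulr_gt0 => //; exact: p_pos.
  have h2 : block_cost k y n.+1 w <= point_cost steps T p (1 + n * k) w (z + y *+ n) +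
      point_cost steps T p (total_count a') (T (z + y *+ n) w) (displacement step a').
    rewrite /block_cost.
    have -> : (n.+1 * k = (1 + n * k) + total_count a')%N.
      by rewrite mulSn {1}ka; clear; lia.
    have -> : y *+ n.+1 = (z + y *+ n) + displacement step a'.
      by rewrite mulrS [X in X + _ = _]ya -addrA addrC.
    apply: (point_cost_add TD T0 p_ge0) => //; first exact: step_groupD.
    exact: (point_prob_counts TD T0 p_ge0 p_pos step_mem).
  have h3 : point_cost steps T p (total_count a') (T (z + y *+ n) w)
      (displacement step a') <= e / 2 * n%:R.
    apply: le_trans (point_cost_counts TD T0 p_ge0 p_pos step_mem _ _) _.
    apply: hN1; first by clear -Nn; lia.
      exact: step_groupD.
    apply: leq_trans (l1normD _ _) _; rewrite mulnDl addnC leq_add//.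
      by apply: leq_trans (l1norm_mulrn _ _) _; rewrite mulnC.
    by rewrite leq_pmulr//; clear -Nn; lia.
  have h4 : - ln (p w z) <= e / 2 * n%:R.
    by rewrite -ler_pdivrMl// mulrC; apply: hN2; clear -Nn; lia.
  have -> : e * n%:R = e / 2 * n%:R + e / 2 * n%:R by rewrite -mulrDl -splitr.
  by move: h1 h2 h3 h4; lra.
Qed.

Lemma free_energy_cvg a : positive_counts a ->
  {ae P, forall w, cost a n w / n%:R @[n --> \oo] --> free_energy a}.
Proof.
move=> a0; have [c [_ hc]] := block_cost_cvg a0.
pose S : set R := [set l : R | {ae P, forall w, cost a n w / n%:R @[n --> \oo] --> l}].
suff : S (xget 0 S) by [].
by apply: xgetPex; exists c.
Qed.

Let cost_limit_unique a c : positive_counts a ->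
  {ae P, forall w, cost a n w / n%:R @[n --> \oo] --> c} -> free_energy a = c.
Proof.
move=> a0 hc.
have [w [h1 h2]] : exists w, (cost a n w / n%:R @[n --> \oo] --> free_energy a) /\
    (cost a n w / n%:R @[n --> \oo] --> c).
  by apply: (@ae_exists _ _ _ P); apply: filterS2 (free_energy_cvg a0) hc.
exact: (cvg_unique _ h1 h2).
Qed.

Lemma free_energy_bound a : positive_counts a ->
  0 <= free_energy a <= mean_cost * (total_count a)%:R.
Proof.
move=> a0; have [c [hc1 hc2]] := block_cost_cvg a0.
by rewrite (cost_limit_unique a0 hc2) mulrC.
Qed.

Lemma free_energy_hom a k : positive_counts a -> (0 < k)%N ->
  free_energy (fun i => k * a i)%N = k%:R * free_energy a.
Proof.
move=> a0 k0; apply: cost_limit_unique.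
  by move=> i; rewrite muln_gt0 k0 a0.
apply: filterS (free_energy_cvg a0) => w hw.
have -> : (fun n => cost (fun i => k * a i)%N n w / n%:R) =
    (fun n => k%:R * (cost a (k * n)%N w / (k * n)%:R)).
  apply/funext => n; rewrite /block_cost total_countM displacementM.
  rewrite -mulrnA mulnA [(n * k)%N]mulnC natrM invfM mulrCA [LHS]mulrC.
  rewrite [k%:R * (_ / _)]mulrA mulfV ?mul1r 1?mulrC//.
  by rewrite pnatr_eq0 -lt0n.
apply: cvgMr; apply: (cvg_comp (fun n => (k * n)%N)) hw.
apply/cvgnyPge => N; exists N => // n /= Nn.
by apply: leq_trans Nn (leq_pmull _ k0).
Qed.

Let measurable_cost_le a n (c : R) : measurable [set w | cost a n w < c].
Proof. exact: (measurable_lt_set (g := cst _) (measurable_point_cost _ _) (measurable_cst _)). Qed.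

Let measurable_cost_ge a n (c : R) : measurable [set w | c < cost a n w].
Proof. exact: (measurable_lt_set (f := cst _) (measurable_cst _) (measurable_point_cost _ _)). Qed.

(** The blocks of [b] start from an environment that moves with [n], where almost sure convergence
    says nothing. Stationarity still gives convergence in probability: for some large [n] three
    events of probability above 3/4 meet, and an environment in all of them yields the inequality up
    to [e]. *)
Lemma free_energy_sub a b : positive_counts a -> positive_counts b ->
  free_energy (fun i => a i + b i)%N <= free_energy a + free_energy b.
Proof.
move=> a0 b0; set ab := (fun i => a i + b i)%N.
have ab0 : positive_counts ab by move=> i; rewrite addn_gt0 a0.
apply/ler_addgt0Pr => e e0; have e3 : 0 < e / 3 by rewrite divr_gt0.
have q0 : 0 < 4%:R^-1 :> R by rewrite invr_gt0.
pose E c n := [set w | cost c n w < (free_energy c + e / 3) * n%:R].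
pose E' n := [set w | (free_energy ab - e / 3) * n%:R < cost ab n w].
have upper c (c0 : positive_counts c) : \forall n \near \oo,
    ((1 - 4%:R^-1)%:E < P (E c n))%E.
  apply: ae_eventually_prob => // [n|]; first exact: measurable_cost_le.
  apply: filterS (free_energy_cvg c0) => w /cvgr_lt /(_ (free_energy c + e / 3)).
  rewrite ltrDl => /(_ e3)[N _ hN]; exists N.+1 => // n /= Nn.
  rewrite /E /= -ltr_pdivrMr; last by rewrite ltr0n; clear -Nn; lia.
  by apply: hN; exact: ltnW.
have lower : \forall n \near \oo, ((1 - 4%:R^-1)%:E < P (E' n))%E.
  apply: ae_eventually_prob => // [n|]; first exact: measurable_cost_ge.
  apply: filterS (free_energy_cvg ab0) => w /cvgr_gt /(_ (free_energy ab - e / 3)).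
  rewrite ltrBlDr ltrDl => /(_ e3)[N _ hN]; exists N.+1 => // n /= Nn.
  rewrite /E' /= -ltr_pdivlMr; last by rewrite ltr0n; clear -Nn; lia.
  by apply: hN; exact: ltnW.
have [N1 _ h1] := upper a a0; have [N2 _ h2] := upper b b0; have [N3 _ h3] := lower.
pose n := (N1 + N2 + N3).+1.
have {}h1 := h1 n ltac:(rewrite /= /n; lia).
have {}h2 := h2 n ltac:(rewrite /= /n; lia).
have {}h3 := h3 n ltac:(rewrite /= /n; lia).
have nG : step_group steps (displacement step a *+ n).
  by rewrite -displacementM; exact: disp_group.
have [A AE] : exists A, A = E a n by exists (E a n).
have [B BE] : exists B, B = E b n := ex_intro _ (E b n) erefl.
have [C CE] : exists C, C = E' n by exists (E' n).
rewrite -AE in h1; rewrite -BE in h2; rewrite -CE in h3.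
have mA : measurable A by rewrite ?AE ?BE; exact: measurable_cost_le.
have mB : measurable B by rewrite ?AE ?BE; exact: measurable_cost_le.
have mC : measurable C by rewrite CE; exact: measurable_cost_ge.
pose B' := T (displacement step a *+ n) @^-1` B.
have mB' : measurable B' by rewrite -[X in measurable X]setTI; exact: mT.
have PB' : P B' = P B by exact: PT.
have [w [Aw B'w Cw]] : exists w, [/\ A w, B' w & C w].
  apply: contrapT => /forallNP h.
  have mAB := measurableU _ _ (measurableC mA) (measurableC mB').
  have mABC := measurableU _ _ mAB (measurableC mC).
  have h4 : (P (~` A `|` ~` B' `|` ~` C) <= P (~` A `|` ~` B') + P (~` C))%E.
    exact: (measureU2 _ mAB (measurableC mC)).
  have h5 : (P (~` A `|` ~` B') <= P (~` A) + P (~` B'))%E.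
    exact: (measureU2 _ (measurableC mA) (measurableC mB')).
  have ABCT : ~` A `|` ~` B' `|` ~` C = setT.
    apply/seteqP; split=> // w _ /=.
    have [Aw|] := pselect (A w); last by left; left.
    have [Bw|] := pselect (B' w); last by left; right.
    by right => Cw; apply: (h w).
  have [u Pu] := prob_EFin P mAB.
  have [r1 Pr1] := prob_EFin P mA; have [r2 Pr2] := prob_EFin P mB.
  have [r3 Pr3] := prob_EFin P mC.
  have PA' : P (~` A) = (1 - r1)%:E by rewrite (probability_setC P mA) Pr1.
  have PB'' : P (~` B') = (1 - r2)%:E by rewrite (probability_setC P mB') PB' Pr2.
  have PC' : P (~` C) = (1 - r3)%:E by rewrite (probability_setC P mC) Pr3.
  have PST : P setT = 1%E := probability_setT P.
  have g1 : 1 - 4%:R^-1 < r1 by rewrite -lte_fin -Pr1.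
  have g2 : 1 - 4%:R^-1 < r2 by rewrite -lte_fin -Pr2.
  have g3 : 1 - 4%:R^-1 < r3 by rewrite -lte_fin -Pr3.
  have g4 : 1 <= u + (1 - r3) by rewrite -lee_fin EFinD -Pu -PC' -PST -ABCT.
  have g5 : u <= (1 - r1) + (1 - r2) by rewrite -lee_fin EFinD -Pu -PA' -PB''.
  by move: g1 g2 g3 g4 g5; lra.
have : cost ab n w <= cost a n w + cost b n (T (displacement step a *+ n) w).
  rewrite !costE.
  have -> : (fun i => n * ab i)%N = (fun i => n * a i + n * b i)%N.
    by apply/funext => i; rewrite /ab mulnDr.
  by rewrite total_countD displacementD -[displacement step a *+ n]displacementM;
    exact: point_cost_countsD.
move: Aw B'w Cw; rewrite /B' AE BE CE /E /E' /= => Aw Bw Cw Dw.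
have n0 : 0 < n%:R :> R by rewrite ltr0n.
rewrite -(ler_pM2r n0).
move: n0 (lt_le_trans Cw Dw) (ltrD Aw Bw).
move: (free_energy ab) (free_energy a) (free_energy b) (n%:R : R) => x x1 x2 N.
by move: (cost a n w + _) => s N0 g1 g2; have := lt_trans g1 g2; lra.
Qed.

Definition typical (w : Omega) := tame steps T p w /\
  forall a : 'I_m -> nat, positive_counts a ->
    cost a n w / n%:R @[n --> \oo] --> free_energy a.

(** Counts are countably many, but functions out of ['I_m] form a countable type only as finite
    functions. *)
Lemma typical_ae : {ae P, forall w, typical w}.
Proof.
have h : {ae P, forall w, forall a : {ffun 'I_m -> nat}, positive_counts a ->
    cost a n w / n%:R @[n --> \oo] --> free_energy a}.
  apply: ae_forall_count => a; have [a0|a0] := pselect (positive_counts a).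
    by apply: filterS (free_energy_cvg a0).
  exact: aeW.
apply: filterS2 tame_ae h => w tw hw; split=> // a a0.
have aE : a = finfun a by apply/funext => i; rewrite ffunE.
by move: a0; rewrite aE; exact: hw.
Qed.

Lemma free_energy_fiber a b : total_count a = total_count b ->
  displacement step a = displacement step b -> free_energy a = free_energy b.
Proof. by rewrite /free_energy => -> ->. Qed.

End FreeEnergy.

(** * Point probabilities near given weights *)

Section PointAsymptotics.
Variables (R : realType) (d : nat) (steps : {fset 'rV[int]_d}).
Variables (Omega : Type) (T : 'rV[int]_d -> Omega -> Omega).
Variable p : Omega -> 'rV[int]_d -> R.
Hypotheses
  (TD : forall x y, step_group steps x -> step_group steps y ->
        forall w, T (x + y) w = T x (T y w))
  (T0 : forall w, T 0 w = w)
  (p_pos : forall w z, z \in steps -> 0 < p w z)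
  (p_sum : forall w, \sum_(z <- steps) p w z = 1).
Variables (m : nat) (step : 'I_m -> 'rV[int]_d).
Hypotheses (step_mem : forall i, step i \in steps)
  (step_surj : forall z, z \in steps -> exists i, z = step i).
Variables (F : ('I_m -> nat) -> R) (C : R).
Hypotheses (C_ge0 : 0 <= C)
  (F_bound : forall a, positive_counts a -> 0 <= F a <= C * (total_count a)%:R)
  (F_hom : forall a k, positive_counts a -> (0 < k)%N ->
    F (fun i => k * a i)%N = k%:R * F a)
  (F_sub : forall a b, positive_counts a -> positive_counts b ->
    F (fun i => a i + b i)%N <= F a + F b).
Variable w : Omega.
Hypotheses (w_tame : tame steps T p w)
  (w_cvg : forall a, positive_counts a ->
    point_cost steps T p (n * total_count a) w (displacement step a *+ n) / n%:R
      @[n --> \oo] --> F a).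

Let p_ge0 w' z : z \in steps -> 0 <= p w' z.
Proof. by move=> zs; rewrite ltW// p_pos. Qed.

Notation cost n x := (point_cost steps T p n w x).
Notation ext := (extension F C).
Let K := (\sum_i l1norm (step i))%N.

Let l1norm_displacement a n : (forall i, a i <= n)%N ->
  (l1norm (displacement step a) <= K * n)%N.
Proof.
move=> an; rewrite /displacement /K big_distrl/=.
elim/big_ind2 : _ => [|x1 y1 x2 y2 h1 h2|i _]; first by rewrite l1norm0.
  by apply: leq_trans (l1normD _ _) _; exact: leq_add.
by apply: leq_trans (l1norm_mulrn _ _) _; rewrite mulnC leq_mul2l an orbT.
Qed.

Let block_near a (e : R) : positive_counts a -> 0 < e -> exists N, forall M, (N <= M)%N ->
  (F a - e) * M%:R <= cost (total_count (fun i => M * a i)%N)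
    (displacement step (fun i => M * a i)%N) <= (F a + e) * M%:R.
Proof.
move=> a0 e0; have /cvgrPdist_le/(_ e e0)[N _ hN] := w_cvg a0.
exists N.+1 => -[//|M] NM.
have := hN M.+1 (ltnW NM); rewrite /= ler_distlC.
by rewrite ler_pdivlMr// ler_pdivrMr// total_countM displacementM.
Qed.

(** The counts [c] are completed from above: [M a = c + b], where [a / k] lies slightly above [g] in
    every coordinate and [b] is small. Subadditivity and tameness bound the cost of [M a] by that of
    [c] plus [q n], and the cost of [M a] is about [M * F a]. Going upwards, [g] may vanish in some
    coordinates. *)
Lemma point_cost_ge (g : 'I_m -> R) (e : R) : (forall i, 0 <= g i) ->
  (forall i, g i <= 1) -> 0 < e ->
  exists2 r : R, 0 < r & exists N, forall n (c : 'I_m -> nat), (N <= n)%N ->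
    total_count c = n -> (forall i, `|(c i)%:R / n%:R - g i| < r) ->
    n%:R * (C + ext g - e) <= cost n (displacement step c).
Proof.
move=> g0 g1 e0; pose q := e / 4.
have q0 : 0 < q by rewrite divr_gt0.
have H0 := extension_le0 F_bound g.
have [a0 [k0 [a0_pos k00 ga0 Da0]]] := extension_adherent F_bound g q0.
have k0R : 0 < k0%:R :> R by rewrite ltr0n.
have [e1 e10 ge1] : exists2 e, 0 < e & forall i, e <= (a0 i)%:R / k0%:R - g i.
  by apply: pos_lower_bound => i; rewrite subr_gt0 ltr_pdivlMr// mulrC.
(* The correction [b] will lie between [s n / 2] and [3 s n] in every coordinate, whence the ratio
   6. *)
have [r0 r00 [N0 hN0]] := tame_counts TD T0 p_pos p_sum w_tame step_mem step_surj K 6 q0.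
have [s [s0 s1 se1 sr0]] : exists s, [/\ 0 < s, s <= 1, 2 * s <= e1 & 3 * s <= r0].
  exists (Num.min 1 (Num.min (e1 / 2) (r0 / 3))).
  split.
  - by rewrite !lt_min ltr01 !divr_gt0.
  - by rewrite ge_min lexx.
  - by rewrite mulrC -ler_pdivlMr// !ge_min lexx !orbT.
  - by rewrite mulrC -ler_pdivlMr// !ge_min lexx !orbT.
have [k k_pos ks] : exists2 k, (0 < k)%N & 1 <= k%:R * s.
  exists (Num.truncn s^-1).+1 => //.
  by rewrite -ler_pdivrMr// mul1r; apply/ltW/Num.Theory.truncnS_gt.
have kR : 0 < k%:R :> R by rewrite ltr0n.
pose a i := (Num.truncn (k%:R * (g i + s))).+1.
have a_pos : positive_counts a by [].
have a_gt i : k%:R * (g i + s) < (a i)%:R by exact: Num.Theory.truncnS_gt.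
have a_le i : (a i)%:R <= k%:R * (g i + 2 * s).
  rewrite /a -natr1; apply: (@le_trans _ _ (k%:R * (g i + s) + 1)).
    by rewrite lerD2r Num.Theory.truncn_le mulr_ge0// addr_ge0// ltW.
  by move: ks; lra.
have Da : k%:R * (ext g - q) <= excess F C a.
  rewrite mulrC -ler_pdivlMr//; apply: (le_trans (ltW Da0)).
  apply: (excess_ratio F_bound F_hom F_sub a_pos a0_pos k00 k_pos) => i.
  rewrite -(ler_nat R) !natrM.
  apply: (@le_trans _ _ (k0%:R * (k%:R * (g i + 2 * s)))).
    by rewrite ler_wpM2l// ltW.
  rewrite mulrCA ler_wpM2l//.
  rewrite mulrC -ler_pdivlMr//; have := ge1 i; lra.
have [M0 hM0] := block_near a_pos q0.
have [N1 hN1] := natr_eventually (6 * k%:R / s).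
(* Beyond this index the error from rounding [n] up to a multiple of [k] is at most [q n]; the four
   errors of size [q n] add up to [e n]. *)
have [N2 hN2] := natr_eventually (k%:R * (2 * q - ext g) / q).
exists (s / 2); first by rewrite divr_gt0.
exists (N0 + N1 + N2 + k * M0).+1 => n c Nn tc cg.
have n0 : 0 < n%:R :> R by rewrite ltr0n; clear -Nn; lia.
pose M := (n %/ k).+1.
have nMk : (n < M * k)%N by rewrite /M -ltn_divLR.
have Mkn : (M * k <= n + k)%N by rewrite /M mulSn addnC leq_add2r leq_divM.
have M0M : (M0 <= M)%N.
  by rewrite /M ltnW// ltnS leq_divRL// mulnC; clear -Nn; lia.
have nMkR : n%:R <= M%:R * k%:R :> R by rewrite -natrM ler_nat ltnW.
have MknR : M%:R * k%:R <= n%:R + k%:R :> R by rewrite -natrM -natrD ler_nat.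
have MR : 0 <= M%:R :> R by [].
have c_le i : (c i)%:R <= n%:R * (g i + s / 2).
  have := cg i; rewrite ltr_distl => /andP[_]; rewrite ltr_pdivrMr// mulrC => /ltW.
  by [].
have c_ge i : n%:R * (g i - s / 2) <= (c i)%:R.
  have := cg i; rewrite ltr_distl => /andP[+ _]; rewrite ltr_pdivlMr// mulrC => /ltW.
  by [].
have Ma_ge i : n%:R * (g i + s) <= (M * a i)%:R.
  rewrite natrM; apply: (@le_trans _ _ (M%:R * (k%:R * (g i + s)))).
    by rewrite mulrA ler_wpM2r// addr_ge0// ltW.
  by rewrite ler_wpM2l// ltW.
have Ma_le i : (M * a i)%:R <= n%:R * (g i + 2 * s) + 3 * k%:R.
  rewrite natrM; apply: (@le_trans _ _ (M%:R * (k%:R * (g i + 2 * s)))).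
    by rewrite ler_wpM2l.
  rewrite mulrA; apply: (@le_trans _ _ ((n%:R + k%:R) * (g i + 2 * s))).
    by rewrite ler_wpM2r// addr_ge0// mulr_ge0// ltW.
  rewrite mulrDl lerD2l mulrC ler_wpM2r ?(ltW kR)//; have := g1 i; lra.
have cMa i : (c i <= M * a i)%N.
  rewrite -(ler_nat R); apply: le_trans (c_le i) (le_trans _ (Ma_ge i)).
  by rewrite ler_wpM2l ?ltW//; lra.
pose b i := (M * a i - c i)%N.
have bE i : (b i)%:R = (M * a i)%:R - (c i)%:R :> R by rewrite natrB.
have kn : 6 * k%:R <= n%:R * s.
  rewrite -ler_pdivrMr//; apply: hN1; clear -Nn; lia.
have b_le i : (b i)%:R <= 3 * s * n%:R.
  have := Ma_le i; have := c_ge i; rewrite bE; move: kn; lra.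
have b_ge i : s / 2 * n%:R <= (b i)%:R.
  have := Ma_ge i; have := c_le i; rewrite bE; lra.
have Mab : (fun i => M * a i)%N = (fun i => c i + b i)%N.
  by apply/funext => i; rewrite /b subnKC.
have cn i : (c i <= n)%N by rewrite -tc /total_count (bigD1 i)//= leq_addr.
have h1 : cost (total_count (fun i => M * a i)%N) (displacement step (fun i => M * a i)%N)
    <= cost n (displacement step c) + q * n%:R.
  rewrite Mab total_countD displacementD -tc.
  apply: le_trans (point_cost_add TD T0 p_ge0 _ _ _) _.
  - exact: displacement_group.
  - exact: point_prob_counts.
  - exact: point_prob_counts.
  rewrite lerD2l tc; apply: hN0.
  - by clear -Nn; lia.
  - exact: displacement_group.
  - exact: l1norm_displacement.
  - by move=> i; apply: le_trans (b_le i) _; rewrite ler_wpM2r.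
  - move=> i j; rewrite -(ler_nat R) natrM; apply: le_trans (b_le i) _.
    have := b_ge j; lra.
have /andP[h2 _] := hM0 M M0M.
have Mtot : n%:R <= M%:R * (total_count a)%:R :> R.
  by rewrite -natrM ler_nat -total_countM Mab total_countD tc leq_addr.
have Fa : F a = excess F C a + C * (total_count a)%:R by rewrite /excess subrK.
have h3 : M%:R * excess F C a >= (n%:R + k%:R) * (ext g - q).
  apply: (@le_trans _ _ (M%:R * (k%:R * (ext g - q)))); last by rewrite ler_wpM2l.
  rewrite mulrA ler_wnM2r//; lra.
have h4 : C * n%:R <= M%:R * (C * (total_count a)%:R).
  by rewrite mulrCA ler_wpM2l.
have h5 : q * M%:R <= q * (n%:R + k%:R).
  rewrite ler_wpM2l ?(ltW q0)//; apply: le_trans MknR; rewrite ler_peMr//.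
  by rewrite ler1n.
have h6 : k%:R * (2 * q - ext g) <= n%:R * q.
  rewrite -ler_pdivrMr//; apply: hN2; clear -Nn; lia.
move: h1 h2 h3 h4 h5 h6; rewrite Fa.
have -> : e = 4 * q by rewrite /q; lra.
move: (cost n _) (cost _ _) (excess _ _ _) (total_count a)%:R => X Y D tt.
move: (M%:R : R) (k%:R : R) (n%:R : R) (ext g) => M' k' n' H.
lra.
Qed.

(** The mirror image of [point_cost_ge]: [c = M a + b] with [a / k] slightly below [g]. Room below
    in every coordinate, and with it comparability of the counts of [b], needs all weights
    positive. *)
Lemma point_cost_le (g : 'I_m -> R) (e : R) : (forall i, 0 < g i) ->
  (forall i, g i <= 1) -> 0 < e ->
  exists2 r : R, 0 < r & exists N, forall n (c : 'I_m -> nat), (N <= n)%N ->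
    total_count c = n -> (forall i, `|(c i)%:R / n%:R - g i| < r) ->
    cost n (displacement step c) <= n%:R * (C + ext g + e).
Proof.
move=> g0 g1 e0; pose q := e / 4.
have q0 : 0 < q by rewrite divr_gt0.
have H0 := extension_le0 F_bound g.
have [u u0 gu] := pos_lower_bound g0.
(* The coordinates of [b] will lie between [n s u / 4] and [3 s n], with ratio at most [12 / u]. *)
pose L := (Num.truncn (12 / u)).+1.
have Lu : 12 <= L%:R * u.
  by rewrite -ler_pdivrMr//; apply/ltW/Num.Theory.truncnS_gt.
have [r0 r00 [N0 hN0]] := tame_counts TD T0 p_pos p_sum w_tame step_mem step_surj K L q0.
have [s [s0 s1 sH sr0]] : exists s, [/\ 0 < s, 2 * s <= 1, s * (1 - ext g) <= q & 3 * s <= r0].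
  have H1 : 0 < 1 - ext g by lra.
  exists (Num.min (1 / 2) (Num.min (q / (1 - ext g)) (r0 / 3))).
  split.
  - by rewrite !lt_min !divr_gt0.
  - by rewrite mulrC -ler_pdivlMr// ge_min lexx.
  - by rewrite -ler_pdivlMr// !ge_min lexx !orbT.
  - by rewrite mulrC -ler_pdivlMr// !ge_min lexx !orbT.
have [k k_pos ks] : exists2 k, (0 < k)%N & 1 <= k%:R * (s * u / 2).
  have su : 0 < s * u / 2 by rewrite divr_gt0// mulr_gt0.
  exists (Num.truncn (s * u / 2)^-1).+1 => //.
  by rewrite -ler_pdivrMr// mul1r; apply/ltW/Num.Theory.truncnS_gt.
have kR : 0 < k%:R :> R by rewrite ltr0n.
have s1' : 0 < 1 - s by lra.
pose a i := (Num.truncn (k%:R * ((1 - s) * g i))).+1.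
have a_pos : positive_counts a by [].
have a_gt i : k%:R * ((1 - s) * g i) < (a i)%:R by exact: Num.Theory.truncnS_gt.
have gi0 i : 0 <= g i by exact: ltW.
have a_le i : (a i)%:R <= k%:R * ((1 - s / 2) * g i).
  rewrite /a -natr1; apply: (@le_trans _ _ (k%:R * ((1 - s) * g i) + 1)).
    by rewrite lerD2r Num.Theory.truncn_le !mulr_ge0// ltW.
  have : k%:R * (s * u / 2) <= k%:R * (s * g i / 2).
    rewrite ler_wpM2l ?(ltW kR)//.
    have : s * u <= s * g i by rewrite ler_wpM2l ?(ltW s0)// ltW.
    lra.
  by move: ks; lra.
have Da : excess F C a <= k%:R * ((1 - s) * ext g).
  rewrite mulrC -ler_pdivrMr//.
  apply: le_trans (extension_scale F_bound F_hom s1' gi0).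
  exact: (extension_ge F_bound a_pos k_pos).
have [M0 hM0] := block_near a_pos q0.
have [N1 hN1] := natr_eventually (k%:R / s).
have [N2 hN2] := natr_eventually (k%:R * (- ext g) / q).
exists (s * u / 4); first by rewrite divr_gt0// mulr_gt0.
exists (N0 + N1 + N2 + k * M0).+1 => n c Nn tc cg.
have n0 : 0 < n%:R :> R by rewrite ltr0n; clear -Nn; lia.
pose M := (n %/ k)%N.
have Mkn : (M * k <= n)%N by rewrite /M leq_divM.
have nMk : (n <= M * k + k)%N by rewrite addnC -mulSn ltnW// /M -ltn_divLR.
have M0M : (M0 <= M)%N by rewrite /M leq_divRL// mulnC; clear -Nn; lia.
have MknR : M%:R * k%:R <= n%:R :> R by rewrite -natrM ler_nat.
have nMkR : n%:R - k%:R <= M%:R * k%:R :> R by rewrite lerBlDr -natrM -natrD ler_nat.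
have MR : 0 <= M%:R :> R by [].
have c_le i : (c i)%:R <= n%:R * (g i + s * u / 4).
  by have := cg i; rewrite ltr_distl => /andP[_]; rewrite ltr_pdivrMr// mulrC => /ltW.
have c_ge i : n%:R * (g i - s * u / 4) <= (c i)%:R.
  by have := cg i; rewrite ltr_distl => /andP[+ _]; rewrite ltr_pdivlMr// mulrC => /ltW.
have sg i : s * u <= s * g i by rewrite ler_wpM2l// ltW.
have Ma_le i : (M * a i)%:R <= n%:R * ((1 - s / 2) * g i).
  rewrite natrM; apply: (@le_trans _ _ (M%:R * (k%:R * ((1 - s / 2) * g i)))).
    by rewrite ler_wpM2l.
  by rewrite mulrA ler_wpM2r// mulr_ge0//; lra.
have Ma_ge i : n%:R * ((1 - s) * g i) - k%:R <= (M * a i)%:R.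
  rewrite natrM; apply: (@le_trans _ _ (M%:R * (k%:R * ((1 - s) * g i)))); last first.
    by rewrite ler_wpM2l// ltW.
  apply: (@le_trans _ _ ((n%:R - k%:R) * ((1 - s) * g i))); last first.
    by rewrite [leRHS]mulrA ler_wpM2r// mulr_ge0// ltW.
  rewrite [leRHS]mulrBl lerD2l lerN2 ger_pMr//.
  by have := g1 i; have := gi0 i; nra.
have cMa_ge i : n%:R * (s * g i / 4) <= (c i)%:R - (M * a i)%:R.
  have := Ma_le i; have := c_ge i.
  have : n%:R * (s * u / 4) <= n%:R * (s * g i / 4).
    rewrite ler_wpM2l ?(ltW n0)//; have := sg i; lra.
  lra.
have Mac i : (M * a i <= c i)%N.
  rewrite -(ler_nat R) -subr_ge0; apply: le_trans (cMa_ge i).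
  by rewrite mulr_ge0 ?ltW// divr_gt0// mulr_gt0.
pose b i := (c i - M * a i)%N.
have bE i : (b i)%:R = (c i)%:R - (M * a i)%:R :> R by rewrite natrB.
have kn : k%:R <= n%:R * s.
  rewrite -ler_pdivrMr//; apply: hN1; clear -Nn; lia.
have b_le i : (b i)%:R <= 3 * s * n%:R.
  have := Ma_ge i; have := c_le i; rewrite bE.
  have : n%:R * (s * u / 4) <= n%:R * (s / 4).
    rewrite ler_wpM2l ?(ltW n0)//.
    have : s * u <= s by rewrite ger_pMr//; exact: le_trans (gu i) (g1 i).
    lra.
  have : n%:R * (s * g i) <= n%:R * s.
    by rewrite ler_wpM2l ?(ltW n0)// ger_pMr.
  by move: kn n0 s0; nra.
have b_ge i : n%:R * (s * u / 4) <= (b i)%:R.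
  rewrite bE; apply: le_trans (cMa_ge i).
  rewrite ler_wpM2l ?(ltW n0)//; have := sg i; lra.
have cab : c = (fun i => M * a i + b i)%N.
  by apply/funext => i; rewrite /b subnKC.
have cn i : (c i <= n)%N by rewrite -tc /total_count (bigD1 i)//= leq_addr.
have tcab : n = (total_count (fun i => M * a i) + total_count b)%N.
  by rewrite -tc {1}cab total_countD.
have h1 : cost n (displacement step c) <=
    cost (total_count (fun i => M * a i)%N) (displacement step (fun i => M * a i)%N)
    + q * n%:R.
  rewrite {1}tcab {1}cab displacementD.
  apply: le_trans (point_cost_add TD T0 p_ge0 _ _ _) _.
  - exact: displacement_group.
  - exact: point_prob_counts.
  - exact: point_prob_counts.
  rewrite lerD2l; apply: hN0.
  - by clear -Nn; lia.
  - exact: displacement_group.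
  - by apply: l1norm_displacement => i; exact: leq_trans (Mac i) (cn i).
  - by move=> i; apply: le_trans (b_le i) _; rewrite ler_wpM2r.
  - move=> i j; rewrite -(ler_nat R) natrM; apply: le_trans (b_le i) _.
    apply: (@le_trans _ _ (L%:R * (n%:R * (s * u / 4)))); last first.
      by rewrite ler_wpM2l.
    have : s * n%:R * 12 <= s * n%:R * (L%:R * u).
      by rewrite ler_wpM2l// mulr_ge0// ltW.
    lra.
have /andP[_ h2] := hM0 M M0M.
have Mtot : M%:R * (total_count a)%:R <= n%:R :> R.
  by rewrite -natrM ler_nat -total_countM {1}tcab leq_addr.
have Fa : F a = excess F C a + C * (total_count a)%:R by rewrite /excess subrK.
have h3 : M%:R * excess F C a <= (n%:R - k%:R) * ((1 - s) * ext g).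
  apply: (@le_trans _ _ (M%:R * (k%:R * ((1 - s) * ext g)))); first by rewrite ler_wpM2l.
  by rewrite mulrA ler_wnM2r// pmulr_rle0.
have h4 : M%:R * (C * (total_count a)%:R) <= C * n%:R.
  by rewrite mulrCA ler_wpM2l.
have h5 : q * M%:R <= q * n%:R.
  rewrite ler_wpM2l ?(ltW q0)//; apply: le_trans MknR; rewrite ler_peMr//.
  by rewrite ler1n.
have h6 : k%:R * (- ext g) <= n%:R * q.
  rewrite -ler_pdivrMr//; apply: hN2; clear -Nn; lia.
have h7 : (n%:R - k%:R) * ((1 - s) * ext g) <= n%:R * ext g + n%:R * q + k%:R * (- ext g).
  have : n%:R * (s * (1 - ext g)) <= n%:R * q by rewrite ler_wpM2l// ltW.
  have : 0 <= n%:R * s by rewrite mulr_ge0// ltW.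
  have : k%:R * (s * ext g) <= 0 by rewrite pmulr_rle0// pmulr_rle0.
  lra.
move: h1 h2 h3 h4 h5 h6 h7; rewrite Fa.
have -> : e = 4 * q by rewrite /q; lra.
move: (cost n (displacement step c)) (cost (total_count _) _) (excess _ _ _).
move: (total_count a)%:R ((n%:R - k%:R) * _) => tt Z X Y D.
move: (M%:R : R) (k%:R : R) (n%:R : R) (ext g) => M' k' n' H.
lra.
Qed.

End PointAsymptotics.

(** * Compactness of the weights and barycentric coordinates *)

(** A statement that holds eventually, uniformly near each point of the unit cube, holds eventually
    on the whole cube. The filter is general because it serves both for large [n] and for
    neighborhoods of a velocity. *)
Lemma cube_covering (R : realType) m (I : Type) (F : set_system I) (FF : Filter F)
    (Q : I -> ('I_m -> R) -> Prop) :
  (forall g : 'I_m -> R, (forall j, 0 <= g j <= 1) -> exists2 r : R, 0 < r &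
    \forall i \near F, forall g', (forall j, `|g' j - g j| < r) -> Q i g') ->
  \forall i \near F, forall g : 'I_m -> R, (forall j, 0 <= g j <= 1) -> Q i g.
Proof.
move=> hQ; pose K := [set v : 'rV[R]_m | forall j, `[0 : R, 1]%classic (v ord0 j)].
have K_compact : compact K
  by apply: (@rV_compact _ _ (fun=> `[0 : R, 1]%classic)) => j; exact: segment_compact.
have := proj1 (compact_near_coveringP K) K_compact I F (fun i v => Q i (v ord0)) FF.
have -> : (\forall i \near F, forall g : 'I_m -> R, (forall j, 0 <= g j <= 1) -> Q i g) <->
    (\forall i \near F, K `<=` [set v : 'rV[R]_m | Q i (v ord0)]).
  split; apply: filterS => i h.
    by move=> v Kv; apply: h => j; have := Kv j; rewrite /= in_itv.
  move=> g g01; have := h (\row_j g j); rewrite /K /=.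
  have -> : (\row_j g j) ord0 = g by apply/funext => j; rewrite mxE.
  by apply=> j; rewrite in_itv/=.
apply=> v Kv; have [j|r r0 hr] := hQ (v ord0).
  by have := Kv j; rewrite /= in_itv.
exists (ball v r, [set i | forall g', (forall j, `|g' j - v ord0 j| < r) -> Q i g']).
  by split=> //=; exact: nbhsx_ballx.
move=> [v' i] /= [vv' hi]; apply: hi => j.
by have [_ /(_ ord0 j)] := vv'; rewrite /ball/= distrC.
Qed.

Section Barycenter.
Context (R : realType) (d m : nat) (step : 'I_m -> 'rV[int]_d).
Implicit Types g : 'I_m -> R.

Definition simplex g := (forall i, 0 <= g i) /\ \sum_i g i = 1.

Definition barycenter g : 'rV[R]_d := \sum_i g i *: to_real R (step i).

Lemma simplex_le1 g i : simplex g -> g i <= 1.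
Proof.
by move=> [g0 <-]; rewrite (bigD1 i)//= lerDl sumr_ge0.
Qed.

Lemma barycenter_comb s t g g' :
  barycenter (fun i => s * g i + t * g' i) = s *: barycenter g + t *: barycenter g'.
Proof.
rewrite /barycenter !scaler_sumr -big_split; apply: eq_bigr => i _ /=.
by rewrite scalerDl !scalerA.
Qed.

Lemma simplex_comb s t g g' : 0 <= s -> 0 <= t -> s + t = 1 ->
  simplex g -> simplex g' -> simplex (fun i => s * g i + t * g' i).
Proof.
move=> s0 t0 st [g0 gs] [g'0 g's]; split=> [i|].
  by rewrite addr_ge0 ?mulr_ge0.
by rewrite big_split -!mulr_sumr gs g's !mulr1.
Qed.

Lemma barycenter_counts (c : 'I_m -> nat) n :
  barycenter (fun i => (c i)%:R / n%:R) = n%:R^-1 *: to_real R (displacement step c).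
Proof.
apply/rowP => j; rewrite /barycenter /displacement !(summxE, mxE) rmorph_sum mulr_sumr.
apply: eq_bigr => i _; rewrite !mxE mulmxnE rmorphMn -mulr_natl/=; ring.
Qed.

Lemma simplex_counts (c : 'I_m -> nat) n : (0 < n)%N -> total_count c = n ->
  simplex (fun i => (c i)%:R / n%:R).
Proof.
move=> n0 tc; split=> [i|]; first by rewrite divr_ge0.
by rewrite -mulr_suml -natr_sum -/(total_count c) tc divff// pnatr_eq0 -lt0n.
Qed.

Lemma barycenter_dist g g' (r : R) i : (forall j, `|g' j - g j| <= r) ->
  `|barycenter g' 0 i - barycenter g 0 i| <= r * \sum_j `|(step j 0 i)%:~R|.
Proof.
move=> h; rewrite /barycenter !summxE -sumrB mulr_sumr.
apply: le_trans (ler_norm_sum _ _ _) _; apply: ler_sum => j _.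
by rewrite !mxE -mulrBl normrM ler_wpM2r.
Qed.

Lemma barycenter_near g (V : set 'rV[R]_d) : nbhs (barycenter g) V ->
  exists2 r : R, 0 < r & forall g', (forall j, `|g' j - g j| < r) -> V (barycenter g').
Proof.
move=> /nbhs_ballP[e /= e0 eV].
pose B := \sum_i \sum_j `|(step j 0 i)%:~R : R|.
have B0 : 0 <= B by apply: sumr_ge0 => i _; apply: sumr_ge0.
exists (e / (B + 1)); first by rewrite divr_gt0// ltr_wpDl.
move=> g' gg'; apply: eV; split=> // i j; rewrite /ball/= distrC ord1.
apply: le_lt_trans (barycenter_dist _ _) _; first by move=> k; exact/ltW/gg'.
rewrite mulrAC ltr_pdivrMr ?ltr_wpDl// ltr_pM2l//.
apply: (@le_lt_trans _ _ B); last by rewrite ltrDl.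
rewrite /B (bigD1 j)//= lerDl; apply: sumr_ge0 => k _; exact: sumr_ge0.
Qed.

Lemma sum_near g (e : R) : 0 < e ->
  exists2 r : R, 0 < r & forall g', (forall j, `|g' j - g j| < r) ->
    `|\sum_j g' j - \sum_j g j| < e.
Proof.
move=> e0; exists (e / m.+1%:R); first by rewrite divr_gt0.
move=> g' gg'; rewrite -sumrB; apply: le_lt_trans (ler_norm_sum _ _ _) _.
apply: (@le_lt_trans _ _ (\sum_(j < m) (e / m.+1%:R))).
  by apply: ler_sum => j _; exact: ltW.
rewrite sumr_const card_ord -[ltLHS]mulr_natr mulrAC ltr_pdivrMr// ltr_pM2l//.
by rewrite ltr_nat.
Qed.

Lemma simplex_rounding g (r : R) : simplex g -> 0 < r ->
  exists N, forall n, (N <= n)%N -> exists2 c : 'I_m -> nat, total_count c = n &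
    forall i, `|(c i)%:R / n%:R - g i| < r.
Proof.
move=> [g0 gs] r0.
have [i0 _|m0] := pickP (@predT 'I_m); last first.
  by move: gs => /eqP; rewrite big_pred0// eq_sym oner_eq0.
have [N hN] := natr_eventually (m.+1%:R / r).
exists N.+1 => n Nn; have n0 : 0 < n%:R :> R by rewrite ltr0n; clear -Nn; lia.
pose f i := Num.truncn (n%:R * g i).
have f_le i : (f i)%:R <= n%:R * g i by rewrite Num.Theory.truncn_le mulr_ge0.
have f_gt i : n%:R * g i < (f i)%:R + 1.
  by rewrite natr1; exact: Num.Theory.truncnS_gt.
have fn : (total_count f <= n)%N.
  rewrite -(ler_nat R) natr_sum -[n%:R]mulr1 -[X in _ * X]gs mulr_sumr.
  by apply: ler_sum.
have nf : (n <= total_count f + m)%N.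
  rewrite -(ler_nat R) natrD natr_sum -[n%:R]mulr1 -[X in _ * X]gs mulr_sumr.
  rewrite -[X in _ + X%:R]card_ord -sumr_const -big_split/=.
  by apply: ler_sum => i _; exact/ltW/f_gt.
(* All weights are rounded down; the deficit, at most [m], is put on the single index [i0]. *)
exists (fun i => f i + (if i == i0 then n - total_count f else 0))%N.
  rewrite total_countD [X in (_ + X)%N]/total_count -big_mkcond big_pred1_eq.
  by rewrite subnKC.
move=> i; have mn : m.+1%:R <= n%:R * r.
  by rewrite -ler_pdivrMr//; apply: hN; exact: ltnW.
set x := (if i == i0 then _ else _).
have xm : x%:R <= m%:R :> R.
  rewrite ler_nat /x; case: ifP => // _; clear -nf; lia.
have := f_le i; have := f_gt i; move: mn; rewrite -natr1 natrD.
rewrite ltr_distl ltr_pdivrMr// ltr_pdivlMr//.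
move: (ler0n R x) (ler0n R m) xm; move: (x%:R : R) (m%:R : R) => X M X0 M0 XM mn h1 h2.
by apply/andP; split; nra.
Qed.

End Barycenter.

(** * The rate function *)

Section Rate.
Context (R : realType) (d m : nat) (step : 'I_m -> 'rV[int]_d).
Variables (F : ('I_m -> nat) -> R) (C : R).
Hypotheses (C_ge0 : 0 <= C)
  (F_bound : forall a, positive_counts a -> 0 <= F a <= C * (total_count a)%:R)
  (F_hom : forall a k, positive_counts a -> (0 < k)%N ->
    F (fun i => k * a i)%N = k%:R * F a)
  (F_sub : forall a b, positive_counts a -> positive_counts b ->
    F (fun i => a i + b i)%N <= F a + F b).
Variables (U : set 'rV[R]_d) (I : 'rV[R]_d -> R).
Hypotheses
  (U_barycenter : forall zeta, U zeta <->
    exists2 g, simplex g & zeta = barycenter step g)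
  (I_barycenter : forall g : 'I_m -> R, simplex g ->
    I (barycenter step g) = C + extension F C g).
Notation ext := (extension F C).

Lemma rate_ge0 zeta : U zeta -> 0 <= I zeta.
Proof.
move=> /U_barycenter[g gS ->]; rewrite I_barycenter//; case: gS => g0 gs.
by have := extension_lower C_ge0 F_bound g0; rewrite gs mulr1; lra.
Qed.

(** Weights need not depend continuously on the velocity, so all representations are treated at once
    by covering the cube. Near a representation of [zeta] the extension is continuous; near any
    other point of the simplex the barycenter stays away from [zeta], hence from every [eta] close
    to it; points with a sum other than 1 have a neighborhood off the simplex. *)
Lemma rate_continuous : {within U, continuous I}.
Proof.
apply/subspace_continuousP => zeta Uz; apply/cvgrPdist_lt => e e0.
rewrite near_withinE.
pose Q (eta : 'rV[R]_d) (g : 'I_m -> R) :=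
  simplex g -> barycenter step g = eta -> `|I zeta - I eta| < e.
have : \forall eta \near zeta, forall g : 'I_m -> R, (forall j, 0 <= g j <= 1) -> Q eta g.
  apply: (@cube_covering R m _ (nbhs zeta) _ Q) => g g01.
  have g0 i : 0 <= g i by have /andP[] := g01 i.
  have [gs|gs] := eqVneq (\sum_j g j) 1; last first.
    have [|r r0 hr] := @sum_near _ _ g `|\sum_j g j - 1|.
      by rewrite normr_gt0 subr_eq0.
    exists r => //; near=> eta => g' gg' [_ g's] _.
    by have := hr g' gg'; rewrite g's distrC ltxx.
  have [gz|gz] := eqVneq (barycenter step g) zeta.
    have [r r0 hr] := extension_continuous F_bound F_hom g0 e0.
    exists r => //; near=> eta => g' gg' g'S <-.
    rewrite -gz !I_barycenter// opprD addrACA subrr add0r distrC; apply: hr => //.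
    by case: g'S.
  have := @norm_hausdorff R 'rV[R]_d.
  rewrite open_hausdorff => /(_ _ _ gz)[[V W]/=].
  rewrite !inE => -[Vg Wz] [oV oW VW0].
  have [r r0 hr] := barycenter_near (open_nbhs_nbhs (conj oV Vg)).
  exists r => //.
  apply: filterS (open_nbhs_nbhs (conj oW Wz)) => eta Weta g' gg' _ g'eta.
  have : (V `&` W) eta by split=> //; rewrite -g'eta; exact: hr.
  by rewrite VW0.
apply: filterS => eta h /U_barycenter[g gS geta].
by apply: (h g) => // j; rewrite (simplex_le1 j gS) andbT; case: gS.
Unshelve. all: by end_near. Qed.

Lemma rate_convex : convex_function U I.
Proof.
move=> t x y; rewrite !inE => /U_barycenter[g gS ->] /U_barycenter[h hS ->].
rewrite convRE.
have -> : conv t (barycenter step g : convex_lmodType _) (barycenter step h) =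
    barycenter step (fun i => t%:num * g i + (1 - t%:num) * h i).
  by rewrite barycenter_comb.
have t01 : (0 : R) <= (t%:num : R) <= 1 by rewrite ge0 le1.
have /andP[t0 t1] := t01.
rewrite !I_barycenter//; last by apply: simplex_comb => //; lra.
have := extension_convex F_bound F_hom F_sub t01 (proj1 gS) (proj1 hS).
rewrite /unstable.onem; lra.
Qed.

End Rate.

(** * Exponential rates, polynomial factors and the number of endpoints *)

Lemma limn_esup_le (R : realType) (u : nat -> \bar R) (x : \bar R) N :
  (forall n, (N <= n)%N -> (u n <= x)%E) -> (limn_esup u <= x)%E.
Proof.
move=> h; apply: (@le_trans _ _ (ereal_sup [set u n | n in [set n | (N <= n)%N]])).
  apply: ereal_inf_lbound; exists [set n | (N <= n)%N] => //.
  by exists N => // n; exact.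
by apply: ge_ereal_sup => _ [n /= Nn <-]; exact: h.
Qed.

Lemma limn_einf_ge (R : realType) (u : nat -> \bar R) (x : \bar R) N :
  (forall n, (N <= n)%N -> (x <= u n)%E) -> (x <= limn_einf u)%E.
Proof.
move=> h; rewrite /limn_einf leeNr; apply: (@limn_esup_le _ _ _ N) => n Nn.
by rewrite leeN2; exact: h.
Qed.

Lemma ln_pow_div_cvg0 (R : realType) k (e : R) : 0 < e ->
  exists N, forall n, (N <= n)%N -> ln ((n.+1%:R : R) ^+ k) <= e * n%:R.
Proof.
move=> e0; have [->|k0] := eqVneq k 0%N.
  by exists 0%N => n _; rewrite expr0 ln1 mulr_ge0// ltW.
have kR : 0 < k%:R :> R by rewrite ltr0n lt0n.
(* [ln (n.+1) = 2 ln (sqrt n.+1) <= 2 sqrt n.+1] *)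
have [N hN] := natr_eventually (8 * (k%:R / e) ^+ 2).
exists N.+1 => n Nn; have n0 : 0 < n%:R :> R by rewrite ltr0n; clear -Nn; lia.
have n1 : 1 <= n%:R :> R by rewrite ler1n -(ltr0n R).
set s := Num.sqrt (n.+1%:R : R).
have sn : s ^+ 2 = n%:R + 1 by rewrite sqr_sqrtr// natr1.
have s0 : 0 < s by rewrite sqrtr_gt0.
rewrite lnXn ?ltr0n// -[n.+1%:R]natr1 -sn lnXn// -[leLHS]mulr_natl -[ln s *+ 2]mulr_natl.
have ls : ln s <= s by exact/ltW/ln_sublinear.
have h : 8 * (k%:R / e) ^+ 2 <= n%:R by apply: hN; exact: ltnW.
apply: (@le_trans _ _ (k%:R * (2 * s))).
  by rewrite ler_wpM2l ?(ltW kR)// ler_wpM2l.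
have ke : k%:R = (k%:R / e) * e by rewrite divfK// gt_eqF.
rewrite ke; move: (divr_gt0 kR e0) h; move: (k%:R / e) => K K0 h.
(* After squaring this reads [4 K^2 (n+1) <= n^2], which follows from [8 K^2 <= n] and
   [n+1 <= 2 n]. *)
suff : K * (2 * s) <= n%:R by move=> h1; rewrite mulrAC [leRHS]mulrC ler_wpM2r// ltW.
rewrite -(@ler_pXn2r _ 2)// ?nnegrE ?mulr_ge0 ?(ltW K0) ?(ltW s0)//.
by rewrite !exprMn sn; move: (K ^+ 2) (sqr_ge0 K) h => KK KK0 h; nra.
Qed.

Section PointProbabilities.
Context (R : realType) (d : nat) (steps : {fset 'rV[int]_d}).
Context (Omega : Type) (T : 'rV[int]_d -> Omega -> Omega).
Context (p : Omega -> 'rV[int]_d -> R).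
Context (m : nat) (step : 'I_m -> 'rV[int]_d).
Hypothesis step_surj : forall z, z \in steps -> exists i, z = step i.

Lemma point_prob_support n w x : point_prob steps T p n w x != 0 ->
  exists2 c : 'I_m -> nat, total_count c = n & x = displacement step c.
Proof.
elim: n w x => [|n IH] w x /=.
  have [->|_] := eqVneq x 0; last by rewrite eqxx.
  move=> _.
  exists (fun=> 0%N); first by rewrite /total_count big1.
  by rewrite /displacement big1// => i _; rewrite mulr0n.
have [//|] := pselect (exists2 c : 'I_m -> nat, total_count c = n.+1 & x = displacement step c).
move=> nc; rewrite big_seq big1 ?eqxx// => z zs; apply/eqP; rewrite mulf_eq0; apply/orP; right.
apply/negPn/negP => /IH[c tc xc]; apply: nc; have [i zi] := step_surj zs.
exists (fun j => c j + (j == i))%N.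
  rewrite total_countD tc /total_count (bigD1 i)//= eqxx big1 ?addn0 ?addn1//.
  by move=> j /negPf ->.
rewrite displacementD -xc /displacement (bigD1 i)//= eqxx mulr1n big1 ?addr0.
  by rewrite -zi subrK.
by move=> j /negPf ->; rewrite mulr0n.
Qed.

Context (w : Omega) (Q : probability (path_space d) R).
Hypothesis Q_point : forall n x,
  Q [set X : nat -> 'rV[int]_d | X n = x] = (point_prob steps T p n w x)%:E.

(** Union bound over the endpoints. Each is the displacement of counts with values in [{0, ..., n}],
    which leaves at most [(n+1)^m] of them; all other lattice points carry no mass. *)
Lemma velocity_law_le n (A : set 'rV[R]_d) (B : R) : 0 <= B ->
  (forall c : 'I_m -> nat, total_count c = n ->
    A (n%:R^-1 *: to_real R (displacement step c)) ->
    point_prob steps T p n w (displacement step c) <= B) ->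
  (velocity_law Q n A <= (n.+1%:R ^+ m * B)%:E)%E.
Proof.
move=> B0 hB; set E := [set X : nat -> 'rV[int]_d | A (n%:R^-1 *: to_real R (X n))].
pose ct : seq {ffun 'I_m -> 'I_n.+1} := enum {ffun 'I_m -> 'I_n.+1}.
pose x_ (j : nat) := displacement step (fun i => nth (finfun (fun=> ord0)) ct j i : nat).
(* The enumeration also contains tuples whose total is not [n], so the event keeps only endpoints
   that some counts of total [n] reach; the hypothesis on [B] applies to those. *)
pose A_ (j : nat) : set (path_space d) := [set X | A (n%:R^-1 *: to_real R (x_ j)) /\
   (exists2 c : 'I_m -> nat, total_count c = n & x_ j = displacement step c) /\ X n = x_ j].
have mA j : measurable (A_ j).
  have [[Aj cj]|nAj] := pselect (A (n%:R^-1 *: to_real R (x_ j)) /\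
   (exists2 c : 'I_m -> nat, total_count c = n & x_ j = displacement step c)).
    have -> : A_ j = [set X | X n = x_ j].
      by apply/seteqP; split=> [X [_ [_]]//|X Xn]; split.
    exact: measurable_coordinate.
  rewrite (_ : A_ j = set0)//; apply/seteqP; split=> // X [h1 [h2 _]].
  by apply: nAj.
have QA j : (Q (A_ j) <= B%:E)%E.
  have [[Aj [c tc cj]]|nAj] := pselect (A (n%:R^-1 *: to_real R (x_ j)) /\
   (exists2 c : 'I_m -> nat, total_count c = n & x_ j = displacement step c)).
    have -> : A_ j = [set X | X n = x_ j].
      by apply/seteqP; split=> [X [_ [_]]//|X Xn]; split=> //; split=> //; exists c.
    rewrite Q_point lee_fin cj; apply: hB => //; by rewrite -cj.
  rewrite (_ : A_ j = set0) ?measure0 ?lee_fin//.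
  by apply/seteqP; split=> // X [h1 [h2 _]]; apply: nAj.
have mE : measurable (E : set (path_space d)).
  exact: (@measurable_coordinate_set d n [set x | A (n%:R^-1 *: to_real R x)]).
pose S : set (path_space d) := \big[setU/set0]_(j < size ct) A_ j.
have mS : measurable S by apply: bigsetU_measurable.
have ES0 : Q (E `\` S) = 0%E.
  apply: measure_negligible; first exact: measurableD.
  have : {ae Q, forall X, forall x, point_prob steps T p n w x = 0 -> X n <> x}.
    apply: ae_forall_count => x.
    have [q0|q0] := eqVneq (point_prob steps T p n w x) 0; last first.
      by apply: aeW => X h; move: q0; rewrite h eqxx.
    exists [set X | X n = x]; split.
    - exact: measurable_coordinate.
    - by have := Q_point n x; rewrite q0.
    - by move=> X /= /not_implyP[_ /contrapT].
  apply: negligibleS => X [EX nSX] hX; apply: nSX.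
  have [//|q0] := eqVneq (point_prob steps T p n w (X n)) 0; first by move/hX.
  have [c tc Xc] := point_prob_support q0.
  have cn i : (c i < n.+1)%N by rewrite ltnS -tc /total_count (bigD1 i)//= leq_addr.
  pose f := [ffun i => Ordinal (cn i)].
  have fj : (index f ct < size ct)%N by rewrite index_mem mem_enum.
  rewrite /S (bigD1 (Ordinal fj))//=; left.
  have xf : x_ (index f ct) = X n.
    rewrite /x_ nth_index ?mem_enum// Xc; congr (displacement step _).
    by apply/funext => i; rewrite ffunE.
  by rewrite /A_ /= xf; split=> //; split=> //; exists c.
have -> : velocity_law Q n A = Q E by [].
apply: (@le_trans _ _ (Q (S `|` (E `\` S)))).
  apply: le_measure; rewrite ?inE//; first by apply: measurableU => //; exact: measurableD.
  by move=> X EX; have [|] := pselect (S X); [left|right].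
apply: (le_trans (measureU2 _ _ _)) => //; first exact: measurableD.
rewrite [X in (_ + X)%E](_ : _ = 0%E) ?adde0; last exact: ES0.
apply: le_trans (Boole_inequality _ (fun j _ => mA j)) _.
apply: (@le_trans _ _ (\sum_(j < size ct) B%:E)%E); first by apply: lee_sum => j _; exact: QA.
rewrite sumEFin lee_fin sumr_const card_ord -[leLHS]mulr_natl.
by rewrite -cardE card_ffun !card_ord natrX.
Qed.

End PointProbabilities.

Lemma lee_addeps (R : realType) (x : \bar R) (y : R) :
  (forall e : R, 0 < e -> (x <= (y + e)%:E)%E) -> (x <= y%:E)%E.
Proof. by move=> h; apply/lee_addgt0Pr => e e0; rewrite -EFinD; exact: h. Qed.

(** * Large deviations for a typical environment *)

Section LargeDeviations.
Context (R : realType) (d : nat) (steps : {fset 'rV[int]_d}).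
Context (Omega : Type) (T : 'rV[int]_d -> Omega -> Omega).
Context (p : Omega -> 'rV[int]_d -> R).
Hypotheses
  (TD : forall x y, step_group steps x -> step_group steps y ->
        forall w, T (x + y) w = T x (T y w))
  (T0 : forall w, T 0 w = w)
  (p_pos : forall w z, z \in steps -> 0 < p w z)
  (p_sum : forall w, \sum_(z <- steps) p w z = 1).
Context (m : nat) (step : 'I_m -> 'rV[int]_d).
Hypotheses (step_mem : forall i, step i \in steps)
  (step_surj : forall z, z \in steps -> exists i, z = step i)
  (m_gt0 : (0 < m)%N).
Variables (F : ('I_m -> nat) -> R) (C : R).
Hypotheses (C_ge0 : 0 <= C)
  (F_bound : forall a, positive_counts a -> 0 <= F a <= C * (total_count a)%:R)
  (F_hom : forall a k, positive_counts a -> (0 < k)%N ->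
    F (fun i => k * a i)%N = k%:R * F a)
  (F_sub : forall a b, positive_counts a -> positive_counts b ->
    F (fun i => a i + b i)%N <= F a + F b).
Variables (U : set 'rV[R]_d) (I : 'rV[R]_d -> R).
Hypotheses
  (U_barycenter : forall zeta, U zeta <->
    exists2 g, simplex g & zeta = barycenter step g)
  (I_barycenter : forall g : 'I_m -> R, simplex g ->
    I (barycenter step g) = C + extension F C g).
Variable w : Omega.
Hypotheses (w_tame : tame steps T p w)
  (w_cvg : forall a, positive_counts a ->
    point_cost steps T p (n * total_count a) w (displacement step a *+ n) / n%:R
      @[n --> \oo] --> F a).
Variable Q : probability (path_space d) R.
Hypothesis Q_point : forall n x,
  Q [set X : nat -> 'rV[int]_d | X n = x] = (point_prob steps T p n w x)%:E.
Notation ext := (extension F C).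
Notation cost n x := (point_cost steps T p n w x).

Let p_ge0 w' z : z \in steps -> 0 <= p w' z.
Proof. by move=> zs; rewrite ltW// p_pos. Qed.

Let probE c : point_prob steps T p (total_count c) w (displacement step c) =
  expR (- cost (total_count c) (displacement step c)).
Proof.
rewrite /point_cost opprK lnK// posrE.
exact: (point_prob_counts TD T0 p_ge0 p_pos step_mem).
Qed.

Let lne_probE c : lne (Q [set X : nat -> 'rV[int]_d |
    X (total_count c) = displacement step c]) =
  (- cost (total_count c) (displacement step c))%:E.
Proof. by rewrite Q_point probE lne_EFin ?expR_gt0// expRK. Qed.

(** Uniform over all counts of total [n]. The local bound [point_cost_ge] around each [g], with
    [ext g] replaced by its value at the actual weights through continuity, is made global by
    compactness of the cube. *)
Lemma counts_cost_ge (e : R) : 0 < e -> exists N, forall n c, (N <= n)%N ->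
  total_count c = n -> n%:R * (C + ext (fun i => (c i)%:R / n%:R) - e) <=
    cost n (displacement step c).
Proof.
move=> e0; have e20 : 0 < e / 2 by rewrite divr_gt0.
pose Qc (n : nat) (g : 'I_m -> R) := forall c, total_count c = n ->
  (forall i, (c i)%:R / n%:R = g i) ->
  n%:R * (C + ext g - e) <= cost n (displacement step c).
have [N _ hN] : \forall n \near \oo, forall g : 'I_m -> R, (forall j, 0 <= g j <= 1) -> Qc n g.
  apply: (@cube_covering R m _ \oo _ Qc) => g g01.
  have g0 i : 0 <= g i by have /andP[] := g01 i.
  have g1 i : g i <= 1 by have /andP[] := g01 i.
  have [r1 r10 [N hN]] := point_cost_ge TD T0 p_pos p_sum step_mem step_surj C_ge0
    F_bound F_hom F_sub w_tame w_cvg g0 g1 e20.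
  have [r2 r20 hr2] := extension_continuous F_bound F_hom g0 e20.
  exists (Num.min r1 r2); first by rewrite lt_min r10.
  exists N => // n /= Nn g' gg' c tc cg'.
  have gg1 i : `|g' i - g i| < r1 by apply: lt_le_trans (gg' i) _; rewrite ge_min lexx.
  have gg2 i : `|g' i - g i| < r2 by apply: lt_le_trans (gg' i) _; rewrite ge_min lexx orbT.
  apply: le_trans (hN n c Nn tc _); last by move=> i; rewrite cg'.
  rewrite ler_wpM2l//.
  have g'0 i : 0 <= g' i by rewrite -cg' divr_ge0.
  have := hr2 g' g'0 gg2; rewrite ltr_distl => /andP[_]; lra.
exists N.+1 => n c Nn tc.
apply: (hN n (ltnW Nn) (fun i => (c i)%:R / n%:R)) => // j.
have S : simplex (fun i => (c i)%:R / n%:R : R).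
  by apply: simplex_counts => //; exact: leq_trans Nn.
by rewrite (simplex_le1 j S) andbT; case: S.
Qed.

(** For every real [v] below the infimum, [counts_cost_ge] bounds the probability of each endpoint
    with velocity in [A] by [exp (- n (v - e/2))], and the number of endpoints costs another [e/2].
    Arguing with real [v] also covers the infimum [+oo] of an empty [A]. *)
Lemma large_deviation_upper (A : set 'rV[R]_d) :
  (limn_esup (fun n => (n%:R^-1)%:E * lne (velocity_law Q n A))
    <= - ereal_inf [set (I x)%:E | x in A])%E.
Proof.
set L := ereal_inf _.
have key (v : R) : (v%:E <= L)%E ->
    (limn_esup (fun n => (n%:R^-1)%:E * lne (velocity_law Q n A)) <= (- v)%:E)%E.
  move=> vL; apply: lee_addeps => e e0; have e20 : 0 < e / 2 by rewrite divr_gt0.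
  have [N1 hN1] := counts_cost_ge e20.
  have [N2 hN2] := ln_pow_div_cvg0 m e20.
  apply: (@limn_esup_le _ _ _ (N1 + N2).+1) => n Nn.
  have n0 : 0 < n%:R :> R by rewrite ltr0n; clear -Nn; lia.
  have Q0 : (0 <= velocity_law Q n A)%E by exact: measure_ge0.
  have QB : (velocity_law Q n A <= (n.+1%:R ^+ m * expR (n%:R * (e / 2 - v)))%:E)%E.
    apply: (velocity_law_le step_surj Q_point); first exact: expR_ge0.
    move=> c tc Ac; rewrite -[X in point_prob _ _ _ X]tc probE ler_expR tc.
    have S : simplex (fun i => (c i)%:R / n%:R : R).
      by apply: simplex_counts => //; rewrite -(ltr0n R).
    have Iv : v <= C + ext (fun i => (c i)%:R / n%:R).
      rewrite -I_barycenter// barycenter_counts -lee_fin; apply: le_trans vL _.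
      by apply: ereal_inf_lbound; eexists; [exact: Ac|].
    rewrite lerNl; apply: le_trans (hN1 n c _ tc); last by clear -Nn; lia.
    by rewrite -mulrN ler_wpM2l ?(ltW n0)//; lra.
  set B := _ * expR _ in QB.
  have B0 : 0 < B by rewrite mulr_gt0 ?expR_gt0// exprn_gt0.
  have : (lne (velocity_law Q n A) <= (n%:R * (e - v))%:E)%E.
    apply: (@le_trans _ _ (lne B%:E)).
      by rewrite lee_lne// ?in_itv/= ?Q0 ?leey// lee_fin ltW.
    rewrite lne_EFin// lee_fin lnM ?posrE ?expR_gt0 ?exprn_gt0// expRK.
    have := hN2 n; rewrite (_ : (N2 <= n)%N = true); last by clear -Nn; lia.
    by move=> /(_ isT); lra.
  move=> h; have ni : (0 <= (n%:R^-1)%:E :> \bar R)%E by rewrite lee_fin invr_ge0.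
  apply: le_trans (lee_wpmul2l ni h) _.
  by rewrite -EFinM lee_fin mulKf ?gt_eqF//; lra.
have [h|[h|[r h]]] : (L = +oo \/ L = -oo \/ exists r : R, L = r%:E)%E.
  by case: {key} L => [r| |]; [right; right; exists r|left|right; left].
- rewrite h leeNr leye_eq; apply/eqP/eqyP => v _; rewrite leeNr -EFinN.
  by apply: key; rewrite h leey.
- by rewrite h /= leey.
- by rewrite h /=; apply: key; rewrite h.
Qed.

Lemma point_cost_near (g : 'I_m -> R) (e : R) : simplex g -> (forall i, 0 < g i) -> 0 < e ->
  exists2 r : R, 0 < r & exists N, forall n (c : 'I_m -> nat), (N <= n)%N ->
    total_count c = n -> (forall i, `|(c i)%:R / n%:R - g i| < r) ->
    cost n (displacement step c) <= n%:R * (I (barycenter step g) + e).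
Proof.
move=> gS g0 e0; rewrite I_barycenter//.
apply: (point_cost_le TD T0 p_pos p_sum step_mem step_surj C_ge0 F_bound F_hom
  w_tame w_cvg) => // i.
exact: simplex_le1.
Qed.

(** A representation [g] of [zeta] may have zero weights, where [point_cost_near] does not apply.
    Mixing in a little of the uniform weights makes them positive, keeps the velocity in [V] and
    changes the rate by at most [e/2]; one endpoint near these weights already has enough
    probability. *)
Lemma large_deviation_lower (V : set 'rV[R]_d) : open V ->
  (- ereal_inf [set (I x)%:E | x in U `&` V]
    <= limn_einf (fun n => (n%:R^-1)%:E * lne (velocity_law Q n (U `&` V))))%E.
Proof.
move=> oV; rewrite leeNl; apply: le_ereal_inf_tmp => _ [zeta [Uz Vz] <-].
rewrite leeNl -EFinN.
set lim := limn_einf _.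
suff : (- lim <= (I zeta)%:E)%E by rewrite leeNl.
apply: lee_addeps => e e0; rewrite leeNl -EFinN.
have /U_barycenter[g gS zg] := Uz.
have gE : g = (fun i => 1 * g i + 0 * g i) by apply/funext => i; rewrite mul1r mul0r addr0.
pose u (i : 'I_m) : R := m%:R^-1.
have uS : simplex u.
  split=> [i|]; first by rewrite invr_ge0.
  by rewrite sumr_const card_ord -[LHS]mulr_natl divff// pnatr_eq0 -lt0n.
have e20 : 0 < e / 2 by rewrite divr_gt0.
have [r r0 hr] : exists2 r : R, 0 < r &
    forall g', (forall j, `|g' j - g j| < r) -> V (barycenter step g').
  by apply: barycenter_near; apply: open_nbhs_nbhs; rewrite -zg.
have [r1 r10 hr1] := extension_continuous F_bound F_hom (proj1 gS) e20.
(* Both the mixing and the later rounding move the weights by at most [t], hence the bound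
   [2 * t <= r]. *)
pose t := Num.min 1 (Num.min r r1) / 2.
have t0 : 0 < t by rewrite divr_gt0// !lt_min ltr01 r0.
have [t1 tr tr1] : [/\ 2 * t <= 1, 2 * t <= r & 2 * t <= r1].
  by rewrite /t mulrC divfK// !ge_min !lexx !orbT.
pose h i := (1 - t) * g i + t * u i.
have hS : simplex h by apply: simplex_comb => //; [lra|exact: ltW|lra].
have h0 i : 0 < h i.
  apply: ltr_wpDl; first by rewrite mulr_ge0 ?(proj1 gS)//; lra.
  by rewrite mulr_gt0// invr_gt0 ltr0n.
have hg i : `|h i - g i| <= t.
  have := simplex_le1 i gS; have := simplex_le1 i uS.
  have := proj1 gS i; have := proj1 uS i; rewrite ler_norml /h; nra.
have Ih : I (barycenter step h) <= I zeta + e / 2.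
  rewrite zg !I_barycenter//.
  have := hr1 h (proj1 hS); rewrite ltr_distl => hh.
  have /andP[_] : (ext g - e / 2 < ext h < ext g + e / 2).
    by apply: hh => i; have := hg i; lra.
  lra.
have [r2 r20 [N2 hN2]] := point_cost_near hS h0 e20.
have [|N3 hN3] := simplex_rounding (r := Num.min t r2) hS; first by rewrite lt_min t0.
apply: (@limn_einf_ge _ _ _ (N2 + N3).+1) => n Nn.
have n0 : 0 < n%:R :> R by rewrite ltr0n; clear -Nn; lia.
have [|c tc cn] := hN3 n; first by clear -Nn; lia.
have cnt i : `|(c i)%:R / n%:R - h i| < t by apply: lt_le_trans (cn i) _; rewrite ge_min lexx.
have cnr i : `|(c i)%:R / n%:R - h i| < r2.
  by apply: lt_le_trans (cn i) _; rewrite ge_min lexx orbT.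
have cS : simplex (fun i => (c i)%:R / n%:R : R).
  by apply: simplex_counts => //; rewrite -(ltr0n R).
have cUV : (U `&` V) (n%:R^-1 *: to_real R (displacement step c)).
  rewrite -barycenter_counts; split; first by apply/U_barycenter; eexists; [exact: cS|].
  apply: hr => i; have := ler_distD (h i) ((c i)%:R / n%:R) (g i).
  by have := hg i; have := cnt i; lra.
have hc := hN2 n c; rewrite (_ : (N2 <= n)%N = true) in hc; last by clear -Nn; lia.
have {}hc := hc isT tc cnr.
have QQ : (Q [set X : nat -> 'rV[int]_d | X n = displacement step c]
    <= velocity_law Q n (U `&` V))%E.
  apply: le_measure; rewrite ?inE.
  - exact: measurable_coordinate.
  - exact: (@measurable_coordinate_set d n [set x | (U `&` V) (n%:R^-1 *: to_real R x)]).
  - by move=> X /= ->.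
have : ((- (n%:R * (I zeta + e)))%:E <= lne (velocity_law Q n (U `&` V)))%E.
  apply: (@le_trans _ _ (lne (Q [set X : nat -> 'rV[int]_d | X n = displacement step c]))).
    rewrite -[X in [set Y : nat -> 'rV[int]_d | Y X = _]]tc lne_probE lee_fin lerN2 tc.
    by apply: le_trans hc _; rewrite ler_wpM2l//; lra.
  by rewrite lee_lne// in_itv/= measure_ge0 leey.
move=> hl; have ni : (0 <= (n%:R^-1)%:E :> \bar R)%E by rewrite lee_fin invr_ge0.
apply: le_trans (lee_wpmul2l ni hl).
by rewrite -EFinM lee_fin mulrN mulKf// gt_eqF.
Qed.

(** The lower bound on the cost is read off at the counts [c n]. For the upper bound they are
    replaced by counts with the same total and endpoint whose proportions approach positive weights
    [b]; such [b] exist because [a] is positive with the barycenter of [g]. *)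
Lemma point_prob_cvg (g a : 'I_m -> R) (c : nat -> 'I_m -> nat) :
  simplex g -> simplex a -> (forall i, 0 < a i) -> barycenter step a = barycenter step g ->
  (forall n, total_count (c n) = n) ->
  (forall n i, `|(c n i)%:R - n%:R * g i| <= 1) ->
  ((n%:R^-1)%:E * lne (Q [set X : nat -> 'rV[int]_d | X n = displacement step (c n)]))%E
    @[n --> \oo] --> (- I (barycenter step g))%:E.
Proof.
move=> gS aS a0 ag tc cg.
have [e0 e00 ae0] := pos_lower_bound a0.
pose v i := a i - g i.
have v0 : \sum_i v i = 0 by rewrite sumrB (proj2 aS) (proj2 gS) subrr.
have vz : \sum_i v i *: to_real R (step i) = 0.
  have -> : \sum_i v i *: to_real R (step i) = barycenter step a - barycenter step g.
    by rewrite /barycenter -sumrB; apply: eq_bigr => i _; rewrite scalerBl.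
  by rewrite ag subrr.
have e01 : 0 < e0 / 2 by rewrite divr_gt0.
(* The difference [a - g] is a real relation between the steps; only integral ones can be added to
   counts. At distance below half the least weight of [a], [g + u / l] is still positive. *)
have [l [u [l0 u0 uz uv]]] := rational_relation_approx e01 v0 vz.
have lR : 0 < l%:R :> R by rewrite ltr0n.
pose b i := g i + (u i)%:~R / l%:R.
have b0 i : 0 < b i.
  have := uv i; have := ae0 i; rewrite ltr_distl /b /v => h1 /andP[h2 h3]; lra.
have uS : \sum_i (u i)%:~R = 0 :> R by rewrite -rmorph_sum u0.
have bS : simplex b.
  split=> [i|]; first exact: ltW.
  by rewrite /b big_split /= (proj2 gS) -mulr_suml uS mul0r addr0.
have bg : barycenter step b = barycenter step g.
  have -> : b = (fun i => 1 * g i + l%:R^-1 * (u i)%:~R).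
    by apply/funext => i; rewrite /b mul1r mulrC.
  rewrite barycenter_comb scale1r (_ : barycenter step (fun i => (u i)%:~R) = 0) ?scaler0 ?addr0//.
  apply/rowP => j; rewrite /barycenter summxE !mxE.
  transitivity ((\sum_i (step i *~ u i) 0 j)%:~R : R).
    rewrite rmorph_sum; apply: eq_bigr => i _; rewrite !mxE -rmorphM/=; congr (_%:~R).
    by rewrite -scaler_int mxE intz mulrC.
  by rewrite -summxE uz mxE.
pose u1 := \sum_i `|(u i)%:~R : R|.
have u1_ge i : `|(u i)%:~R| <= u1 by rewrite /u1 (bigD1 i)//= lerDl sumr_ge0.
have u10 : 0 <= u1 by exact: sumr_ge0.
(* [z n] moves the counts from near [n g] to near [n b] along a relation. *)
pose z n i : int := (c n i)%:Z + u i * (n %/ l)%N%:Z.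
have zR n i : (z n i)%:~R = (c n i)%:R + (u i)%:~R * (n %/ l)%:R :> R.
  by rewrite /z intrD intrM.
have zb n i : `|(z n i)%:~R - n%:R * b i| <= 1 + u1.
  have -> : (z n i)%:~R - n%:R * b i = ((c n i)%:R - n%:R * g i) +
      (u i)%:~R * ((n %/ l)%:R - n%:R / l%:R) by rewrite zR /b; ring.
  apply: le_trans (ler_normD _ _) _; apply: lerD; first exact: cg.
  rewrite normrM -[leRHS]mulr1; apply: ler_pM => //.
  have h1 : (n %/ l)%:R * l%:R <= n%:R :> R by rewrite -natrM ler_nat leq_divM.
  have h2 : n%:R <= (n %/ l)%:R * l%:R + l%:R :> R.
    by rewrite -natrM -natrD ler_nat addnC -mulSn ltnW// -ltn_divLR.
  have -> : n%:R / l%:R = (n %/ l)%:R + (n%:R - (n %/ l)%:R * l%:R) / l%:R :> R.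
    by field; rewrite gt_eqF.
  rewrite opprD addNKr normrN ger0_norm ?divr_ge0 ?subr_ge0// ler_pdivrMr//; lra.
have [e1 e10 be1] := pos_lower_bound b0.
(* From here on [n * b] exceeds the rounding error [1 + u1], so the moved counts are nonnegative and
   the absolute value in [c'] changes nothing. *)
have [N0 hN0] := natr_eventually ((1 + u1) / e1).
pose c' n i := `|z n i|%N.
have c'E n i : (N0 <= n)%N -> (c' n i)%:Z = z n i.
  move=> /hN0; rewrite ler_pdivrMr// => h; apply/gez0_abs.
  rewrite -(ler0z R); have := zb n i; rewrite ler_distl => /andP[+ _].
  by apply: le_trans; rewrite subr_ge0; apply: le_trans h _; rewrite ler_wpM2l.
have c'R n i : (N0 <= n)%N -> (c' n i)%:R = (z n i)%:~R :> R.
  by move=> Nn; rewrite -(c'E n i Nn).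
have tc' n : (N0 <= n)%N -> total_count (c' n) = n.
  move=> Nn; apply/eqP; rewrite -(eqr_nat R) natr_sum.
  under eq_bigr do rewrite c'R// zR.
  by rewrite big_split/= -mulr_suml uS mul0r addr0 -natr_sum -/(total_count _) tc.
have dc' n : (N0 <= n)%N -> displacement step (c' n) = displacement step (c n).
  move=> Nn; rewrite /displacement.
  under eq_bigr do rewrite pmulrn c'E// /z mulrzDr mulrzA.
  by rewrite big_split /= -mulrz_suml uz mul0rz addr0.
have -> : (fun n => (n%:R^-1)%:E *
      lne (Q [set X : nat -> 'rV[int]_d | X n = displacement step (c n)]))%E =
    (fun n => (n%:R^-1 * - cost n (displacement step (c n)))%:E).
  by apply/funext => n; rewrite -[X in [set Y : nat -> 'rV[int]_d | Y X = _]]tc lne_probE tc.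
apply/fine_cvgP; split; first by near=> n.
apply/cvgrPdist_le => e e_gt0; have e20 : 0 < e / 2 by rewrite divr_gt0.
have [r1 r10 hr1] := extension_continuous F_bound F_hom (proj1 gS) e20.
have [N1 hN1] := counts_cost_ge e20.
have [r2 r20 [N2 hN2]] := point_cost_near bS b0 e_gt0.
have [N3 hN3] := natr_eventually (2 / r1).
have [N4 hN4] := natr_eventually ((2 + u1) / r2).
exists (N0 + N1 + N2 + N3 + N4).+1 => // n /= Nn.
have n0 : 0 < n%:R :> R by rewrite ltr0n; clear -Nn; lia.
have divE x (y : R) : x / n%:R - y = (x - n%:R * y) / n%:R by field; rewrite gt_eqF.
have upper : cost n (displacement step (c n)) <= n%:R * (I (barycenter step g) + e).
  rewrite -dc'; last by clear -Nn; lia.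
  rewrite -bg; apply: hN2; first by clear -Nn; lia.
    by apply: tc'; clear -Nn; lia.
  move=> i; rewrite divE normrM normfV [X in X^-1]ger0_norm// ltr_pdivrMr// c'R; last first.
    by clear -Nn; lia.
  apply: le_lt_trans (zb n i) _.
  have : (2 + u1) / r2 <= n%:R by apply: hN4; clear -Nn; lia.
  by rewrite ler_pdivrMr//; lra.
have lower : n%:R * (I (barycenter step g) - e) <= cost n (displacement step (c n)).
  apply: le_trans (hN1 n (c n) _ (tc n)); last by clear -Nn; lia.
  rewrite I_barycenter// ler_wpM2l//.
  have S : simplex (fun i => (c n i)%:R / n%:R : R).
    by apply: simplex_counts => //; rewrite -(ltr0n R).
  have := hr1 _ (proj1 S); rewrite ltr_distl => h.
  have /andP[] : (ext g - e / 2 < ext (fun i => (c n i)%:R / n%:R) < ext g + e / 2).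
    apply: h => i; rewrite divE normrM normfV [X in X^-1]ger0_norm// ltr_pdivrMr//.
    apply: le_lt_trans (cg n i) _.
    have : 2 / r1 <= n%:R by apply: hN3; clear -Nn; lia.
    by rewrite ler_pdivrMr//; lra.
  lra.
move: lower upper; rewrite -ler_pdivlMl// => lower; rewrite -ler_pdivrMl// => upper.
by rewrite /= mulrN ler_distl; apply/andP; split; lra.
Unshelve. all: by end_near. Qed.

End LargeDeviations.

(** * From the iterated limit of class L to bounds along orbits *)

Lemma limf_esup_lt (X : choiceType) (Y : filteredType X) (R : realType)
    (f : Y -> \bar R) (F : set (set Y)) (x : \bar R) :
  (limf_esup f F < x)%E -> exists2 V, F V & forall y, V y -> (f y < x)%E.
Proof.
rewrite limf_esupE => /ereal_inf_lt[_ [V FV <-] hV]; exists V => // y Vy.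
by apply: le_lt_trans hV; apply: ereal_sup_ubound; exists y.
Qed.

Section OrbitBound.
Context (R : realType) (d : nat) (steps : {fset 'rV[int]_d}).
Context disp (Omega : measurableType disp) (T : 'rV[int]_d -> Omega -> Omega).
Context (g : Omega -> 'rV[int]_d -> R).

Definition orbit_bound (z : 'rV[int]_d) (h : Omega -> R) (w : Omega) := forall e : R, 0 < e ->
  exists2 r : R, 0 < r & exists N, forall n k x, (N <= n)%N -> step_group steps x ->
    (l1norm x <= n)%N -> k%:R <= r * n%:R ->
    \sum_(0 <= j < k) h (T (x + z *+ j) w) <= e * n%:R.

Lemma orbit_max_bound z zt w :
  limf_esup (fun eps : R => limn_esup (orbit_max steps T g z zt w eps)) 0^'+ = 0%E ->
  orbit_bound z (fun w => `|g w zt|) w.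
Proof.
move=> h0 e e0.
have : (limf_esup (fun eps : R => limn_esup (orbit_max steps T g z zt w eps)) 0^'+ < e%:E)%E.
  by rewrite h0 lte_fin.
move=> /limf_esup_lt[V V0 hV].
have [r [r0 Vr]] : exists r : R, 0 < r /\ V r.
  have : \forall r \near (0:R)^'+, 0 < r /\ V r.
    by near=> r; split; near: r => //; exact: nbhs_right_gt.
  by move=> /filter_ex.
exists r => //.
have /limf_esup_lt[W [N _ NW] hW] := hV r Vr.
exists N.+1 => n k x Nn xG xn kr.
have n0 : 0 < n%:R :> R by rewrite ltr0n; clear -Nn; lia.
have := hW n (NW n (ltnW Nn)) => {}hW.
have : ((n%:R^-1 * \sum_(0 <= k < (Num.truncn (r * n%:R)).+1)
            `|g (T (x + z *+ k) w) zt|)%:E <= orbit_max steps T g z zt w r n)%E.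
  apply: ereal_sup_ubound; exists x => //; split=> //.
  by apply: le_trans (euclidean_norm_le_l1 _ _) _; rewrite ler_nat.
move=> /le_lt_trans /(_ hW); rewrite lte_fin ltr_pdivrMl// [n%:R * e]mulrC => /ltW.
apply: le_trans.
have kt : (k <= (Num.truncn (r * n%:R)).+1)%N.
  rewrite ltnW// ltnS Num.Theory.truncn_ge_nat//.
  by rewrite mulr_ge0// ltW.
rewrite (big_cat_nat _ kt)//= lerDl; exact: sumr_ge0.
Unshelve. all: by end_near. Qed.

Lemma orbit_bound_sum z w (h : 'rV[int]_d -> Omega -> R) (s : seq 'rV[int]_d) :
  (forall zt, zt \in s -> orbit_bound z (h zt) w) ->
  orbit_bound z (fun w => \sum_(zt <- s) h zt w) w.
Proof.
elim: s => [|y s IH] hs e e0.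
  exists 1 => //; exists 0%N => n k x _ _ _ _.
  by rewrite big1 ?mulr_ge0 ?(ltW e0)// => j _; rewrite big_nil.
have e20 : 0 < e / 2 by rewrite divr_gt0.
have [r1 r10 [N1 hN1]] := hs y (mem_head _ _) _ e20.
have [|r2 r20 [N2 hN2]] := IH _ _ e20.
  by move=> zt zs; apply: hs; rewrite inE zs orbT.
exists (Num.min r1 r2); first by rewrite lt_min r10.
exists (N1 + N2)%N => n k x Nn xG xn kr.
under eq_bigr do rewrite big_cons.
rewrite big_split /=.
have h1 : k%:R <= r1 * n%:R.
  by apply: le_trans kr _; rewrite ler_wpM2r// ge_min lexx.
have h2 : k%:R <= r2 * n%:R.
  by apply: le_trans kr _; rewrite ler_wpM2r// ge_min lexx orbT.
have := hN1 n k x (leq_trans (leq_addr _ _) Nn) xG xn h1.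
have := hN2 n k x (leq_trans (leq_addl _ _) Nn) xG xn h2.
lra.
Qed.

End OrbitBound.

(** * Reduction to everywhere positive transitions *)

Section PositiveModification.
Context (R : realType) (d : nat) (steps : {fset 'rV[int]_d}).
Hypothesis steps_nonempty : steps != fset0.
Context disp (Omega : measurableType disp) (P : probability Omega R).
Context (T : 'rV[int]_d -> Omega -> Omega) (T_system : measurable_system steps P T).
Context (p : Omega -> 'rV[int]_d -> R) (p_transition : random_transition steps p).
Hypothesis log_p_L : log_transition_in_classL steps P T p.

(* Positive everywhere, so that [ln] is never evaluated at its junk point [0], and
   equal to [p] along the orbit of almost every environment. *)
Definition positive_transition (w : Omega) (z : 'rV[int]_d) : R :=
  if `[< forall y, y \in steps -> 0 < p w y >] then p w z else (#|` steps|%:R)^-1.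

Let card_gt0 : (0 < #|` steps|)%N. Proof. by rewrite cardfs_gt0. Qed.

Lemma positive_transition_gt0 w z : z \in steps -> 0 < positive_transition w z.
Proof.
rewrite /positive_transition; case: asboolP => [h zs|_ _]; first exact: h.
by rewrite invr_gt0 ltr0n.
Qed.

Lemma positive_transition_sum w : \sum_(z <- steps) positive_transition w z = 1.
Proof.
rewrite /positive_transition; case: asboolP => _; first by case: p_transition.
by rewrite big_const_seq count_predT iter_addr_0 -[LHS]mulr_natr mulVf// pnatr_eq0 -lt0n.
Qed.

Let positive_set : set Omega := [set w | forall y, y \in steps -> 0 < p w y].

Let measurable_positive_set : measurable positive_set.
Proof.
have -> : positive_set = \big[setI/setT]_(y <- steps) [set w | y \in steps -> 0 < p w y].
  rewrite -bigcap_seq; apply/seteqP; split=> [w h y _|w h y ys]; first exact: h.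
  exact: (h y).
apply: bigsetI_measurable => y _; case ys: (y \in steps).
  rewrite (_ : [set w | _] = [set w | cst 0 w < p w y]).
    by apply: measurable_lt_set => //; case: p_transition => + _ _; apply.
  by apply/seteqP; split=> w /=; [apply|].
by rewrite (_ : [set w | _] = setT)//; apply/seteqP; split.
Qed.

Lemma measurable_positive_transition z : z \in steps ->
  measurable_fun setT (positive_transition ^~ z).
Proof.
move=> zs.
have -> : positive_transition ^~ z =
    (fun w => if w \in positive_set then p w z else (#|` steps|%:R)^-1).
  by apply/funext => w; rewrite /positive_transition; case: asboolP => h;
    [rewrite mem_set|rewrite memNset].
apply: measurable_fun_ifT => //; last by case: p_transition => + _ _; apply.
apply: (measurable_fun_bool true) => /=.
rewrite setTI (_ : _ @^-1` _ = positive_set); first exact: measurable_positive_set.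
by apply/seteqP; split=> w /=; [move/set_mem|move/mem_set].
Qed.

Lemma integrable_ln_positive_transition z : z \in steps ->
  P.-integrable setT (EFin \o (fun w => ln (positive_transition w z))).
Proof.
move=> zs.
have [pint _] := log_p_L.2 z zs.
have kint : P.-integrable setT (EFin \o cst (`|ln (#|` steps|%:R^-1)| : R)).
  exact: finite_measure_integrable_cst.
have := integrableD measurableT (integrable_abse pint) kint.
apply: le_integrable => //.
  apply/measurable_EFinP.
  exact: measurableT_comp (@measurable_ln R) (measurable_positive_transition zs).
move=> w _; rewrite /= lee_fin [leRHS]ger0_norm ?addr_ge0//.
rewrite /positive_transition; case: asboolP => _; first by rewrite lerDl.
by rewrite lerDr.
Qed.

Definition orbit_positive (w : Omega) := forall x, step_group steps x ->
  forall z, z \in steps -> 0 < p (T x w) z.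

(** Stationarity moves the almost sure positivity at the origin to each site, and there are
    countably many sites. *)
Lemma orbit_positive_ae : {ae P, forall w, orbit_positive w}.
Proof.
apply: ae_forall_count => x.
have [xG|nxG] := pselect (step_group steps x); last by apply: aeW.
have [mT _ _ PT] := T_system.
have : {ae P, forall w, forall z, z \in steps -> 0 < p (T x w) z}.
  apply: (ae_comp_invariant (mT x xG) (PT x xG) (Q := fun w => forall z, z \in steps -> 0 < p w z)).
  apply: ae_forall_count => z; case zs: (z \in steps); last exact: aeW.
  by apply: filterS (log_p_L.1 z zs).
by apply: filterS => w h _; exact: h.
Qed.

Lemma positive_transitionE w x z : orbit_positive w -> step_group steps x ->
  positive_transition (T x w) z = p (T x w) z.
Proof. by move=> pw xG; rewrite /positive_transition asboolT//; exact: pw. Qed.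

Lemma point_prob_positive_transition w n x : orbit_positive w ->
  point_prob steps T positive_transition n w x = point_prob steps T p n w x.
Proof.
move=> pw; have [_ TD T0 _] := T_system.
suff h y : step_group steps y -> point_prob steps T positive_transition n (T y w) x =
    point_prob steps T p n (T y w) x.
  by rewrite -[w]T0; exact/h/step_group0.
elim: n x y => [//|n IH] x y yG /=.
rewrite big_seq [RHS]big_seq; apply: eq_bigr => z zs.
have zG := step_group_step zs.
by rewrite positive_transitionE// -TD// IH//; exact: step_groupD.
Qed.

(** Class L is assumed of [ln p], one step at a time. The bounds are summed over the steps and
    carried over on environments positive along their orbit, where both transitions coincide. *)
Lemma tame_positive_transition : {ae P, forall w, tame steps T positive_transition w}.
Proof.
have : {ae P, forall w, forall zt z, zt \in steps -> z \in steps -> z != 0 ->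
    orbit_bound steps T z (fun w => `|ln (p w zt)|) w}.
  apply: ae_forall_count => zt; apply: ae_forall_count => z.
  case zts: (zt \in steps); last exact: aeW.
  case zs: (z \in steps); last exact: aeW.
  case z0: (z != 0); last exact: aeW.
  have [_ /(_ z zs z0)] := log_p_L.2 zt zts.
  by apply: filterS => w h _ _ _; exact: orbit_max_bound h.
move=> ae1; have ae2 := orbit_positive_ae.
apply: filterS2 ae1 ae2 => w hw pw z zs z0.
have H : orbit_bound steps T z (fun w => \sum_(zt <- steps) `|ln (p w zt)|) w.
  by apply: (orbit_bound_sum (h := fun zt w => `|ln (p w zt)|)) => zt zts; exact: hw.
move=> e e0; have [r r0 [N hN]] := H e e0.
exists r => //; exists N => n k x Nn xG xn kr.
apply: le_trans (hN n k x Nn xG xn kr).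
apply: ler_sum => j _; rewrite /env_cost big_seq [leRHS]big_seq; apply: ler_sum => y ys.
have jG : step_group steps (x + z *+ j).
  apply: step_groupD => //; elim: j => [|j IH]; first exact: step_group0.
  by rewrite mulrS; apply: step_groupD => //; exact: step_group_step.
by rewrite positive_transitionE// -normrN ler_norm.
Qed.

End PositiveModification.

(** * Weights representing points of the hull *)

Section HullRepresentation.
Context (R : realType) (d m : nat) (step : 'I_m -> 'rV[int]_d) (U : set 'rV[R]_d).
Hypothesis U_barycenter : forall zeta, U zeta <->
  exists2 g : 'I_m -> R, simplex g & zeta = barycenter step g.

(** From [zeta] one can move a little further, away from the barycenter of the uniform weights [u],
    and stay in the hull: the point is an affine combination of [zeta] and that barycenter. If [h]
    represents it, then [zeta] is a proper mixture of [h] and [u], and [u] makes all weights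
    positive. *)
Lemma relative_interior_positive zeta : relative_interior U zeta ->
  exists a : 'I_m -> R, [/\ simplex a, forall i, 0 < a i & barycenter step a = zeta].
Proof.
move=> [Uz]; have /U_barycenter[g gS zg] := Uz.
have m0 : (0 < m)%N.
  case: (posnP m) => // m0; have := proj2 gS; rewrite big1 => [/esym/eqP|i _].
    by rewrite oner_eq0.
  by have := ltn_ord i; rewrite {2}m0.
pose u (i : 'I_m) : R := m%:R^-1.
have uS : simplex u.
  split=> [i|]; first by rewrite invr_ge0.
  by rewrite sumr_const card_ord -[LHS]mulr_natl divff// pnatr_eq0 -lt0n.
rewrite {1}zg => /barycenter_near[r r0 hr].
have [s s0 sr] : exists2 s : R, 0 < s & s < r by exists (r / 2); lra.
have s1 : 0 < 1 + s by lra.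
have [|h hS hE] := proj1 (U_barycenter (barycenter step (fun i => (1 + s) * g i + - s * u i))).
  apply: hr => [i|].
    have -> : (1 + s) * g i + - s * u i - g i = s * (g i - u i) by ring.
    rewrite normrM (gtr0_norm s0); apply: le_lt_trans sr; rewrite ger_pMr//.
    have := simplex_le1 i gS; have := simplex_le1 i uS.
    have := proj1 gS i; have := proj1 uS i; rewrite ler_norml; lra.
  exists 2%N, (fun i => if i == ord0 then zeta else barycenter step u),
    (fun i => if i == ord0 then 1 + s else - s); split=> [i||].
  - by case: ifP => _ //; apply/U_barycenter; exists u.
  - by rewrite !big_ord_recl big_ord0 /=; lra.
  - by rewrite !big_ord_recl big_ord0 /= addr0 barycenter_comb zg.
exists (fun i => (1 + s)^-1 * h i + (s / (1 + s)) * u i); split.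
- apply: simplex_comb => //; first by rewrite invr_ge0 ltW.
    by rewrite divr_ge0// ltW.
  by rewrite -[X in X + _]mul1r -mulrDl divff// gt_eqF.
- move=> i; rewrite ltr_wpDl//; first by rewrite mulr_ge0 ?invr_ge0 ?(ltW s1)// (proj1 hS).
  by rewrite mulr_gt0 ?divr_gt0// invr_gt0 ltr0n.
- rewrite barycenter_comb -hE barycenter_comb -zg scalerDr !scalerA mulVf ?gt_eqF//.
  rewrite scale1r -addrA -scalerDl (_ : (1 + s)^-1 * - s + s / (1 + s) = 0) ?scale0r ?addr0//.
  by rewrite mulrN mulrC addNr.
Qed.

End HullRepresentation.

Section StepIndexing.
Context (d : nat) (steps : {fset 'rV[int]_d}).

Definition step_of (i : 'I_(size (enum_fset steps))) : 'rV[int]_d :=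
  tnth (in_tuple (enum_fset steps)) i.

Lemma step_of_mem i : step_of i \in steps.
Proof. exact: mem_tnth. Qed.

Lemma step_of_surj z : z \in steps -> exists i, z = step_of i.
Proof. by move=> zs; have /tnthP[i] : z \in in_tuple (enum_fset steps) by []; exists i. Qed.

Lemma sum_step_of (V : nmodType) (f : 'rV[int]_d -> V) :
  \sum_(z <- steps) f z = \sum_i f (step_of i).
Proof. exact: big_tnth. Qed.

Context (R : realType) (beta : 'rV[R]_d -> 'rV[int]_d -> R).
Hypothesis beta_weights : admissible_weights steps beta.
Notation weight zeta := (fun i => beta zeta (step_of i)).

Lemma weight_simplex zeta : step_hull R steps zeta -> simplex (weight zeta).
Proof.
move=> /beta_weights[b01 b1 _ _]; split=> [i|]; last by rewrite -sum_step_of.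
by have /andP[] := b01 _ (step_of_mem i).
Qed.

Lemma barycenter_weight zeta : step_hull R steps zeta ->
  barycenter step_of (weight zeta) = zeta.
Proof. by move=> /beta_weights[_ _ + _] => {2}->; rewrite /barycenter sum_step_of. Qed.

Lemma step_hullP zeta : step_hull R steps zeta <->
  exists2 g, simplex g & zeta = barycenter step_of g.
Proof.
split=> [zU|[g [g0 g1] ->]].
  by exists (weight zeta); [exact: weight_simplex|rewrite barycenter_weight].
exists (size (enum_fset steps)), (fun i => to_real R (step_of i)), g; split=> // i.
by exists (step_of i) => //; exact: step_of_mem.
Qed.

Context (b : nat -> 'rV[R]_d -> 'rV[int]_d -> bool).
Hypothesis b_corrections : admissible_corrections steps beta b.

(** The floor plus a correction in [{0, 1}] stays within 1 of [n * beta], and the prescribed sum of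
    the corrections makes the total exactly [n]. *)
Lemma xhat_counts zeta : step_hull R steps zeta ->
  exists c : nat -> 'I_(size (enum_fset steps)) -> nat,
  [/\ forall n, total_count (c n) = n,
      forall n i, `|(c n i)%:R - n%:R * weight zeta i| <= 1 &
      forall n, xhat steps beta b n zeta = displacement step_of (c n)].
Proof.
move=> zU; have [w0 _] := weight_simplex zU.
pose z n i : int := Num.floor (n%:R * beta zeta (step_of i)) + (b n zeta (step_of i) : nat)%:Z.
pose c n i := `|z n i|%N.
have cE n i : (c n i)%:Z = z n i.
  by apply: gez0_abs; rewrite addr_ge0// Num.Theory.floor_ge0 mulr_ge0.
exists c; split=> [n|n i|n].
- apply/eqP; rewrite -eqz_nat; apply/eqP; rewrite /total_count.
  rewrite (big_morph _ PoszD (erefl (Posz 0))).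
  under eq_bigr do rewrite cE.
  rewrite big_split /=.
  have [_] := b_corrections n zU; rewrite !sum_step_of => ->.
  by rewrite addrCA subrr addr0.
- have -> : (c n i)%:R = (z n i)%:~R :> R by rewrite -cE.
  rewrite /z intrD; set x := n%:R * _.
  have := Num.Theory.floor_le x; have := Num.Theory.floorD1_gt x.
  rewrite intrD; case: (b _ _ _) => /=; rewrite ler_norml; lra.
- rewrite /xhat sum_step_of /displacement; apply: eq_bigr => i _.
  by rewrite [RHS]pmulrn cE.
Qed.

End StepIndexing.

Theorem theorem4p3 (R : realType) (d : nat) (hd : (1 <= d)%N)
  (steps : {fset 'rV[int]_d}) (steps_nonempty : steps != fset0)
  (disp : measure_display) (Omega : measurableType disp)
  (P : probability Omega R)
  (T : 'rV[int]_d -> Omega -> Omega)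
  (T_system : measurable_system steps P T)
  (T_ergodic : ergodic steps P T)
  (p : Omega -> 'rV[int]_d -> R)
  (p_transition : random_transition steps p)
  (log_p_L : log_transition_in_classL steps P T p)
  (Q : Omega -> probability (path_space d) R)
  (Q_quenched : quenched_law steps T p Q)
  (beta : 'rV[R]_d -> 'rV[int]_d -> R)
  (beta_weights : admissible_weights steps beta)
  (b : nat -> 'rV[R]_d -> 'rV[int]_d -> bool)
  (b_corrections : admissible_corrections steps beta b) :
  exists I : 'rV[R]_d -> R,
    [/\ forall zeta, step_hull R steps zeta -> 0 <= I zeta,
        {within step_hull R steps, continuous I},
        convex_function (step_hull R steps) I,
        {ae P, forall w,
          large_deviation_principle (step_hull R steps)
            (velocity_law (Q w)) I} &
        forall zeta, relative_interior (step_hull R steps) zeta ->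
          {ae P, forall w,
            ((n%:R^-1)%:E *
               lne (Q w [set X : nat -> 'rV[int]_d |
                           X n = xhat steps beta b n zeta]))%E
            @[n --> \oo] --> (- I zeta)%:E}].
Proof.
(* All limits are established for [p']; only [Q_point] returns to [p], since the two have equal
   point probabilities wherever the orbit is positive. *)
pose p' := positive_transition steps p.
have p'_pos w z : z \in steps -> 0 < p' w z by exact: positive_transition_gt0.
have p'_sum w : \sum_(z <- steps) p' w z = 1 by exact: positive_transition_sum.
have p'_meas z : z \in steps -> measurable_fun setT (p' ^~ z).
  exact: measurable_positive_transition.
have p'_int z : z \in steps -> P.-integrable setT (EFin \o (fun w => ln (p' w z))).
  exact: (integrable_ln_positive_transition p_transition log_p_L).
have p'_tame : {ae P, forall w, tame steps T p' w}.
  exact: (tame_positive_transition T_system log_p_L).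
have [_ TD T0 _] := T_system.
have smem := @step_of_mem d steps.
have ssurj := @step_of_surj d steps.
pose F := free_energy steps P T p' (@step_of d steps).
pose C := mean_cost steps P p'.
have C_ge0 : 0 <= C := mean_cost_ge0 T p'_pos p'_sum p'_int.
have F_bound := free_energy_bound T_system T_ergodic p'_meas p'_pos p'_sum p'_int
  p'_tame smem ssurj.
have F_hom := free_energy_hom T_system T_ergodic p'_meas p'_pos p'_sum p'_int
  p'_tame smem ssurj.
have F_sub := free_energy_sub T_system T_ergodic p'_meas p'_pos p'_sum p'_int
  p'_tame smem ssurj.
have F_fiber a b' : positive_counts a -> positive_counts b' ->
    total_count a = total_count b' ->
    displacement (@step_of d steps) a = displacement (@step_of d steps) b' ->
    F a = F b' by move=> _ _; exact: free_energy_fiber.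
(* The given weights [beta] merely select a representation; [I_bary] shows that every other one
   yields the same value. *)
pose I zeta := C + extension F C (fun i => beta zeta (step_of i)).
have U_bary := step_hullP beta_weights.
have I_bary g : simplex g -> I (barycenter (@step_of d steps) g) = C + extension F C g.
  move=> gS; rewrite /I; congr (_ + _).
  have hU : step_hull R steps (barycenter (@step_of d steps) g) by apply/U_bary; exists g.
  have [w0 w1] := weight_simplex beta_weights hU.
  apply: (extension_fiber F_bound F_hom F_fiber) => //; first by case: gS.
    by rewrite w1; case: gS.
  exact: barycenter_weight.
have m_gt0 : (0 < size (enum_fset steps))%N by rewrite (cardfs_gt0 steps).
have typ := typical_ae T_system T_ergodic p'_meas p'_pos p'_sum p'_int p'_tame smem ssurj.
have pos_ae := orbit_positive_ae T_system log_p_L.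
have Q_point w : orbit_positive steps T p w -> forall n x,
    Q w [set X : nat -> 'rV[int]_d | X n = x] = (point_prob steps T p' n w x)%:E.
  move=> pw n x; rewrite /p' (point_prob_positive_transition T_system)//.
  by apply: law_point_prob => //; case: p_transition.
exists I; split.
- exact: (rate_ge0 C_ge0 F_bound U_bary I_bary).
- exact: (rate_continuous F_bound F_hom U_bary I_bary).
- exact: (rate_convex F_bound F_hom F_sub U_bary I_bary).
- apply: filterS2 typ pos_ae => w [w_tame w_cvg] pw; split=> [A _ _|V oV].
    exact: (large_deviation_upper TD T0 p'_pos p'_sum smem ssurj C_ge0 F_bound F_hom F_sub
      I_bary w_tame w_cvg (Q_point w pw)).
  exact: (large_deviation_lower TD T0 p'_pos p'_sum smem ssurj m_gt0 C_ge0 F_bound F_hom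
      U_bary I_bary w_tame w_cvg (Q_point w pw)).
- move=> zeta zri; have zU : step_hull R steps zeta by case: zri.
  have [a [aS a0 az]] := relative_interior_positive U_bary zri.
  have [c [tc cn cx]] := xhat_counts beta_weights b_corrections zU.
  apply: filterS2 typ pos_ae => w [w_tame w_cvg] pw.
  under eq_fun do rewrite cx.
  have wS := weight_simplex beta_weights zU.
  have wz := barycenter_weight beta_weights zU.
  have := point_prob_cvg TD T0 p'_pos p'_sum smem ssurj C_ge0 F_bound F_hom F_sub
      I_bary w_tame w_cvg (Q_point w pw) wS aS a0 (etrans az (esym wz)) tc cn.
  by rewrite wz.
Qed.
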